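(* The orthonormal system $\{\Upsilon_k\}_{k=1}^\infty$ in $L^2_{[0,1]}$ constructed as described in the context is a divergence system: for every real sequence $\{a_k\}_{k=1}^\infty\notin l^2$ the series $\sum_{k=1}^\infty a_k\Upsilon_k(x)$ diverges for almost every $x\in[0,1]$.
   Context: All functions are real-valued and considered up to finitely many points. $\mathbb{N}=\{1,2,\dots\}$. A series diverges at $x$ if its partial sums have no finite limit. Spaces. $\mathcal{E}^k_{[a,b]}$ is the space of functions on $[a,b]$ that are constant on each interval $(a+(i-1)\frac{b-a}{2^k},a+i\frac{b-a}{2^k})$, $1\le i\le 2^k$. For $j>k$, $\mathcal{E}^{k,j}_{[a,b]}$ is the orthogonal complement of $\mathcal{E}^k_{[a,b]}$ in $\mathcal{E}^j_{[a,b]}$ with respect to the $L^2_{[a,b]}$ inner product. Rademacher and Haar functions. $r_n(t)=\mathrm{sgn}(\sin 2^{n+1}\pi t)$, $n\ge 0$. $h_1^{(k)}$ ($k\ge 0$) equals $2^{k/2}$ on $(0,2^{-k-1})$, $-2^{k/2}$ on $(2^{-k-1},2^{-k})$, and $0$ elsewhere on $[0,1]$. Menshov functions. For $k\ge 2$, $M_k$ is the $2$-periodic function on $\mathbb{R}$ with $M_k(x)=\frac{1}{8i}2^{k/2}$ for $x\in(\frac{i-1}{2^k},\frac{i}{2^k})$, $1\le|i|\le 2^k-1$, and $M_k(x)=0$ for $x\in(-2^{-k},0)\cup(1-2^{-k},1)$. Put $M_{k,i}(x)=M_k(x-i2^{-k})$. For each $k$ fix an orthonormal system $\{f_k^i\}_{i=0}^{2^k-1}$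 in $L^2_{[-2,2]}$ with $f_k^i=M_{k,i}$ on $[-1,1]$, $f_k^i=0$ on $[-2,-1)$, $f_k^i|_{[1,2]}\in\mathcal{E}^{k+1}_{[1,2]}$ and $\int_{-2}^2 f_k^i=0$ (such systems exist); extend each $f_k^i$ to $\mathbb{R}$ with period $4$. Functions $g_n^i$, $\psi_\nu$ and numbers $k_n,m_n$. For $0\le i\le 3$ let $g_1^i(x)=2f_2^i(8x-2)$ on $[0,\frac12]$ and $g_1^i(x)=r_{9+i}(x)$ on $(\frac12,1]$. Let $k_1$ be the smallest natural number with $g_1^i\in\mathcal{E}^{k_1}_{[0,1]}$ for all $i$. Let $m_0=0$, $m_1=2^{k_1+2}-6$, and let $\psi_1\equiv 1,\psi_2,\dots,\psi_{m_1}$ be an orthonormal basis of the orthogonal complement in $\mathcal{E}^{k_1+2}_{[0,1]}$ of $\{g_1^i\}_{i=0}^3\cup\{r_{k_1},h_1^{(k_1+1)}\}$. For $n\ge 2$ and $0\le i\le 2^{2n}-1$ define $\widehat g_n^i$ on $[0,1]$ by: $\widehat g_n^i(x)=n^{-1}2^{n^2}f_{2n}^i(2^{2n^2+2}(x-2^{-2n^2}))$ for $x\in[0,2^{-2n^2}]$; $\widehat g_n^i(x)=n^{-1}2^{k/2}f_{2n}^i(2^{k+2}(x-2^{-k}))$ for $x\in(2^{-k},2^{-k+1}]$, $2\le k\le 2n^2$; $\widehat g_n^i(x)=r_{k_{n-1}+4+i}(x)$ for $x\in(\frac12,1]$. Extend $\widehat g_n^i$ with period $1$ and set $g_n^i(x)=\widehat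 g_n^i(2^{k_{n-1}+2n^2+2}x)$. Let $k_n$ be the smallest natural number with $g_n^i\in\mathcal{E}^{k_n}_{[0,1]}$ for all $0\le i\le 2^{2n}-1$. Let $m_n=m_{n-1}+2^{k_n+2}-2^{k_{n-1}+2}-2^{2n}-2$ and let $\{\psi_\nu\}_{\nu=m_{n-1}+1}^{m_n}$ be an orthonormal basis of the orthogonal complement in $\mathcal{E}^{k_{n-1}+2,k_n+2}_{[0,1]}$ of $\{g_n^i\}_{i=0}^{2^{2n}-1}\cup\{r_{k_n},h_1^{(k_n+1)}\}$. Matrices. For $N\in\mathbb{N}$ let $\delta_N=\frac1N\left(1+\frac{1}{\sqrt{N+1}}\right)$ and let $(\kappa^{(N+1)}_{ij})_{1\le i,j\le N+1}$ be the orthogonal matrix with $\kappa^{(N+1)}_{1j}=\frac1{\sqrt{N+1}}$ for all $j$, and for $2\le i\le N+1$: $\kappa^{(N+1)}_{i,N+1}=\frac{1}{\sqrt{N+1}}$, $\kappa^{(N+1)}_{i,i-1}=1-\delta_N$, and $\kappa^{(N+1)}_{ij}=-\delta_N$ for $1\le j\le N$, $j\ne i-1$. Functions $\xi_l$. Let $p(n)=2^{2(k_n+1)}$, $q_n=(p(n)-1)(m_n-m_{n-1})$, and for $m_{n-1}+1\le\nu\le m_n$ let $q_\nu(n)=\sum_{i=1}^{n-1}q_i+(\nu-m_{n-1}-1)(p(n)-1)$. For such $\nu$ and $1\le j\le p(n)$ put $$\phi_j^\nu=\kappa_{1j}^{(p(n))}\psi_\nu+\sum_{i=2}^{p(n)}\kappa_{ij}^{(p(n))}h_1^{(k_{q_\nu(n)+i-1}+1)}.$$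 Let $\rho_n=\sum_{j=1}^n p(j)(m_j-m_{j-1})$, $\rho_0=0$, $\rho_\nu(n)=\rho_{n-1}+(\nu-m_{n-1}-1)p(n)$, and $\xi_l=\phi^\nu_j$ for $l=\rho_\nu(n)+j$, $1\le j\le p(n)$, $m_{n-1}+1\le\nu\le m_n$. Functions $\Upsilon_k$. For $n\in\mathbb{N}$ and $1\le j\le 2^{2n}+1$ put $$\Upsilon_j^n=\kappa_{1j}^{(2^{2n}+1)}\xi_n+\sum_{i=2}^{2^{2n}+1}\kappa_{ij}^{(2^{2n}+1)}g_n^{i-2}.$$ Let $\mu_0=0$, $\mu_m=\mu_{m-1}+2^{2m}+1$, and $\Upsilon_k=\Upsilon_j^m$ for $k=\mu_{m-1}+j$, $1\le j\le 2^{2m}+1$. *)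

(* Defs.v *)
From mathcomp Require Import all_boot all_order all_algebra.
From mathcomp Require Export all_classical all_reals all_analysis.
Import Order.TTheory GRing.Theory Num.Theory.
Import numFieldNormedType.Exports.

Set Implicit Arguments.
Unset Strict Implicit.
Unset Printing Implicit Defensive.

Local Open Scope classical_set_scope.
Local Open Scope ring_scope.

(* Functions on an interval D are represented by total functions R -> R whose
   values outside D are never used; they are compared up to finitely many
   points of D. *)
Definition eq_fin (R : realType) (D : set R) (f g : R -> R) : Prop :=
  finite_set [set x | D x /\ f x != g x].

Definition periodize (R : realType) (a L : R) (f : R -> R) (x : R) : R :=
  f (x - (Num.floor ((x - a) / L))%:~R * L).

Definition inner (R : realType) (a b : R) (f g : R -> R) : R :=
  \int[lebesgue_measure]_(x in `[a, b]) (f x * g x).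

Definition L2 (R : realType) (a b : R) : set (R -> R) :=
  [set f : R -> R | measurable_fun `[a, b] f /\
     (@lebesgue_measure R).-integrable `[a, b] (fun x : R => (f x ^+ 2)%:E)].

Definition orthonormal (R : realType) (a b : R) (I : set nat)
    (phi : nat -> R -> R) : Prop :=
  (forall i, I i -> L2 a b (phi i)) /\
  (forall i j, I i -> I j -> inner a b (phi i) (phi j) = (i == j)%:R).

Definition orthonormal_basis (R : realType) (a b : R) (V : set (R -> R))
    (u v : nat) (phi : nat -> R -> R) : Prop :=
  [/\ orthonormal a b [set nu | (u < nu <= v)%N] phi,
      forall nu, (u < nu <= v)%N -> V (phi nu) &
      forall w, V w -> exists c : nat -> R,
        eq_fin `[a, b] w (fun x => \sum_(u.+1 <= nu < v.+1) c nu * phi nu x)].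

Definition Estep (R : realType) (a b : R) (k : nat) : set (R -> R) :=
  [set f : R -> R | forall i : nat, (1 <= i <= 2 ^ k)%N -> exists c : R,
     eq_fin `]a + i.-1%:R * ((b - a) / 2 ^+ k), a + i%:R * ((b - a) / 2 ^+ k)[
       f (fun=> c)].

Definition Ecompl (R : realType) (a b : R) (k j : nat) : set (R -> R) :=
  [set f : R -> R | Estep a b j f /\ forall e, Estep a b k e -> inner a b f e = 0].

Definition rademacher (R : realType) (n : nat) (t : R) : R :=
  Num.sg (sin (2 ^+ n.+1 * pi * t)).

(* Num.sqrt (2 ^+ k) is 2^(k/2) *)
Definition haar1 (R : realType) (k : nat) (x : R) : R :=
  if (0 < x) && (x < 2 ^- k.+1) then Num.sqrt (2 ^+ k)
  else if (2 ^- k.+1 < x) && (x < 2 ^- k) then - Num.sqrt (2 ^+ k)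
  else 0.

(* For x in [-1, 1) off the grid 2^-k Z, the index i with
   (i-1)/2^k < x < i/2^k is floor (2^k x) + 1; the two intervals where the
   function vanishes correspond to i = 0 and i = 2^k. *)
Definition menshov_base (R : realType) (k : nat) (x : R) : R :=
  let i : int := Num.floor (2 ^+ k * x) + 1 in
  if (i == 0) || (i == 2 ^+ k) then 0
  else (8 * i%:~R)^-1 * Num.sqrt (2 ^+ k).

Definition menshov (R : realType) (k : nat) : R -> R :=
  periodize (-1) 2 (menshov_base k).

Definition menshov_shift (R : realType) (k i : nat) (x : R) : R :=
  menshov k (x - i%:R / 2 ^+ k).

(* The requirements on {f_k^i : 0 <= i < 2^k} for one fixed k, as functions
   on [-2, 2]. *)
Definition menshov_system (R : realType) (k : nat) (f : nat -> R -> R) : Prop :=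
  orthonormal (-2) 2 [set i | (i < 2 ^ k)%N] f /\
  forall i, (i < 2 ^ k)%N ->
    [/\ eq_fin `[-1, 1] (f i) (menshov_shift k i),
        eq_fin `[-2, -1[ (f i) (fun=> 0),
        Estep 1 2 k.+1 (f i) &
        \int[lebesgue_measure]_(x in `[-2, 2]) f i x = 0].

Section Construction.
Variables (R : realType).
(* f k i is f_k^i on [-2, 2]; k n is k_n for n >= 1 (k 0 is never used) *)
Variables (f : nat -> nat -> R -> R) (k : nat -> nat).

Definition fper (r i : nat) : R -> R := periodize (-2) 4 (f r i).

Definition g_first (i : nat) (x : R) : R :=
  if x <= 1 / 2 then 2 * fper 2 i (8 * x - 2) else rademacher (9 + i) x.

(* On (2^(-2n^2), 1/2] the sum has exactly one term. *)
Definition ghat (n i : nat) (x : R) : R :=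
  if x <= 2 ^- (2 * n ^ 2) then
    n%:R^-1 * 2 ^+ (n ^ 2) *
      fper (2 * n) i (2 ^+ (2 * n ^ 2 + 2) * (x - 2 ^- (2 * n ^ 2)))
  else if x <= 1 / 2 then
    \sum_(2 <= l < (2 * n ^ 2).+1 | (2 ^- l < x) && (x <= 2 ^- l.-1))
      n%:R^-1 * Num.sqrt (2 ^+ l) * fper (2 * n) i (2 ^+ (l + 2) * (x - 2 ^- l))
  else rademacher (k n.-1 + 4 + i) x.

Definition g (n i : nat) (x : R) : R :=
  if n == 1%N then g_first i x
  else periodize 0 1 (ghat n i) (2 ^+ (k n.-1 + 2 * n ^ 2 + 2) * x).

Definition is_level (n j : nat) : Prop :=
  (1 <= j)%N /\ forall i, (i < 2 ^ (2 * n))%N -> Estep 0 1 j (g n i).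

Definition is_smallest_level (n j : nat) : Prop :=
  is_level n j /\ forall j', is_level n j' -> (j <= j')%N.

(* Subtraction is truncated; when each k n is the smallest level of the n-th
   block it never truncates here. *)
Fixpoint m (n : nat) : nat :=
  match n with
  | 0 => 0
  | 1 => 2 ^ (k 1 + 2) - 6
  | n'.+1 => m n' + 2 ^ (k n + 2) - 2 ^ (k n' + 2) - 2 ^ (2 * n) - 2
  end%N.

Definition psi_ambient (n : nat) : set (R -> R) :=
  if n == 1%N then Estep 0 1 (k 1 + 2) else Ecompl 0 1 (k n.-1 + 2) (k n + 2).

Definition psi_space (n : nat) : set (R -> R) :=
  [set w : R -> R | [/\ psi_ambient n w,
     forall i, (i < 2 ^ (2 * n))%N -> inner 0 1 w (g n i) = 0,
     inner 0 1 w (rademacher (k n)) = 0 &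
     inner 0 1 w (haar1 (k n).+1) = 0]].

Definition delta (N : nat) : R := N%:R^-1 * (1 + (Num.sqrt N.+1%:R)^-1).

(* kappa D i j is the (i, j) entry, 1 <= i, j <= D, of the D x D matrix
   (so D = N + 1). *)
Definition kappa (D i j : nat) : R :=
  if i == 1%N then (Num.sqrt D%:R)^-1
  else if j == D then (Num.sqrt D%:R)^-1
  else if j == i.-1 then 1 - delta D.-1
  else - delta D.-1.

Definition p (n : nat) : nat := 2 ^ (2 * (k n + 1)).

Definition q (n : nat) : nat := ((p n - 1) * (m n - m n.-1))%N.

Definition qnu (n nu : nat) : nat :=
  (\sum_(1 <= i < n) q i + (nu - m n.-1 - 1) * (p n - 1))%N.

Definition phi (psi : nat -> R -> R) (n nu j : nat) (x : R) : R :=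
  kappa (p n) 1 j * psi nu x +
  \sum_(2 <= i < (p n).+1) kappa (p n) i j * haar1 (k (qnu n nu + i - 1) + 1) x.

Definition rho (n : nat) : nat :=
  (\sum_(1 <= j < n.+1) p j * (m j - m j.-1))%N.

Definition rhonu (n nu : nat) : nat :=
  (rho n.-1 + (nu - m n.-1 - 1) * p n)%N.

Definition upsilon (xi : nat -> R -> R) (n j : nat) (x : R) : R :=
  kappa (2 ^ (2 * n) + 1) 1 j * xi n x +
  \sum_(2 <= i < (2 ^ (2 * n) + 1).+1)
    kappa (2 ^ (2 * n) + 1) i j * g n (i - 2) x.

Definition mu (n : nat) : nat := (\sum_(1 <= l < n.+1) (2 ^ (2 * l) + 1))%N.

End Construction.

(* Sequences are indexed from 1; the value at 0 is ignored. *)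
Definition in_l2 (R : realType) (a : nat -> R) : Prop :=
  cvgn (fun N : nat => \sum_(1 <= l < N.+1) a l ^+ 2).

Definition divergence_system (R : realType) (Phi : nat -> R -> R) : Prop :=
  orthonormal 0 1 [set l | (1 <= l)%N] Phi /\
  forall a : nat -> R, ~ in_l2 a ->
    {ae @lebesgue_measure R, forall x, x \in `[0, 1] ->
       ~ cvgn (fun N : nat => \sum_(1 <= l < N.+1) a l * Phi l x)}.

(* Main.v *)
(* Off a countable set every function of the construction is a step function on
   dyadic intervals, so integrals and probabilities become averages over the points
   of a dyadic grid shifted to avoid all exceptional points, and a function of
   2^K x that is 1-periodic is independent of every step function of level K.

   Block n of the system is the image of xi_n, g_n^0, g_n^1, ... under an orthogonal
   matrix; let b_n be the n-th block of coefficients and alpha_n its coordinate on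
   xi_n, proportional to the sum of the entries of b_n.  Since xi_n(x) -> 0 almost
   everywhere, only the g_n^i can make a series diverge.

   If, for some theta > 0, the blocks with |alpha_n| >= theta |b_n| and |b_n| not too
   small have sum of min(1, |b_n|^2) infinite, then on each of them the harmonic decay
   of the Menshov functions, |b_n| being compensated by the choice of one of the
   scales 2^-l of ghat_n, makes a sub-block sum exceed a fixed constant on a set of
   measure at least a multiple of min(1, |b_n|^2).  These sets are independent, so
   almost every x lies in infinitely many of them.

   Otherwise sum alpha_n^2 <= C + theta^2 sum |b_n|^2 for every theta > 0, so almost
   all of the infinite energy sits on the g_n^i.  On their Rademacher half these have
   bounded fourth moments, hence the sums over blocks p, ..., q have second moment
   comparable to that energy on any set of positive measure, and cannot stay bounded
   there. *)

Require Import Defs.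
From mathcomp Require Import all_boot all_order all_algebra.
From mathcomp Require Import all_classical all_reals all_analysis.
From mathcomp Require Import measurable_realfun zify ring lra.
Import Order.TTheory GRing.Theory Num.Theory.
Import numFieldNormedType.Exports.

Set Implicit Arguments.
Unset Strict Implicit.
Unset Printing Implicit Defensive.

Local Open Scope classical_set_scope.
Local Open Scope ring_scope.

(** The f_k^i have mean zero, because the Menshov kernel 1/i takes both signs, so a full block sum
    averages to zero over x and says nothing about size. The remedy is a sub-block that depends on
    x: the indices i for which x lies on the positive branch of the i-th shift form an interval, and
    there the kernel is one-sided. Summed over the cells of x, every coefficient then receives the
    same factor H = 1 + 1/2 + ... + 1/(N-1), N = 2^(2n). The mean is thus governed by the sum of the
    entries of b_n, that is by alpha_n, and a second moment bound turns a large mean into a large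
    value on a fixed proportion of the cells. The factor 1/n of ghat_n^i, which lets 2n^2 scales
    share half of the unit norm, is offset by H >= n.

    The parameter theta is free because the second case needs it small. There the xi_n enter an
    upper bound through sum alpha_n^2, while the g_n^i give a lower bound proportional to the
    measure of the set where the partial sums stay bounded. Refuting a measure e takes theta^2 of
    order e. *)

Lemma countableU (T : Type) (A B : set T) :
  countable A -> countable B -> countable (A `|` B).
Proof.
move=> cA cB.
have -> : A `|` B = \bigcup_(b in [set: bool]) (if b then A else B).
  apply/seteqP; split=> x.
    by case=> ?; [exists true | exists false].
  by move=> [[]] _ ?; [left|right].
by apply: bigcup_countable => // -[].
Qed.

(** The quadratic form u^2 a + 2uvb + v^2 c is nonnegative; the point (-b, a) gives the inequality.
    When a = 0 the form is affine in u, which forces b = 0. *)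
Lemma weighted_cauchy_schwarz (R : realFieldType) (I : Type) (s : seq I) (P : pred I)
    (w x y : I -> R) : (forall i, P i -> 0 <= w i) ->
  (\sum_(i <- s | P i) w i * (x i * y i)) ^+ 2 <=
  (\sum_(i <- s | P i) w i * x i ^+ 2) * (\sum_(i <- s | P i) w i * y i ^+ 2).
Proof.
move=> w0; set b := \sum_(i <- s | P i) w i * (x i * y i).
set a := \sum_(i <- s | P i) w i * x i ^+ 2; set c := \sum_(i <- s | P i) w i * y i ^+ 2.
have h (u v : R) : 0 <= u ^+ 2 * a + 2 * u * v * b + v ^+ 2 * c.
  rewrite /a /b /c !mulr_sumr -!big_split /=; apply: sumr_ge0 => i Pi.
  have -> : u ^+ 2 * (w i * x i ^+ 2) + 2 * u * v * (w i * (x i * y i)) +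
      v ^+ 2 * (w i * y i ^+ 2) = w i * (u * x i + v * y i) ^+ 2 by ring.
  by rewrite mulr_ge0 ?w0 // sqr_ge0.
have a0 : 0 <= a by apply: sumr_ge0 => i Pi; rewrite mulr_ge0 ?w0 // sqr_ge0.
have [a00|an0] := eqVneq a 0.
  rewrite a00 mul0r; have [->|b0] := eqVneq b 0; first by rewrite expr0n.
  have := h (- (c + 1) / (2 * b)) 1; rewrite a00 mulr0 add0r expr1n mul1r.
  have -> : 2 * (- (c + 1) / (2 * b)) * 1 * b = - (c + 1) by field.
  by move=> ?; exfalso; lra.
have ap : 0 < a by rewrite lt_neqAle eq_sym an0.
have := h (- b) a; nra.
Qed.

Lemma sum_cauchy_schwarz (R : realFieldType) (I : Type) (s : seq I) (P : pred I)
    (x y : I -> R) :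
  (\sum_(i <- s | P i) x i * y i) ^+ 2 <=
  (\sum_(i <- s | P i) x i ^+ 2) * (\sum_(i <- s | P i) y i ^+ 2).
Proof.
have := @weighted_cauchy_schwarz R I s P (fun=> 1) x y (fun _ _ => ler01).
by under eq_bigr do rewrite mul1r; under [X in _ <= X * _]eq_bigr do rewrite mul1r;
   under [X in _ <= _ * X]eq_bigr do rewrite mul1r.
Qed.

(** * Lebesgue integrals of functions known off a countable set *)

Section StepIntegral.
Context {R : realType}.
Local Notation mu := (@lebesgue_measure R).

Lemma measurable_countable (Z : set R) : countable Z -> measurable Z.
Proof.
by move=> cZ; apply: countable_measurable => // t; exact: measurable_set1.
Qed.

Lemma measurable_fun_mod_countable (D Z : set R) (F G : R -> R) :
  measurable D -> countable Z -> (forall x, D x -> ~ Z x -> F x = G x) ->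
  measurable_fun D G -> measurable_fun D F.
Proof.
move=> mD cZ FG mG _ B mB.
have -> : D `&` F @^-1` B =
    ((D `&` G @^-1` B) `\` Z) `|` (D `&` F @^-1` B `&` Z).
  apply/seteqP; split=> x /=.
    move=> [Dx Bx]; case: (pselect (Z x)) => Zx; [by right|left].
    by rewrite -FG.
  by move=> [[[Dx Bx] Zx]|[[Dx Bx] Zx]] //; split => //; rewrite FG.
apply: measurableU.
  by apply: measurableD; [exact: mG | exact: measurable_countable].
by apply: measurable_countable; apply: sub_countable cZ; apply: subset_card_le => x [].
Qed.

Lemma integral_mod_countable_cst (D Z : set R) (F : R -> R) (c : R) :
  measurable D -> (mu D < +oo)%E -> countable Z ->
  (forall x, D x -> ~ Z x -> F x = c) ->
  mu.-integrable D (EFin \o F) /\ \int[mu]_(x in D) F x = c * fine (mu D).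
Proof.
move=> mD fD cZ FG.
have mF : measurable_fun D F.
  by apply: (measurable_fun_mod_countable mD cZ FG); exact: measurable_cst.
have nZ : mu.-negligible Z.
  exists Z; split => //; first exact: measurable_countable.
  exact: countable_lebesgue_measure0.
have ae1 (f : R -> \bar R) : ae_eq mu D (fun x => f (F x)) (fun=> f c).
  by apply: (negligibleS _ nZ) => x /= /not_implyP[Dx] h;
     apply: contrapT => Zx; apply: h; rewrite FG.
have mEF : measurable_fun D (EFin \o F) by exact/measurable_EFinP.
split.
  apply/integrableP; split => //.
  have -> : (\int[mu]_(x in D) `|(EFin \o F) x| = \int[mu]_(x in D) `|c%:E|)%E.
    apply: ae_eq_integral => //; first exact: measurableT_comp.
    exact: (ae1 (fun y => `|y%:E|%E)).
  by rewrite integral_cst //= lte_mul_pinfty.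
rewrite /Rintegral.
have -> : (\int[mu]_(x in D) (F x)%:E = \int[mu]_(x in D) c%:E)%E.
  by apply: ae_eq_integral => //; exact: (ae1 EFin).
by rewrite integral_cst //= fineM // ge0_fin_numE.
Qed.

Lemma integrable_setU (A B : set R) (F : R -> R) :
  measurable A -> measurable B -> [disjoint A & B] ->
  mu.-integrable A (EFin \o F) -> mu.-integrable B (EFin \o F) ->
  mu.-integrable (A `|` B) (EFin \o F).
Proof.
move=> mA mB dAB /integrableP[mFA iA] /integrableP[mFB iB].
have mU : measurable_fun (A `|` B) (EFin \o F) by apply/measurable_funU.
apply/integrableP; split => //.
rewrite ge0_integral_setU //; first exact: lte_add_pinfty.
exact: measurableT_comp.
Qed.

Lemma step_integral (Z : set R) (a h : R) (n : nat) (F : R -> R) (c : nat -> R) :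
  countable Z -> 0 <= h ->
  (forall i x, (i < n)%N -> ~ Z x ->
     a + i%:R * h < x -> x < a + i.+1%:R * h -> F x = c i) ->
  mu.-integrable `[a, a + n%:R * h] (EFin \o F) /\
  \int[mu]_(x in `[a, a + n%:R * h]) F x = h * \sum_(i < n) c i.
Proof.
move=> cZ h0; elim: n => [|n IH] FG.
  rewrite mul0r addr0 set_itv1 big_ord0 mulr0 Rintegral_set1; split => //.
  have m1 : mu [set a] = 0 by apply: countable_lebesgue_measure0; exact: countable1.
  apply: null_set_integrable => //; exact: measurable_fun_set1.
have [|iA eA] := IH; first by move=> i x ilt; apply: FG; exact: ltnW.
set u := a + n%:R * h in iA eA *; set v := a + n.+1%:R * h.
have uv : v = u + h by rewrite /u /v -natr1; ring.
have mB : mu `]u, v] = h%:E.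
  rewrite lebesgue_measure_itv /= lte_fin uv ltrDl; case: ltP => hh.
    by rewrite -EFinB; congr EFin; ring.
  by congr EFin; apply/eqP; rewrite eq_le h0 hh.
(* The right endpoint joins the exceptional set, since the hypothesis covers only the open cell. *)
have [||||iB eB] := @integral_mod_countable_cst `]u, v] (Z `|` [set v]) F (c n).
- by [].
- by rewrite mB ltry.
- by apply: countableU => //; exact: countable1.
- move=> x /=; rewrite in_itv /= => /andP[ux xv] /not_orP[Zx /eqP xv'].
  by apply: FG => //; rewrite lt_neqAle xv' xv.
have dAB : [disjoint `[a, u] & `]u, v] ].
  apply/disj_setPS => x /= []; rewrite !in_itv /= => /andP[_ xu] /andP[ux _].
  by move: (lt_le_trans ux xu); rewrite ltxx.
have -> : [set` `[a, v]] = [set` `[a, u]] `|` [set` `]u, v]] :> set R.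
  apply/seteqP; split => x /=; rewrite !in_itv /=.
    by move=> /andP[-> ->]; case: (leP x u); [left|right].
  move=> [/andP[-> xu]|/andP[ux ->]] /=.
    by rewrite (le_trans xu) // uv lerDl.
  rewrite andbT; apply: ltW; apply: le_lt_trans ux.
  by rewrite /u lerDl mulr_ge0.
have iU := integrable_setU (measurable_itv _) (measurable_itv _) dAB iA iB.
split=> //.
rewrite Rintegral_setU // eA eB big_ord_recr /= mulrDr; congr (_ + _).
have -> : fine (mu `]u, v]) = h by rewrite mB.
by rewrite mulrC.
Qed.

End StepIntegral.

(** * Generic points and averages over dyadic sample points *)

Section Generic.
Context {R : realType}.

Definition is_rational (a : R) : Prop := exists u : rat, a = ratr u.

Lemma rational_nat n : is_rational n%:R.
Proof. by exists n%:R; rewrite ratr_nat. Qed.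

Lemma rationalN a : is_rational a -> is_rational (- a).
Proof. by move=> [u ->]; exists (- u); rewrite rmorphN. Qed.

Lemma rationalD a b : is_rational a -> is_rational b -> is_rational (a + b).
Proof. by move=> [u ->] [v ->]; exists (u + v); rewrite rmorphD. Qed.

Lemma rationalM a b : is_rational a -> is_rational b -> is_rational (a * b).
Proof. by move=> [u ->] [v ->]; exists (u * v); rewrite rmorphM. Qed.

Lemma rationalV a : is_rational a -> is_rational a^-1.
Proof. by move=> [u ->]; exists u^-1; rewrite fmorphV. Qed.

Lemma rational_expn a n : is_rational a -> is_rational (a ^+ n).
Proof. by move=> [u ->]; exists (u ^+ n); rewrite rmorphXn. Qed.

Variable Z : set R.

(* A point is generic when it avoids every image of the exceptional set Z under
   a rational affine map; generic points are then stable under such maps. *)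
Definition generic (x : R) : Prop :=
  forall a b y, is_rational a -> is_rational b -> Z y -> x <> a * y + b.

Lemma countable_nongeneric : countable Z -> countable [set x | ~ generic x].
Proof.
move=> cZ.
have -> : [set x | ~ generic x] = \bigcup_(u in [set: rat])
    \bigcup_(v in [set: rat]) \bigcup_(y in Z) [set ratr u * y + ratr v].
  apply/seteqP; split=> x /=.
    move=> nx; apply: contrapT => h; apply: nx => a b y [u ->] [v ->] Zy xE.
    by apply: h; exists u => //; exists v => //; exists y.
  move=> [u _ [v _ [y Zy ->]]] /(_ (ratr u) (ratr v) y) h.
  by apply: h => //; [exists u | exists v].
apply: bigcup_countable => // u _; apply: bigcup_countable => // v _.
by apply: bigcup_countable => // y _; exact: countable1.
Qed.

Lemma generic_affine x a b :
  generic x -> is_rational a -> is_rational b -> a != 0 -> generic (a * x + b).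
Proof.
move=> gx ra rb a0 c d y rc rd Zy E.
apply: (gx (a^-1 * c) (a^-1 * (d - b)) y) => //.
- exact: rationalM (rationalV ra) rc.
- by apply: rationalM (rationalV ra) _; exact: rationalD rd (rationalN rb).
- apply: (mulfI a0); have -> : a * x = c * y + d - b by rewrite -E addrK.
  by field.
Qed.

Lemma genericZ x a : generic x -> is_rational a -> a != 0 -> generic (a * x).
Proof.
move=> gx ra a0; rewrite -[a * x]addr0; apply: generic_affine => //.
exact: (rational_nat 0).
Qed.

Lemma genericD x b : generic x -> is_rational b -> generic (x + b).
Proof.
move=> gx rb; rewrite -[x]mul1r; apply: generic_affine => //.
exact: (rational_nat 1).
Qed.

Lemma rational_pow2 n : is_rational (2 ^+ n).
Proof. exact: rational_expn (rational_nat 2). Qed.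

Lemma generic_pow2 n x : generic x -> generic (2 ^+ n * x).
Proof.
by move=> gx; apply: genericZ => //; exact: rational_pow2.
Qed.

Hypothesis Z0 : Z 0.

(** Every rational a is the image of the point 0 of Z under y -> y + a. Generic points therefore
    avoid all dyadic endpoints. *)
Lemma generic_irrational x a : generic x -> is_rational a -> x != a.
Proof.
move=> gx ra; apply/eqP => xa; apply: (gx 1 a 0) => //; first exact: (rational_nat 1).
by rewrite mulr0 add0r.
Qed.

Lemma generic_notin x : generic x -> ~ Z x.
Proof.
move=> gx Zx; apply: (gx 1 0 x) => //.
- exact: (rational_nat 1).
- exact: (rational_nat 0).
- by rewrite mul1r addr0.
Qed.

Lemma exists_generic : countable Z -> exists tau, [/\ 0 < tau, tau < 1 & generic tau].
Proof.
move=> cZ; apply: contrapT => h.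
have : countable [set` `]0 : R, 1[].
  apply: sub_countable (countable_nongeneric cZ).
  apply: subset_card_le => x /=; rewrite in_itv /= => /andP[x0 x1] gx.
  by apply: h; exists x.
move=> /countable_lebesgue_measure0; rewrite lebesgue_measure_itv /= lte_fin ltr01.
by rewrite sube0 => /eqP; rewrite eqe oner_eq0.
Qed.

End Generic.

(** * Dyadic cells *)

Definition cell (R : realType) (L : nat) (x : R) : nat := Num.truncn (2 ^+ L * x).

Section Cell.
Context {R : realType}.
Implicit Types (x : R).

Lemma cellP L x z : 0 <= x -> (cell L x = z <-> z%:R <= 2 ^+ L * x < z.+1%:R).
Proof.
move=> x0; split => [<-|]; first by apply: truncn_itv; rewrite mulr_ge0 // exprn_ge0.
exact: truncn_def.
Qed.

Lemma cell_lt L x : 0 <= x < 1 -> (cell L x < 2 ^ L)%N.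
Proof.
move=> /andP[x0 x1]; rewrite truncn_lt_nat; last by rewrite mulr_ge0 // exprn_ge0.
by rewrite natrX gtr_pMr // exprn_gt0.
Qed.

Lemma cellD L K x : 0 <= x -> cell K x = (cell (L + K) x %/ 2 ^ L)%N.
Proof.
move=> x0; apply/cellP => //.
have /andP[h1 h2] : (cell (L + K) x)%:R <= 2 ^+ (L + K) * x < (cell (L + K) x).+1%:R.
  exact/cellP.
set z := cell _ _ in h1 h2 *.
have p0 : 0 < 2 ^+ L :> R by rewrite exprn_gt0.
have zE := divn_eq z (2 ^ L); set q := (z %/ _)%N in zE *; set r := (z %% _)%N in zE.
have r2 : (r < 2 ^ L)%N by rewrite ltn_mod expn_gt0.
rewrite -(ler_pM2l p0) -(ltr_pM2l p0) mulrA -exprD.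
have e w : 2 ^+ L * w%:R = (2 ^ L * w)%:R :> R by rewrite natrM natrX.
rewrite !e; apply/andP; split; first by apply: le_trans h1; rewrite ler_nat zE mulnC leq_addr.
by apply: lt_le_trans h2 _; rewrite ler_nat zE mulnS mulnC addnC ltn_add2r.
Qed.

Lemma cell_le L K x : 0 <= x -> (K <= L)%N -> cell K x = (cell L x %/ 2 ^ (L - K))%N.
Proof. by move=> x0 KL; rewrite (cellD (L - K)) // subnK. Qed.

End Cell.

Lemma sum_ord_mul (V : nmodType) (a b : nat) (F : nat -> V) :
  \sum_(z < a * b) F z = \sum_(i < a) \sum_(j < b) F (i * b + j)%N.
Proof.
elim: a => [|a IH]; first by rewrite !big_ord0.
rewrite big_ord_recr /= -IH mulSnr -!(big_mkord xpredT F) /=.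
rewrite (big_cat_nat (n := (a * b)%N)) ?leq_addr //=; congr (_ + _).
rewrite -{1}[(a * b)%N]add0n big_addn addnC addnK big_mkord.
by apply: eq_bigr => j _; rewrite addnC.
Qed.

(* The offset makes every sample point generic, so that averaging a dyadic step
   function over the sample points of a fine level computes its integral. *)
Record sampling (R : realType) := Sampling {
  exceptional : set R;
  offset : R;
  exceptional0 : exceptional 0;
  exceptional_countable : countable exceptional;
  offset_gt0 : 0 < offset;
  offset_lt1 : offset < 1;
  offset_generic : generic exceptional offset }.

Section Average.
Context {R : realType}.
Variable S : sampling R.
Local Notation Z := (exceptional S).
Local Notation tau := (offset S).
Let Z0 : Z 0 := exceptional0 S.
Let cZ : countable Z := exceptional_countable S.
Let tau0 : 0 < tau := offset_gt0 S.
Let tau1 : tau < 1 := offset_lt1 S.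
Let gtau : generic Z tau := @offset_generic R S.
Implicit Types (F G H : R -> R).

Definition unitg (x : R) : Prop := [/\ 0 < x, x < 1 & generic Z x].

(** The offset is scaled with the grid: the same tau at every level makes multiplication by 2^K
    carry the sample points of level K + L to those of level L, modulo integers. *)
Definition pt (L z : nat) : R := (z%:R + tau) / 2 ^+ L.

Lemma pt_itv L z : (z < 2 ^ L)%N -> 0 < pt L z < 1.
Proof.
move=> zL; have p0 : 0 < 2 ^+ L :> R by rewrite exprn_gt0.
rewrite /pt divr_gt0 //=; last by rewrite ltr_wpDl.
rewrite ltr_pdivrMr // mul1r -natrX.
apply: lt_le_trans (_ : z.+1%:R <= _); last by rewrite ler_nat.
by rewrite -natr1 ltrD2l.
Qed.

Lemma pt_unitg L z : (z < 2 ^ L)%N -> unitg (pt L z).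
Proof.
move=> zL; have /andP[h0 h1] := pt_itv zL; split => //.
rewrite /pt mulrC; apply: genericZ; last by rewrite invr_eq0 expf_neq0.
  by rewrite addrC; apply: genericD => //; exact: rational_nat.
exact: rationalV (rational_pow2 _).
Qed.

Lemma scale_pt K L z : 2 ^+ K * pt (K + L) z = pt L z.
Proof. by rewrite /pt exprD; field; rewrite !expf_neq0. Qed.

Lemma pt_split L i j : pt L (i * 2 ^ L + j) = i%:R + pt L j.
Proof.
rewrite /pt natrD natrM natrX; field.
by rewrite expf_neq0.
Qed.

Lemma cell_pt L z : (z < 2 ^ L)%N -> cell L (pt L z) = z.
Proof.
move=> zL; have /andP[h0 h1] := pt_itv zL; apply/cellP; first exact: ltW.
have -> : 2 ^+ L * pt L z = z%:R + tau by rewrite /pt mulrC divfK // expf_neq0.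
rewrite lerDl ltW //=.
by rewrite -natr1 ltrD2l.
Qed.

(** The codomain is arbitrary so that events, seen as functions into [Prop], are covered by the same
    notion. *)
Definition stepf (T : Type) (L : nat) (F : R -> T) : Prop :=
  forall x y, unitg x -> unitg y -> cell L x = cell L y -> F x = F y.

Lemma stepf_le T L L' (F : R -> T) : (L <= L')%N -> stepf L F -> stepf L' F.
Proof.
move=> LL sF x y ux uy e; apply: sF => //.
case: ux => /ltW x0 _ _; case: uy => /ltW y0 _ _.
by rewrite (cell_le x0 LL) (cell_le y0 LL) e.
Qed.

Lemma stepf_cst T L (c : T) : stepf L (fun=> c).
Proof. by []. Qed.

Lemma stepf_comp T U L (f : T -> U) (F : R -> T) :
  stepf L F -> stepf L (fun x => f (F x)).
Proof. by move=> sF x y ux uy e; rewrite (sF x y). Qed.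

Lemma stepf_comp2 T U V L (f : T -> U -> V) (F : R -> T) (G : R -> U) :
  stepf L F -> stepf L G -> stepf L (fun x => f (F x) (G x)).
Proof. by move=> sF sG x y ux uy e; rewrite (sF x y) // (sG x y). Qed.

Lemma stepf_eq T L (F G : R -> T) :
  (forall x, unitg x -> F x = G x) -> stepf L G -> stepf L F.
Proof. by move=> FG sG x y ux uy e; rewrite !FG //; exact: sG. Qed.

Lemma stepf_sum_nat (m n : nat) L (F : nat -> R -> R) :
  (forall i, (m <= i < n)%N -> stepf L (F i)) ->
  stepf L (fun x => \sum_(m <= i < n) F i x).
Proof. by move=> sF x y ux uy e; apply: eq_big_nat => i Pi; exact: sF. Qed.

Lemma stepf_sum_ord (n : nat) L (F : nat -> R -> R) :
  (forall i, (i < n)%N -> stepf L (F i)) ->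
  stepf L (fun x => \sum_(i < n) F i x).
Proof. by move=> sF x y ux uy e; apply: eq_bigr => i _; exact: sF. Qed.

Lemma stepfD L F G : stepf L F -> stepf L G -> stepf L (fun x => F x + G x).
Proof. exact: stepf_comp2. Qed.

Lemma stepfM L F G : stepf L F -> stepf L G -> stepf L (fun x => F x * G x).
Proof. exact: stepf_comp2. Qed.

Lemma stepfZ L (c : R) F : stepf L F -> stepf L (fun x => c * F x).
Proof. exact: stepf_comp. Qed.

Lemma stepf_cell L : stepf L (cell L).
Proof. by []. Qed.

Lemma unitg_frac K x : unitg x -> unitg (2 ^+ K * x - (cell K x)%:R).
Proof.
move=> [x0 x1 gx].
have /andP[h1 h2] : (cell K x)%:R <= 2 ^+ K * x < (cell K x).+1%:R.
  by apply/cellP => //; exact: ltW.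
have g2 : generic Z (2 ^+ K * x) by exact: generic_pow2.
split; last by apply: genericD => //; exact: rationalN (rational_nat _).
  rewrite subr_gt0 lt_neqAle h1 andbT eq_sym.
  by apply: (generic_irrational Z0 g2); exact: rational_nat.
by rewrite ltrBlDr addrC natr1.
Qed.

Definition periodic1 (T : Type) (G : R -> T) : Prop := forall y (n : nat), G (n%:R + y) = G y.

Lemma periodic_frac T (G : R -> T) K x : periodic1 G ->
  G (2 ^+ K * x - (cell K x)%:R) = G (2 ^+ K * x).
Proof. by move=> pG; rewrite -(pG _ (cell K x)) addrC subrK. Qed.

Lemma cell_frac K L x : unitg x ->
  cell L (2 ^+ K * x - (cell K x)%:R) = (cell (L + K) x %% 2 ^ L)%N.
Proof.
move=> ux; have [x0 x1 gx] := ux; have [y0 y1 gy] := unitg_frac K ux.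
apply/cellP; first exact: ltW.
have xL : (cell (L + K) x)%:R <= 2 ^+ (L + K) * x < (cell (L + K) x).+1%:R.
  by apply/cellP => //; exact: ltW.
rewrite (cellD L K (ltW x0)).
have e : (cell (L + K) x %% 2 ^ L)%:R =
    (cell (L + K) x)%:R - 2 ^+ L * (cell (L + K) x %/ 2 ^ L)%:R :> R.
  rewrite {2}(divn_eq (cell (L + K) x) (2 ^ L)) natrD natrM natrX; ring.
rewrite -natr1 e mulrBr mulrA -exprD.
move: xL; rewrite -natr1 => /andP[xL1 xL2]; apply/andP; split; lra.
Qed.

Definition av (L : nat) F : R := 2 ^- L * \sum_(z < 2 ^ L) F (pt L z).

Lemma eq_av L F G : (forall x, unitg x -> F x = G x) -> av L F = av L G.
Proof.
by move=> FG; congr (_ * _); apply: eq_bigr => z _; rewrite FG //; exact: pt_unitg.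
Qed.

Lemma avD L F G : av L (fun x => F x + G x) = av L F + av L G.
Proof. by rewrite /av big_split mulrDr. Qed.

Lemma avZ L (c : R) F : av L (fun x => c * F x) = c * av L F.
Proof. by rewrite /av -mulr_sumr mulrCA. Qed.

Lemma avN L F : av L (fun x => - F x) = - av L F.
Proof. by rewrite /av sumrN mulrN. Qed.

Lemma avB L F G : av L (fun x => F x - G x) = av L F - av L G.
Proof. by rewrite avD avN. Qed.

Lemma av_sum (I : Type) (r : seq I) (P : pred I) L (F : I -> R -> R) :
  av L (fun x => \sum_(i <- r | P i) F i x) = \sum_(i <- r | P i) av L (F i).
Proof. by rewrite /av exchange_big /= mulr_sumr. Qed.

Lemma av_cst L (c : R) : av L (fun=> c) = c.
Proof.
by rewrite /av sumr_const card_ord -(mulr_natl c) natrX mulrA mulVf ?mul1r.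
Qed.

Lemma pow2V_ge0 L : 0 <= 2 ^- L :> R.
Proof. by rewrite invr_ge0 exprn_ge0. Qed.

Lemma av_ge0 L F : (forall x, unitg x -> 0 <= F x) -> 0 <= av L F.
Proof.
move=> F0; rewrite mulr_ge0 ?pow2V_ge0 // sumr_ge0 // => z _.
by apply: F0; exact: pt_unitg.
Qed.

Lemma av_le L F G : (forall x, unitg x -> F x <= G x) -> av L F <= av L G.
Proof.
move=> FG; rewrite -subr_ge0 -avB; apply: av_ge0 => x ux.
by rewrite subr_ge0 FG.
Qed.

Lemma av_cauchy_schwarz L F G :
  av L (fun x => F x * G x) ^+ 2 <= av L (fun x => F x ^+ 2) * av L (fun x => G x ^+ 2).
Proof.
have avE H : av L H = \sum_(z < 2 ^ L) 2 ^- L * H (pt L z) by rewrite /av mulr_sumr.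
rewrite !avE; apply: (weighted_cauchy_schwarz (w := fun=> 2 ^- L) _ (fun z : 'I__ => F (pt L z))).
by move=> z _; exact: pow2V_ge0.
Qed.

Lemma stepf_pt (T : Type) L (F : R -> T) x : stepf L F -> unitg x -> F x = F (pt L (cell L x)).
Proof.
move=> sF ux; have [x0 x1 _] := ux.
have cL : (cell L x < 2 ^ L)%N by apply: cell_lt; rewrite x1 ltW.
by apply: sF => //; [exact: pt_unitg | rewrite cell_pt].
Qed.

Lemma stepf_pt_fine (T : Type) K L (F : R -> T) i j : (K <= L)%N -> stepf K F ->
  (i < 2 ^ K)%N -> (j < 2 ^ (L - K))%N -> F (pt L (i * 2 ^ (L - K) + j)) = F (pt K i).
Proof.
move=> KL sF iK jL; have h : (i * 2 ^ (L - K) + j < 2 ^ L)%N.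
  rewrite -{2}(subnKC KL) expnD; apply: leq_trans (_ : i.+1 * 2 ^ (L - K) <= _)%N.
    by rewrite mulSn addnC ltn_add2r.
  by rewrite leq_mul2r iK orbT.
apply: sF; [exact: pt_unitg | exact: pt_unitg |].
have /andP[p0 _] := pt_itv h.
rewrite (cell_pt iK) (cell_le (ltW p0) KL) (cell_pt h) divnMDl ?expn_gt0 //.
by rewrite divn_small // addn0.
Qed.

Lemma av_stepf K L F : (K <= L)%N -> stepf K F -> av L F = av K F.
Proof.
move=> KL sF; rewrite /av.
have eL : (2 ^ L = 2 ^ K * 2 ^ (L - K))%N by rewrite -expnD subnKC.
rewrite eL (sum_ord_mul _ _ (fun z => F (pt L z))).
have ptF := stepf_pt_fine KL sF.
under eq_bigr => i _ do under eq_bigr => j _ do rewrite ptF //.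
under eq_bigr => i _ do rewrite sumr_const card_ord -(mulr_natl (F _)) natrX.
rewrite -mulr_sumr mulrA; congr (_ * _).
rewrite -{1}(subnKC KL) exprD invfM -mulrA mulVf ?mulr1 // expf_neq0 //.
Qed.

(** Number the sample points of level L as i 2^(L-K) + j: F sees only i, and x -> G (2^K x) sees
    only j, so the double sum factors. *)
Lemma av_indep K L F G : (K <= L)%N -> stepf K F -> periodic1 G ->
  av L (fun x => F x * G (2 ^+ K * x)) = av L F * av (L - K) G.
Proof.
move=> KL sF pG; rewrite (av_stepf KL sF) /av.
have eL : (2 ^ L = 2 ^ K * 2 ^ (L - K))%N by rewrite -expnD subnKC.
have ptF := stepf_pt_fine KL sF.
rewrite eL (sum_ord_mul _ _ (fun z => F (pt L z) * G (2 ^+ K * pt L z))).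
have sc i j : G (2 ^+ K * pt L (i * 2 ^ (L - K) + j)) = G (pt (L - K) j).
  by rewrite -{1}(subnKC KL) scale_pt pt_split // pG.
under eq_bigr => i _ do under eq_bigr => j _ do rewrite ptF // sc.
under eq_bigr => i _ do rewrite -mulr_sumr.
rewrite -mulr_suml.
rewrite -{1}(subnKC KL) exprD.
have : 2 ^+ (L - K) != 0 :> R by rewrite expf_neq0.
have : 2 ^+ K != 0 :> R by rewrite expf_neq0.
set a := 2 ^+ K; set b := 2 ^+ (L - K) => ? ?.
by field; apply/andP.
Qed.

Lemma av_scale K L G : (K <= L)%N -> periodic1 G ->
  av L (fun x => G (2 ^+ K * x)) = av (L - K) G.
Proof.
move=> KL pG; have := av_indep KL (@stepf_cst R K 1) pG.
rewrite av_cst mul1r => <-; apply: eq_av => x _; by rewrite mul1r.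
Qed.

(** The passage from integrals to averages; the nongeneric points form the countable set that the
    integral ignores. *)
Lemma integral_stepf L F : stepf L F ->
  (@lebesgue_measure R).-integrable `[0, 1] (EFin \o F) /\
  \int[lebesgue_measure]_(x in `[0, 1]) F x = av L F.
Proof.
move=> sF; have p0 : 0 < 2 ^+ L :> R by rewrite exprn_gt0.
have := @step_integral R [set x | ~ generic Z x] 0 (2 ^- L) (2 ^ L) F
  (fun i => F (pt L i)) (countable_nongeneric cZ) (pow2V_ge0 _).
rewrite add0r natrX divff ?gt_eqF //; apply => i x iL /contrapT gx.
rewrite !add0r ltr_pdivrMr // ltr_pdivlMr // ![x * _]mulrC => ix xi.
have x0 : 0 < x by rewrite -(pmulr_rgt0 _ p0); apply: le_lt_trans ix.
have x1 : x < 1.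
  rewrite -(ltr_pM2l p0) mulr1; apply: lt_le_trans xi _.
  by rewrite -natrX ler_nat.
have cx : cell L x = i by apply/cellP; [exact: ltW | rewrite ltW].
by rewrite (stepf_pt sF) ?cx.
Qed.

Lemma inner_stepf L F G : stepf L F -> stepf L G ->
  inner 0 1 F G = av L (fun x => F x * G x).
Proof. by move=> sF sG; exact: (integral_stepf (stepfM sF sG)).2. Qed.

Lemma L2_stepf L F : stepf L F -> L2 0 1 F.
Proof.
move=> sF; split.
  by have [/integrableP[/measurable_EFinP]] := integral_stepf sF.
have := (integral_stepf (stepf_comp (fun y => y ^+ 2) sF)).1.
by apply: eq_integrable.
Qed.

End Average.

(** * Rademacher and Haar functions *)

Section Rademacher.
Context {R : realType}.
Variable S : sampling R.
Local Notation unitg := (unitg S).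
Local Notation stepf := (stepf S).
Local Notation av := (av S).
Implicit Types (x y : R) (F G : R -> R).

Lemma unitg_cell L x : unitg x -> (cell L x)%:R < 2 ^+ L * x < (cell L x).+1%:R.
Proof.
move=> ux; have [x0 x1 _] := ux; have [h1 h2 _] := unitg_frac L ux.
apply/andP; split; first by rewrite -subr_gt0.
have := h2; rewrite ltrBlDl => h; apply: lt_le_trans h _; by rewrite natr1.
Qed.

Lemma rademacherE m x : unitg x -> rademacher m x = (-1) ^+ cell m.+1 x.
Proof.
move=> ux; have /andP[h1 h2] := unitg_cell m.+1 ux; rewrite /rademacher.
set n := cell _ _ in h1 h2 *; set u := 2 ^+ m.+1 * x - n%:R.
have u0 : 0 < u by rewrite subr_gt0.
have u1 : u < 1 by rewrite ltrBlDl natr1.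
have -> : 2 ^+ m.+1 * pi * x = u * pi + pi *+ n :> R.
  by rewrite -(mulr_natl pi n) /u; ring.
have su : 0 < sin (u * pi).
  by apply: sin_gt0_pi; rewrite mulr_gt0 ?pi_gt0 //= gtr_pMl ?pi_gt0.
by rewrite (alternatingn (@sinDpi R)) sgrM (gtr0_sg su) mulr1 sgrX sgrN sgr1.
Qed.

Lemma rademacher_scale m x : rademacher m x = rademacher 0 (2 ^+ m * x).
Proof. by rewrite /rademacher; congr (Num.sg (sin _)); rewrite exprS; ring. Qed.

Lemma rademacher_periodic m : periodic1 (@rademacher R m).
Proof.
move=> y n; rewrite /rademacher; congr Num.sg.
have -> : 2 ^+ m.+1 * pi * (n%:R + y) = 2 ^+ m.+1 * pi * y + pi *+ (2 ^ m.+1 * n) :> R.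
  by rewrite -(mulr_natl pi (_ * n)) natrM natrX; ring.
rewrite (alternatingn (@sinDpi R)) -signr_odd oddM oddX /=.
by rewrite expr0 mul1r.
Qed.

Lemma stepf_rademacher m : stepf m.+1 (rademacher m).
Proof. by move=> x y ux uy e; rewrite !rademacherE // e. Qed.

Lemma av_rademacher0 L : (0 < L)%N -> av L (rademacher 0) = 0.
Proof.
move=> L0; rewrite (av_stepf L0 (@stepf_rademacher 0)) /av.
rewrite big_ord_recl big_ord1 !rademacherE ?cell_pt //=; try exact: pt_unitg.
by rewrite expr0 expr1 subrr mulr0.
Qed.

Lemma av_rademacher L m F : (m < L)%N -> stepf m F ->
  av L (fun x => F x * rademacher m x) = 0.
Proof.
move=> mL sF.
under eq_av => x _ do rewrite rademacher_scale.
rewrite (av_indep (ltnW mL) sF (@rademacher_periodic 0)) av_rademacher0 ?mulr0 //.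
by rewrite subn_gt0.
Qed.

Lemma rademacher_sq m x : unitg x -> rademacher m x ^+ 2 = 1.
Proof. by move=> ux; rewrite rademacherE // sqrr_sign. Qed.

Definition cell_ind (L i : nat) (x : R) : R := (cell L x == i)%:R.

Lemma cell_ind_sq L i x : cell_ind L i x * cell_ind L i x = cell_ind L i x.
Proof. by rewrite /cell_ind; case: eqP => _; rewrite ?mulr1 ?mulr0. Qed.

Lemma stepf_cell_ind L i : stepf L (cell_ind L i).
Proof. by move=> x y ux uy e; rewrite /cell_ind e. Qed.

Lemma av_cell_ind K L i : (i < 2 ^ K)%N -> (K <= L)%N -> av L (cell_ind K i) = 2 ^- K.
Proof.
move=> iK KL; rewrite (av_stepf KL (@stepf_cell_ind K i)) /av.
rewrite (bigD1 (Ordinal iK)) //= /cell_ind cell_pt // eqxx.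
rewrite big1 ?addr0 ?mulr1 // => z zi; rewrite cell_pt //.
by case: eqP => // e; case/negP: zi; apply/eqP/val_inj.
Qed.

(** This evaluates one piece of ghat_n^i, where the function is a rescaled periodic function on a
    single dyadic cell. *)
Lemma av_cell_scale K L i F G : (i < 2 ^ K)%N -> (K <= L)%N -> periodic1 G ->
  (forall x, unitg x -> cell K x = i -> F x = G (2 ^+ K * x)) ->
  av L (fun x => cell_ind K i x * F x) = 2 ^- K * av (L - K) G.
Proof.
move=> iK KL pG FG; rewrite -(av_cell_ind iK KL).
rewrite -(av_indep KL (@stepf_cell_ind K i) pG); apply: eq_av => x ux.
by rewrite /cell_ind; case: eqP => [e|]; rewrite ?mul0r // FG.
Qed.

Lemma cell_ltP L i x : unitg x -> (x < i%:R / 2 ^+ L) = (cell L x < i)%N.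
Proof.
move=> ux; have /andP[h1 h2] := unitg_cell L ux.
rewrite ltr_pdivlMr ?exprn_gt0 // mulrC; apply/idP/idP => h.
  by rewrite -(ltr_nat R); exact: lt_trans h.
by apply: lt_le_trans h2 _; rewrite ler_nat.
Qed.

Lemma cell_gtP L i x : unitg x -> (i%:R / 2 ^+ L < x) = (i <= cell L x)%N.
Proof.
move=> ux; have /andP[h1 h2] := unitg_cell L ux.
rewrite ltr_pdivrMr ?exprn_gt0 // mulrC; apply/idP/idP => h.
  by rewrite -ltnS -(ltr_nat R); exact: lt_trans h2.
by apply: le_lt_trans h1; rewrite ler_nat.
Qed.

(** Orthogonality of the Haar functions is thereby inherited from the Rademacher functions, and
    their vanishing away from 0 is read off the indicator. *)
Lemma haar1E k x : unitg x ->
  haar1 k x = cell_ind k 0 x * (Num.sqrt (2 ^+ k) * rademacher k x).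
Proof.
move=> ux; rewrite rademacherE // /haar1 /cell_ind.
have [x0 x1 _] := ux; rewrite x0 /=.
have := cell_ltP k.+1 1 ux; have := cell_gtP k.+1 1 ux; have := cell_ltP k 1 ux.
rewrite !div1r => -> -> ->.
rewrite (cellD 1 k (ltW x0)) add1n expn1.
case: (cell k.+1 x) => [|[|z]] /=; rewrite ?mul1r ?mul0r ?expr0 ?mulr1 ?expr1 ?mulrN1 //.
have -> : (z.+2 %/ 2 < 1)%N = false by lia.
have -> : (z.+2 %/ 2 == 0)%N = false by lia.
by rewrite mul0r.
Qed.

Lemma stepf_haar1 k : stepf k.+1 (haar1 k).
Proof.
apply: stepf_eq (@haar1E k) _; apply: stepfM; first exact: stepf_le (@stepf_cell_ind k 0).
exact/stepfZ/stepf_rademacher.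
Qed.

Lemma av_haar1 L k F : (k < L)%N -> stepf k F -> av L (fun x => F x * haar1 k x) = 0.
Proof.
move=> kL sF; pose G x := Num.sqrt (2 ^+ k) * (F x * cell_ind k 0 x).
rewrite -(@av_rademacher L k G) //; last first.
  by apply/stepfZ/stepfM => //; exact: stepf_cell_ind.
by apply: eq_av => x ux; rewrite haar1E // /G; ring.
Qed.

Lemma av_haar1_sq L k : (k < L)%N -> av L (fun x => haar1 k x * haar1 k x) = 1.
Proof.
move=> kL; have e x : unitg x -> haar1 k x * haar1 k x = 2 ^+ k * cell_ind k 0 x.
  move=> ux; rewrite haar1E //.
  transitivity (cell_ind k 0 x * cell_ind k 0 x * Num.sqrt (2 ^+ k) ^+ 2 *
    rademacher k x ^+ 2); first ring.
  by rewrite cell_ind_sq sqr_sqrtr ?exprn_ge0 // rademacher_sq // mulr1 mulrC.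
rewrite (eq_av L e) avZ av_cell_ind ?expn_gt0 //; last exact: ltnW.
by rewrite mulfV // expf_neq0.
Qed.

(** Cell 1 of level l is (2^-l, 2^(-l+1)), so for T = 2n^2 these are the pieces on which ghat_n^i is
    defined. *)
Lemma cell_partition T x : (0 < T)%N -> unitg x ->
  cell_ind T 0 x + \sum_(1 <= l < T.+1) cell_ind l 1 x = 1.
Proof.
case: T => // T _ ux; have [x0 x1 _] := ux; elim: T => [|T IH].
  rewrite big_nat1 /cell_ind; have : (cell 1 x < 2)%N by apply: (@cell_lt R 1); rewrite ltW.
  by case: (cell 1 x) => [|[|]] //=; rewrite ?addr0 ?add0r.
have e : cell_ind T.+1 0 x = cell_ind T.+2 0 x + cell_ind T.+2 1 x.
  rewrite /cell_ind (cellD 1 T.+1 (ltW x0)) add1n expn1.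
  case: (cell T.+2 x) => [|[|z]] /=; rewrite ?addr0 ?add0r //.
  have -> : (z.+2 %/ 2 == 0)%N = false by lia.
  by [].
move: IH; rewrite e [X in _ -> _ + X = _]big_nat_recr //= => <-; ring.
Qed.

Lemma av_partition L T F : (0 < T)%N ->
  av L F = av L (fun x => cell_ind T 0 x * F x) +
    \sum_(1 <= l < T.+1) av L (fun x => cell_ind l 1 x * F x).
Proof.
move=> T0; rewrite -av_sum -avD; apply: eq_av => x ux.
by rewrite -mulr_suml -mulrDl cell_partition // mul1r.
Qed.

End Rademacher.

(** * Menshov functions *)

Section Periodize.
Context {R : realType}.
Implicit Types (x y : R).

Lemma periodizeE (a L : R) (f : R -> R) x (n : int) : 0 < L ->
  a + n%:~R * L <= x < a + (n + 1)%:~R * L -> periodize a L f x = f (x - n%:~R * L).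
Proof.
move=> L0 /andP[h1 h2]; rewrite /periodize.
have -> // : Num.floor ((x - a) / L) = n.
apply: floor_def; rewrite ler_pdivlMr // ltr_pdivrMr //; apply/andP; split; lra.
Qed.

Lemma periodize_id (a L : R) (f : R -> R) x : 0 < L ->
  a <= x < a + L -> periodize a L f x = f x.
Proof.
move=> L0 h; rewrite (@periodizeE _ _ _ _ 0) //; last by rewrite mul0r addr0 add0r mul1r.
by rewrite mul0r subr0.
Qed.

Lemma periodize_add (a L : R) (f : R -> R) x (n : int) : 0 < L ->
  periodize a L f (n%:~R * L + x) = periodize a L f x.
Proof.
move=> L0; have : (Num.floor ((x - a) / L))%:~R <= (x - a) / L
    < (Num.floor ((x - a) / L) + 1)%:~R by exact: floor_itv.
rewrite ler_pdivlMr // ltr_pdivrMr //; set m := Num.floor _ => /andP[h1 h2].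
rewrite [RHS](@periodizeE _ _ _ _ m) //; last by apply/andP; split; lra.
rewrite (@periodizeE _ _ _ _ (n + m)) //.
  by congr f; rewrite intrD; ring.
by move: h1 h2; rewrite !intrD => h1 h2; apply/andP; split; lra.
Qed.

Lemma floor_cell L x : 0 <= x -> Num.floor (2 ^+ L * x) = (cell L x)%:Z.
Proof.
move=> x0; apply: floor_def.
have /andP[h1 h2] : (cell L x)%:R <= 2 ^+ L * x < (cell L x).+1%:R by exact/cellP.
have e : ((cell L x)%:Z + 1)%:~R = (cell L x).+1%:R :> R by rewrite intrD -natr1.
by rewrite e h2 andbT.
Qed.

(** The value of M_r on the cell with left end t / 2^r. Adding 2^r, reducing modulo the period 2 2^r
    and subtracting 2^r again moves the cell into [-1, 1); the final + 1 passes to the index i of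
    the definition of M_r, which names a cell by its right end. *)
Definition menshov_value (r : nat) (t : int) : R :=
  let t' := (((t + 2 ^+ r) %% (2 * 2 ^+ r))%Z - 2 ^+ r + 1)%R in
  if (t' == 0) || (t' == 2 ^+ r) then 0 else (8 * t'%:~R)^-1 * Num.sqrt (2 ^+ r).

Lemma menshovE r y : menshov r y = menshov_value r (Num.floor (2 ^+ r * y)).
Proof.
set t := Num.floor _.
have p0 : 0 < 2 ^+ r :> R by rewrite exprn_gt0.
have /andP[h1 h2] : t%:~R <= 2 ^+ r * y < (t + 1)%:~R by exact: floor_itv.
have q0 : (2 * 2 ^+ r : int) != 0 by rewrite mulf_neq0 // expf_neq0.
have := divz_eq (t + 2 ^+ r) (2 * 2 ^+ r).
have := modz_ge0 (t + 2 ^+ r) q0.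
have := @ltz_pmod (t + 2 ^+ r) (2 * 2 ^+ r).
set n := ((t + _) %/ _)%Z; set e := ((t + _) %% _)%Z => he1 he0 he.
have {}he1 : e < 2 * 2 ^+ r by apply: he1; rewrite mulr_gt0 // exprn_gt0.
rewrite /menshov (@periodizeE _ _ _ _ n) //; last first.
  have e0 : 0 <= e%:~R :> R by rewrite ler0z.
  have e1 : e%:~R + 1 <= 2 * 2 ^+ r :> R.
    have : e + 1 <= 2 * 2 ^+ r by rewrite lezD1.
    by rewrite -(ler_int R) intrD intrM rmorphXn.
  have eq : t%:~R + 2 ^+ r = n%:~R * (2 * 2 ^+ r) + e%:~R :> R.
    have := congr1 (fun z : int => z%:~R : R) he.
    by rewrite !intrD !intrM rmorphXn.
  rewrite intrD in h2; rewrite intrD; apply/andP; split.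
    by rewrite -(ler_pM2l p0); lra.
  by rewrite -(ltr_pM2l p0); lra.
rewrite /menshov_base /menshov_value.
have -> : Num.floor (2 ^+ r * (y - n%:~R * 2)) = e - 2 ^+ r.
  have -> : 2 ^+ r * (y - n%:~R * 2) = 2 ^+ r * y + (- (n * (2 * 2 ^+ r)))%:~R :> R.
    by rewrite mulrNz intrM intrM rmorphXn /=; ring.
  rewrite floorDrz ?intrKfloor ?intr_int //.
  by rewrite -/t -[t](addrK (2 ^+ r)) he; ring.
by rewrite -/t -/e.
Qed.

Lemma menshov_value_periodic r (t c : int) :
  menshov_value r (t + c * (2 * 2 ^+ r)) = menshov_value r t.
Proof. by rewrite /menshov_value (addrAC t) (addrC _ (c * _)) modzMDl. Qed.

Lemma menshov_value_window r (t : nat) : (t.+1 < 2 ^ r)%N ->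
  menshov_value r t%:Z = Num.sqrt (2 ^+ r) / 8 / t.+1%:R.
Proof.
move=> h; rewrite /menshov_value.
have e2 : 2 ^+ r = (2 ^ r)%:Z by rewrite -natrX natz.
rewrite modz_small; last first.
  by rewrite e2 /=; lia.
rewrite addrK e2.
have -> : (t%:Z + 1 == 0) = false by lia.
have -> : (t%:Z + 1 == (2 ^ r)%:Z) = false by lia.
have -> : (t%:Z + 1)%:~R = t.+1%:R :> R by rewrite intrD -natr1.
rewrite /= invfM; ring.
Qed.

Lemma menshov_shiftE r i u :
  menshov_shift r i u = menshov_value r (Num.floor (2 ^+ r * u) - i%:Z).
Proof.
rewrite /menshov_shift menshovE; congr menshov_value.
have -> : 2 ^+ r * (u - i%:R / 2 ^+ r) = 2 ^+ r * u + (- i%:Z)%:~R :> R.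
  by rewrite mulrNz -pmulrn; field; rewrite expf_neq0.
by rewrite floorDrz ?intrKfloor ?intr_int.
Qed.

End Periodize.

Section MenshovSystem.
Context {R : realType}.
Variable S : sampling R.
Local Notation unitg := (unitg S).
Local Notation stepf := (stepf S).
Local Notation av := (av S).
Local Notation gen := (generic (exceptional S)).

Lemma cell_eqP L i x : unitg x ->
  (cell L x = i <-> i%:R / 2 ^+ L < x < i.+1%:R / 2 ^+ L).
Proof.
move=> ux; rewrite (cell_gtP L i ux) (cell_ltP L i.+1 ux) ltnS -eqn_leq eq_sym.
by split=> [->|/eqP].
Qed.

(** The substitution u / 4 maps [-2, 2] to [-1/2, 1/2], so by periodicity the two halves of the unit
    interval are exchanged; [c] lists the sample values in the exchanged order. *)
Lemma integral_period4 L (G H : R -> R) :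
  periodic1 G -> stepf L.+1 G ->
  (forall u, gen u -> -2 < u -> u < 2 -> H u = G (u / 4)) ->
  \int[lebesgue_measure]_(u in `[-2, 2]) H u = 4 * av L.+1 G.
Proof.
move=> pG sG HG; set N := (2 ^ L)%N.
have eN : N%:R = 2 ^+ L :> R by rewrite natrX.
have p0 : 0 < 2 ^+ L :> R by rewrite exprn_gt0.
pose c z := if (z < N)%N then G (pt S L.+1 (z + N)) else G (pt S L.+1 (z - N)).
have := @step_integral R [set x | ~ gen x] (-2) (4 / 2 ^+ L.+1) (2 ^ L.+1) H c
  (countable_nongeneric (@exceptional_countable R S)).
have e2 : -2 + (2 ^ L.+1)%:R * (4 / 2 ^+ L.+1) = 2 :> R.
  by rewrite natrX exprS; field; rewrite gt_eqF.
rewrite e2 => h; have {h}[||_ ->] := h.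
- by rewrite divr_ge0 // exprn_ge0.
- move=> i x iL /contrapT gx h1 h2.
  have e4 j : -2 + j%:R * (4 / 2 ^+ L.+1) = -2 + 4 * (j%:R / 2 ^+ L.+1) :> R by ring.
  rewrite e4 in h1; rewrite e4 in h2.
  have i0 : 0 <= i%:R / 2 ^+ L.+1 :> R by rewrite divr_ge0 // exprn_ge0.
  have i1 : i.+1%:R / 2 ^+ L.+1 <= 1 :> R.
    by rewrite ler_pdivrMr ?exprn_gt0 // mul1r -natrX ler_nat.
  rewrite HG //; [|lra|lra].
  have r4 : is_rational (4^-1 : R) by exact: rationalV (rational_nat 4).
  have g4 : gen (x / 4) by rewrite mulrC; apply: genericZ.
  have half : 2^-1 = N%:R / 2 ^+ L.+1 :> R by rewrite eN exprS; field; rewrite gt_eqF.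
  rewrite /c; case: ltnP => iN.
    rewrite -(pG _ 1%N).
    have iN1 : i.+1%:R / 2 ^+ L.+1 <= 2^-1 :> R.
      by rewrite half ler_pM2r ?invr_gt0 ?exprn_gt0 // ler_nat.
    have uw : unitg (1 + x / 4).
      split; [lra|lra|].
      by rewrite addrC; apply: genericD => //; exact: (rational_nat 1).
    have cw : cell L.+1 (1 + x / 4) = (i + N)%N.
      apply/cell_eqP => //; rewrite -addSn !natrD !mulrDl -half.
      by apply/andP; split; lra.
    by rewrite (stepf_pt sG uw) cw.
  have iN1 : 2^-1 <= i%:R / 2 ^+ L.+1 :> R.
    by rewrite half ler_pM2r ?invr_gt0 ?exprn_gt0 // ler_nat.
  have uw : unitg (x / 4) by split => //; lra.
  have cw : cell L.+1 (x / 4) = (i - N)%N.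
    apply/cell_eqP => //; rewrite -subSn // !natrB ?(leqW iN) // !mulrBl -half.
    by apply/andP; split; lra.
  by rewrite (stepf_pt sG uw) cw.
rewrite /av -mulrA; congr (_ * _).
rewrite -(big_mkord xpredT c) -(big_mkord xpredT (fun z => G (pt S L.+1 z))).
have NN : (2 ^ L.+1 = N + N)%N by rewrite expnS mul2n addnn.
rewrite NN (@big_cat_nat _ _ _ N) ?leq_addr //= [in RHS](@big_cat_nat _ _ _ N) ?leq_addr //=.
congr (_ * _); rewrite [LHS]addrC; congr (_ + _).
  rewrite -{1}[N]add0n big_addn addnK; apply: eq_big_nat => z /andP[_ zN].
  by rewrite /c addnK ltnNge leq_addl.
rewrite -{2}[N]add0n big_addn addnK; apply: eq_big_nat => z /andP[_ zN].
by rewrite /c zN.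
Qed.

(** The requirements on f_r^i at generic points, where the finite exceptional sets are no longer
    visible. The last clause is membership in the step space on [1, 2], read through the cells of u
    - 1. *)
Definition generic_shift (r i : nat) (h : R -> R) : Prop :=
  [/\ forall u, gen u -> -1 < u < 1 -> h u = menshov_shift r i u,
      forall u, gen u -> -2 < u < -1 -> h u = 0 &
      forall u v, gen u -> gen v -> 1 < u < 2 -> 1 < v < 2 ->
        cell r.+1 (u - 1) = cell r.+1 (v - 1) -> h u = h v].

Definition generic_menshov (r : nat) (f : nat -> R -> R) : Prop :=
  forall i, (i < 2 ^ r)%N -> generic_shift r i (f i).

Variables (r : nat) (f : nat -> R -> R).
Hypotheses (gf : generic_menshov r f) (mf : menshov_system r f).

(** The 4-periodic extension in the variable w = u / 4. The quarters 0, 1, 2, 3 of the unit interval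
    correspond to u in [0, 1], [1, 2], [-2, -1], [-1, 0]. *)
Definition unit_period (i : nat) (w : R) : R := periodize (-2) 4 (f i) (4 * w).

Lemma unit_period_periodic i : periodic1 (unit_period i).
Proof.
move=> y n; rewrite /unit_period mulrDr.
have -> : 4 * n%:R = n%:Z%:~R * 4 :> R by rewrite mulrC.
by rewrite periodize_add.
Qed.

Lemma gen4 w : gen w -> gen (4 * w).
Proof. by move=> gw; apply: genericZ => //; exact: (rational_nat 4). Qed.

Lemma cell_quarter L w q : unitg w -> cell 2 w = q ->
  let u := 4 * w - q%:R in
  unitg u /\ cell (L + 2) w = (q * 2 ^ L + cell L u)%N.
Proof.
move=> uw <- /=.
have e4 : (2 : R) ^+ 2 = 4 by rewrite expr2; lra.
split; first by rewrite -e4; exact: unitg_frac.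
rewrite -e4 (cell_frac 2 L uw); have [x0 _ _] := uw.
by rewrite (cellD L 2 (ltW x0)) -divn_eq.
Qed.

Lemma unit_period_window i w : (i < 2 ^ r)%N -> unitg w ->
  (cell 2 w == 0)%N || (cell 2 w == 3)%N ->
  unit_period i w = menshov_value r ((cell (r + 2) w)%:Z - i%:Z).
Proof.
move=> ir uw hq; have [fM _ _] := gf ir; have [w0 w1 gw] := uw.
have g4 := gen4 gw; rewrite /unit_period.
case/orP: hq => /eqP hq; have [[u0 u1 gu] ec] := cell_quarter r uw hq.
  rewrite subr0 in u0 u1 gu ec.
  rewrite periodize_id //; last by apply/andP; split; lra.
  rewrite fM //; last by apply/andP; split; lra.
  by rewrite menshov_shiftE floor_cell ?ec // ltW.
have -> : 4 * w = 1%:~R * 4 + (4 * w - 4) :> R by ring.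
rewrite periodize_add // periodize_id //; last by apply/andP; split; lra.
rewrite fM; last first.
- by apply/andP; split; lra.
- by apply: genericD => //; apply: rationalN; exact: (rational_nat 4).
rewrite menshov_shiftE.
have e2 : 2 ^+ r = (2 ^ r)%:Z by rewrite -natrX natz.
have -> : 2 ^+ r * (4 * w - 4) = 2 ^+ r * (4 * w - 3) + (- (2 ^ r)%:Z)%:~R :> R.
  by rewrite mulrNz -pmulrn natrX; ring.
rewrite floorDrz ?intrKfloor ?intr_int // floor_cell ?ltW // ec.
(* On the last quarter the cell index of w is 3 2^r + s while that of u is s - 2^r: they differ by
   two periods 2 2^r of [menshov_value]. *)
rewrite -[RHS](menshov_value_periodic r _ (-2)) e2; congr menshov_value.
rewrite PoszD PoszM; ring.
Qed.

(** The outer quarters carry a Menshov function, of level r + 2 in w; the third quarter carries 0.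
    The second carries a function of level r + 1 in u, which has level r + 3 in w and decides the
    bound. *)
Lemma stepf_unit_period i : (i < 2 ^ r)%N -> stepf (r + 3) (unit_period i).
Proof.
move=> ir x y ux uy exy.
have [fM f0 fE] := gf ir; have [x0 x1 gx] := ux; have [y0 y1 gy] := uy.
have e2 : cell 2 x = cell 2 y.
  by rewrite (@cell_le _ (r + 3) 2 x (ltW x0)) ?(@cell_le _ (r + 3) 2 y (ltW y0)) ?exy //; lia.
have er2 : cell (r + 2) x = cell (r + 2) y.
  rewrite (@cell_le _ (r + 3) (r + 2) x (ltW x0)); last by lia.
  by rewrite (@cell_le _ (r + 3) (r + 2) y (ltW y0)) ?exy //; lia.
have c4 : (cell 2 x < 4)%N by apply: (@cell_lt R 2); rewrite ltW.
have [h|h] := boolP ((cell 2 x == 0)%N || (cell 2 x == 3)%N).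
  by rewrite !unit_period_window -?e2 ?er2.
have [[vx0 vx1 gvx] ecx] := cell_quarter r.+1 ux (erefl _).
have [[vy0 vy1 gvy] ecy] := cell_quarter r.+1 uy (erefl _).
rewrite -e2 in vy0 vy1 gvy ecy.
have g4x := gen4 gx; have g4y := gen4 gy.
have gm z : gen z -> gen (z - 4).
  by move=> ?; apply: genericD => //; apply: rationalN; exact: (rational_nat 4).
rewrite /unit_period.
have : (cell 2 x == 1)%N || (cell 2 x == 2)%N by lia.
case/orP => /eqP q; rewrite q in vx0 vx1 vy0 vy1 ecx ecy gvx gvy.
  rewrite !periodize_id //; try by apply/andP; split; lra.
  apply: fE => //; try by apply/andP; split; lra.
  have er3 : (r.+1 + 2 = r + 3)%N by lia.
  by move: ecy; rewrite er3 -exy -er3 ecx => /addnI.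
have e1 z : 4 * z = 1%:~R * 4 + (4 * z - 4) :> R by ring.
rewrite (e1 x) (e1 y) !periodize_add // !periodize_id //; try by apply/andP; split; lra.
rewrite !f0 //; try (by exact: gm); by apply/andP; split; lra.
Qed.

Lemma f_unit_period i u : -2 < u -> u < 2 -> f i u = unit_period i (u / 4).
Proof.
move=> u1 u2; rewrite /unit_period.
have -> : 4 * (u / 4) = u by field.
by rewrite periodize_id //; apply/andP; split; lra.
Qed.

Lemma av_unit_period L i : (i < 2 ^ r)%N -> (r + 3 <= L)%N -> av L (unit_period i) = 0.
Proof.
move=> ir rL; have [_ hf] := mf; have [_ _ _ hz] := hf _ ir.
rewrite (av_stepf rL (stepf_unit_period ir)).
have := stepf_unit_period ir; rewrite addn3 => sp.
have := integral_period4 (@unit_period_periodic i) sp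
  (fun u _ h1 h2 => @f_unit_period i u h1 h2).
by rewrite hz => h; lra.
Qed.

(** The factor 1/4 comes from rescaling the interval [-2, 2] to unit length. *)
Lemma av_unit_periodM L i j : (i < 2 ^ r)%N -> (j < 2 ^ r)%N -> (r + 3 <= L)%N ->
  av L (fun w => unit_period i w * unit_period j w) = (i == j)%:R / 4.
Proof.
move=> ir jr rL; have [[_ ho] _] := mf.
have sp := stepfM (stepf_unit_period ir) (stepf_unit_period jr).
rewrite (av_stepf rL sp); rewrite addn3 in sp.
have pp : periodic1 (fun w => unit_period i w * unit_period j w).
  by move=> y n; rewrite !unit_period_periodic.
have := @integral_period4 _ _ (fun u => f i u * f j u) pp sp.
move=> h; have {}h := h (fun u _ h1 h2 =>
  congr2 *%R (f_unit_period i h1 h2) (f_unit_period j h1 h2)).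
have := ho i j ir jr; rewrite /inner h addn3 => <-; lra.
Qed.

End MenshovSystem.

(** * The functions g_n^i *)

Section Blocks.
Context {R : realType}.
Variable S : sampling R.
Local Notation unitg := (unitg S).
Local Notation av := (av S).

Lemma cell_leP L i x : unitg x -> (x <= i%:R / 2 ^+ L) = (cell L x < i)%N.
Proof.
move=> ux; rewrite -(cell_ltP L i ux) le_eqVlt; case: eqP => //= e.
have [_ _ gx] := ux; have : x != i%:R / 2 ^+ L.
  apply: (generic_irrational (exceptional0 S) gx).
  exact: rationalM (rational_nat _) (rationalV (rational_pow2 _)).
by rewrite e eqxx.
Qed.

Lemma cell_le1P L x : unitg x -> (x <= 2 ^- L) = (cell L x == 0)%N.
Proof. by move=> ux; have := cell_leP L 1 ux; rewrite div1r => ->; rewrite ltnS leqn0. Qed.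

Lemma cell_gt1P L x : unitg x -> (2 ^- L < x) = (0 < cell L x)%N.
Proof. by move=> ux; rewrite ltNge cell_le1P // lt0n. Qed.

Lemma cell_le_half x : unitg x -> (x <= 1 / 2) = (cell 1 x == 0)%N.
Proof. by move=> ux; rewrite -(cell_le1P 1 ux) expr1 div1r. Qed.

(** This serves the first block, where the argument 8x - 2 = 4 (2x - 1/2) is half a unit period out
    of phase. *)
Lemma av_half_shift L (G : R -> R) : periodic1 G ->
  av L.+1 (fun w => G (w - 1 / 2)) = av L.+1 G.
Proof.
move=> pG; rewrite /av; congr (_ * _).
rewrite -(big_mkord xpredT (fun z => G (pt S L.+1 z - 1 / 2))).
rewrite -(big_mkord xpredT (fun z => G (pt S L.+1 z))).
have NN : (2 ^ L.+1 = 2 ^ L + 2 ^ L)%N by rewrite expnS mul2n addnn.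
set N := (2 ^ L)%N in NN; have eN : N%:R = 2 ^+ L :> R by rewrite natrX.
have p0 : 2 ^+ L != 0 :> R by rewrite expf_neq0.
rewrite NN (@big_cat_nat _ _ _ N) ?leq_addr //= [in RHS](@big_cat_nat _ _ _ N) ?leq_addr //=.
rewrite [LHS]addrC; congr (_ + _).
  rewrite -{1}[N]add0n big_addn addnK; apply: eq_big_nat => z /andP[_ zN].
  by congr G; rewrite /pt natrD eN exprS; field.
rewrite -{2}[N]add0n big_addn addnK; apply: eq_big_nat => z /andP[_ zN].
rewrite -(pG _ 1%N); congr G; rewrite /pt natrD eN exprS; by field.
Qed.

Lemma av_rademacherM L a b : (0 < a)%N -> (0 < b)%N -> (a < L)%N -> (b < L)%N ->
  av L (fun x => cell_ind 1 1 x * (rademacher a x * rademacher b x)) = (a == b)%:R / 2.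
Proof.
have main a' b' : (0 < a')%N -> (a' < b')%N -> (b' < L)%N ->
    av L (fun x => cell_ind 1 1 x * (rademacher a' x * rademacher b' x)) = 0.
  move=> a0 ab bL.
  rewrite -(@av_rademacher _ S L b' (fun x => cell_ind 1 1 x * rademacher a' x)) //.
    by apply: eq_av => x _; rewrite mulrA.
  apply: stepfM; last exact: stepf_le ab (@stepf_rademacher _ S a').
  by apply: stepf_le (@stepf_cell_ind _ S 1 1); exact: leq_trans ab.
move=> a0 b0 aL bL; case: (ltngtP a b) => [ab|ba|<-]; rewrite ?mul0r.
- exact: main.
- by rewrite -(main b a) //; apply: eq_av => x _; rewrite [_ * rademacher b x]mulrC.
- rewrite mul1r -[2^-1]expr1 exprVn -(@av_cell_ind _ S 1 L 1) //; last exact: leq_trans aL.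
  apply: eq_av => x ux.
  by rewrite -expr2 (rademacher_sq a ux) mulr1.
Qed.

Variables (f : nat -> nat -> R -> R) (k : nat -> nat).
Hypothesis gf : forall r, (2 <= r)%N -> generic_menshov S r (f r).
Hypothesis mf : forall r, (2 <= r)%N -> menshov_system r (f r).

Definition up (r i : nat) : R -> R := unit_period (f r) i.

(** In the variable of [up] the argument is 2^l x - 1, so the translation by 2^-l is exactly one
    period and disappears. *)
Lemma fper_up l r i x :
  fper f r i (2 ^+ (l + 2) * (x - 2 ^- l)) = up r i (2 ^+ l * x).
Proof.
have e : 2 ^+ l * x = 1%:R + (2 ^+ l * x - 1) :> R by ring.
rewrite [in RHS]e /up unit_period_periodic /unit_period /fper; congr periodize.
by rewrite exprD; field; rewrite expf_neq0.
Qed.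

Section Block.
Variable n : nat.
Hypothesis n2 : (2 <= n)%N.
Local Notation T := (2 * n ^ 2)%N.
Local Notation N := (2 ^ (2 * n))%N.
Local Notation off := (k n.-1 + 4)%N.

Let r2 : (2 <= 2 * n)%N. Proof. by lia. Qed.
Let n0 : n%:R != 0 :> R. Proof. by rewrite pnatr_eq0; lia. Qed.

Definition pattern (i : nat) : R -> R := periodize 0 1 (ghat f k n i).

Lemma pattern_periodic i : periodic1 (pattern i).
Proof.
move=> y z; rewrite /pattern -[z%:R]/(z%:Z%:~R) -[z%:Z%:~R]mulr1.
exact: periodize_add.
Qed.

Lemma pattern_ghat i y : unitg y -> pattern i y = ghat f k n i y.
Proof.
move=> [y0 y1 _]; rewrite /pattern periodize_id //.
by rewrite add0r y1 ltW.
Qed.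

Lemma pattern_low i y : unitg y -> cell T y = 0%N ->
  pattern i y = n%:R^-1 * 2 ^+ (n ^ 2) * up (2 * n) i (2 ^+ T * y).
Proof.
move=> uy c0; rewrite pattern_ghat // /ghat.
by rewrite (cell_le1P _ uy) c0 fper_up.
Qed.

Lemma pattern_mid i y l : unitg y -> (2 <= l <= T)%N -> cell l y = 1%N ->
  pattern i y = n%:R^-1 * Num.sqrt (2 ^+ l) * up (2 * n) i (2 ^+ l * y).
Proof.
move=> uy /andP[l2 lT] c1; have [y0 y1 _] := uy.
have cl j : (j < l)%N -> cell j y = 0%N.
  move=> jl; rewrite (cell_le (ltW y0) (ltnW jl)) c1 divn_small //.
  by rewrite -{1}(expn0 2) ltn_exp2l // subn_gt0.
have cg j : (l < j)%N -> (1 < cell j y)%N.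
  move=> lj; have := cell_le (ltW y0) (ltnW lj); rewrite c1 => e.
  have : (0 < cell j y %/ 2 ^ (j - l))%N by rewrite -e.
  rewrite divn_gt0 ?expn_gt0 //; apply: leq_trans.
  by rewrite -{1}(expn0 2) ltn_exp2l // subn_gt0.
have c_pos : (0 < cell T y)%N.
  by move: lT; rewrite leq_eqVlt => /predU1P[<-|/cg]; [rewrite c1 | lia].
rewrite pattern_ghat // /ghat.
rewrite (cell_le1P _ uy) (gtn_eqF c_pos) (cell_le_half uy) cl //.
rewrite big_mkcond (bigD1_seq l) ?iota_uniq //=; last by rewrite mem_index_iota l2 ltnS.
rewrite (cell_gt1P _ uy) (cell_le1P _ uy) c1 cl ?prednK ?(ltnW l2) //= fper_up.
rewrite big1_seq ?addr0 // => j /andP[jl]; rewrite mem_index_iota => /andP[j2 _].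
rewrite (cell_gt1P _ uy) (cell_le1P _ uy).
have [jl'|lj] : (j < l)%N \/ (l < j)%N by move: jl; rewrite neq_ltn => /orP.
  by rewrite cl.
have [e|h] : l = j.-1 \/ (l < j.-1)%N by lia.
  by rewrite -e c1 andbF.
by rewrite (gtn_eqF (ltnW (cg _ h))) andbF.
Qed.

Lemma pattern_high i y : unitg y -> cell 1 y = 1%N ->
  pattern i y = rademacher (off + i) y.
Proof.
move=> uy c1; have [y0 y1 _] := uy; rewrite pattern_ghat // /ghat.
have T1 : (1 <= T)%N by rewrite muln_gt0 /= expn_gt0; lia.
have c_pos : (0 < cell T y)%N.
  have := cell_le (ltW y0) T1; rewrite c1; case: (cell T y) => //.
  by rewrite div0n.
by rewrite (cell_le1P _ uy) (gtn_eqF c_pos) (cell_le_half uy) c1.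
Qed.

(** A common bound for all averages over one period: T reaches the smallest scale, 2n + 3 resolves
    [up] at that scale, and off + N exceeds all the Rademacher indices of the block. *)
Definition pattern_level : nat := (T + (2 * n + 3) + (off + N) + 1)%N.

Let T1 : (1 <= T)%N. Proof. by rewrite muln_gt0 /= expn_gt0; lia. Qed.
Let sT : 2 ^+ T = (2 ^+ (n ^ 2)) ^+ 2 :> R. Proof. by rewrite -exprM mulnC. Qed.

(** On a piece of scale l the squared amplitude n^-2 2^l meets the measure 2^-l, so each piece
    contributes c / n^2. The left half consists of 2n^2 pieces: scales 2, ..., T, and the remaining
    cell at 0. *)
Lemma av_pattern_gen L (F : R -> R) (G : R -> R) (c : R) : (T <= L)%N -> periodic1 G ->
  (forall y, unitg y -> cell T y = 0%N -> F y = n%:R^-1 ^+ 2 * 2 ^+ T * G (2 ^+ T * y)) ->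
  (forall y l, unitg y -> (2 <= l <= T)%N -> cell l y = 1%N ->
     F y = n%:R^-1 ^+ 2 * 2 ^+ l * G (2 ^+ l * y)) ->
  (forall l, (l <= T)%N -> av (L - l) G = c) ->
  av L F = c * 2 + av L (fun y => cell_ind 1 1 y * F y).
Proof.
move=> TL pG Flow Fmid Gc; rewrite (av_partition S L F T1).
have piece l i : (l <= T)%N -> (i < 2 ^ l)%N ->
    (forall y, unitg y -> cell l y = i -> F y = n%:R^-1 ^+ 2 * 2 ^+ l * G (2 ^+ l * y)) ->
    av L (fun y => cell_ind l i y * F y) = n%:R^-1 ^+ 2 * c.
  move=> lT il Fl.
  rewrite (@av_cell_scale _ S l L i F (fun w => n%:R^-1 ^+ 2 * 2 ^+ l * G w)) //.
  - by rewrite avZ Gc //; field; rewrite n0 expf_neq0.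
  - exact: leq_trans TL.
  - by move=> w z; rewrite pG.
rewrite piece // ?expn_gt0 //.
rewrite big_ltn // addrCA [in RHS]addrC; congr (_ + _).
rewrite (eq_big_nat _ _ (F2 := fun=> n%:R^-1 ^+ 2 * c)); last first.
  move=> l /andP[l2 lT]; apply: piece => //.
  - by rewrite -{1}(expn0 2) ltn_exp2l //; lia.
  - by move=> y uy cy; apply: Fmid => //; rewrite l2.
have eT : (T.+1 - 2 = T.-1)%N by lia.
rewrite sumr_const_nat eT -mulrS prednK //.
by rewrite -(mulr_natl _ T) natrM natrX; field.
Qed.

Lemma av_pattern L i : (i < N)%N -> (pattern_level <= L)%N -> av L (pattern i) = 0.
Proof.
rewrite /pattern_level => iN lL; rewrite (av_partition S L _ T1).
have up0 l c : (l <= T)%N -> av (L - l) (fun w => c * up (2 * n) i w) = 0.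
  by move=> lT; rewrite avZ (av_unit_period (gf r2) (mf r2)) ?mulr0 //; lia.
have upp c : periodic1 (fun w => c * up (2 * n) i w).
  by move=> y z; rewrite /up unit_period_periodic.
rewrite (@av_cell_scale _ S T L 0 _ _ _ _ (upp (n%:R^-1 * 2 ^+ (n ^ 2)))) ?expn_gt0 //; first last.
- by move=> y uy c0; rewrite pattern_low.
- by lia.
rewrite up0 // mulr0 add0r big_ltn // [X in _ + X]big1_seq.
  rewrite addr0 -(@av_rademacher _ S L (off + i) (cell_ind 1 1)).
  - apply: eq_av => y uy; rewrite /cell_ind; case: eqP => [c1|]; last by rewrite !mul0r.
    by rewrite pattern_high.
  - by lia.
  - by apply: stepf_le (@stepf_cell_ind _ S 1 1); lia.
move=> l /andP[_]; rewrite mem_index_iota => hl.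
rewrite (@av_cell_scale _ S l L 1 _ _ _ _ (upp (n%:R^-1 * Num.sqrt (2 ^+ l)))) //; first last.
- by move=> y uy c1; rewrite (@pattern_mid _ _ l).
- by lia.
- by rewrite -{1}(expn0 2) ltn_exp2l //; lia.
by rewrite up0 ?mulr0 //; lia.
Qed.

(** For i = j the norm splits evenly: c = 1/4 gives 1/2 on the Menshov pieces, and the Rademacher
    half gives the other 1/2. *)
Lemma av_patternM L i j : (i < N)%N -> (j < N)%N -> (pattern_level <= L)%N ->
  av L (fun y => pattern i y * pattern j y) = (i == j)%:R.
Proof.
move=> iN jN; rewrite /pattern_level => lL.
rewrite (@av_pattern_gen L _ (fun w => up (2 * n) i w * up (2 * n) j w) ((i == j)%:R / 4)).
- have -> : av L (fun y => cell_ind 1 1 y * (pattern i y * pattern j y)) = (i == j)%:R / 2.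
    rewrite -(eqn_add2l off) -(@av_rademacherM L) //; try lia.
    apply: eq_av => y uy; rewrite /cell_ind; case: eqP => [c1|]; last by rewrite !mul0r.
    by rewrite !pattern_high.
  by field.
- by lia.
- by move=> y z; rewrite /up !unit_period_periodic.
- move=> y uy c0; rewrite !pattern_low // sT; ring.
- move=> y l uy hl c1; rewrite !(pattern_mid _ uy hl c1).
  transitivity (n%:R^-1 ^+ 2 * Num.sqrt (2 ^+ l) ^+ 2 *
    (up (2 * n) i (2 ^+ l * y) * up (2 * n) j (2 ^+ l * y))); first ring.
  by rewrite sqr_sqrtr // exprn_ge0.
- move=> l lT; by apply: (av_unit_periodM (gf r2) (mf r2)) => //; lia.
Qed.

End Block.

End Blocks.

(** * From the step spaces to generic step functions *)

Section EstepCells.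
Context {R : realType}.

(** The exceptions of all the intervals are collected in one countable set. Any interval of length 1
    is allowed because both [0, 1] and [1, 2] occur. *)
Lemma Estep_cells (a b : R) L (F : R -> R) : b - a = 1 -> Estep a b L F ->
  exists2 X : set R, countable X & forall i x y, (i < 2 ^ L)%N -> ~ X x -> ~ X y ->
    i%:R / 2 ^+ L < x - a < i.+1%:R / 2 ^+ L -> i%:R / 2 ^+ L < y - a < i.+1%:R / 2 ^+ L ->
    F x = F y.
Proof.
move=> ba EF.
have : forall i, exists c, (1 <= i <= 2 ^ L)%N ->
    eq_fin `]a + i.-1%:R * ((b - a) / 2 ^+ L), a + i%:R * ((b - a) / 2 ^+ L)[ F (fun=> c).
  move=> i; case: (boolP (1 <= i <= 2 ^ L)%N) => [/EF[c hc]|_]; [by exists c | by exists 0].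
move=> /choice[c hc].
exists (\bigcup_(i in [set i | (1 <= i <= 2 ^ L)%N])
  [set x : R | (x \in `]a + i.-1%:R * ((b - a) / 2 ^+ L), a + i%:R * ((b - a) / 2 ^+ L)[) /\ F x != c i]).
  by apply: bigcup_countable => // i hi; apply: finite_set_countable; exact: hc.
move=> i x y iL Xx Xy hx hy.
have main z : ~ (\bigcup_(i in [set i | (1 <= i <= 2 ^ L)%N]) [set x : R |
    (x \in `]a + i.-1%:R * ((b - a) / 2 ^+ L), a + i%:R * ((b - a) / 2 ^+ L)[) /\ F x != c i]) z ->
    i%:R / 2 ^+ L < z - a < i.+1%:R / 2 ^+ L -> F z = c i.+1.
  move=> Xz /andP[h1 h2]; apply/eqP/negPn/negP => Fz; apply: Xz; exists i.+1 => //.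
  split => //=; rewrite in_itv /= ba mul1r; apply/andP; split; lra.
by rewrite (main x) ?(main y).
Qed.

Lemma Estep_stepf L (F : R -> R) : Estep 0 1 L F ->
  exists2 X : set R, countable X & forall S, X `<=` exceptional S -> stepf S L F.
Proof.
move=> /(Estep_cells (subr0 1))[X cX hX]; exists X => // S XS x y ux uy e.
have [x0 x1 gx] := ux; have [y0 y1 gy] := uy.
have nX z : generic (exceptional S) z -> ~ X z.
  by move=> gz Xz; apply: (generic_notin gz); exact: XS.
apply: (hX (cell L x)); rewrite ?subr0; try exact: nX.
- by apply: cell_lt; rewrite x1 ltW.
- exact/(cell_eqP _ _ ux).
- by apply/(cell_eqP _ _ uy).
Qed.

Lemma Estep_le L L' (F : R -> R) : (L <= L')%N -> Estep 0 1 L F -> Estep 0 1 L' F.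
Proof.
move=> LL EF i /andP[i1 iL'].
have D0 : (0 < 2 ^ (L' - L))%N by rewrite expn_gt0.
have eD : (2 ^ L' = 2 ^ L * 2 ^ (L' - L))%N by rewrite -expnD subnKC.
set D := (2 ^ (L' - L))%N in D0 eD.
have jL : (i.-1 %/ D < 2 ^ L)%N by rewrite ltn_divLR // -eD prednK.
have [|c hc] := EF (i.-1 %/ D).+1; first by rewrite /= jL.
exists c; apply: sub_finite_set hc => x [] /=; rewrite !in_itv /= => /andP[h1 h2] Fx.
split => //; move: h1 h2; rewrite !add0r !subr0 !div1r.
have p0 : 0 < 2 ^+ L :> R by rewrite exprn_gt0.
have q0 : 0 < D%:R :> R by rewrite ltr0n.
have eR : 2 ^+ L' = 2 ^+ L * D%:R :> R by rewrite -natrX eD natrM natrX.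
rewrite eR invfM; set u := (2 ^+ L)^-1 : R.
have u0 : 0 < u by rewrite invr_gt0.
move=> h1 h2.
have e1 : ((i.-1 %/ D) * D)%:R <= i.-1%:R :> R by rewrite ler_nat leq_trunc_div.
have e2 : i%:R <= ((i.-1 %/ D).+1 * D)%:R :> R.
  by rewrite ler_nat; have := ltn_ceil i.-1 D0; lia.
rewrite natrM in e1; rewrite natrM in e2.
have e3 a b : a * (u / b) = u * (a / b) :> R by ring.
rewrite !e3 in h1 h2; apply/andP; split.
  by apply: le_lt_trans h1; rewrite [_ * u]mulrC ler_pM2l // ler_pdivlMr.
by apply: lt_le_trans h2 _; rewrite [_ * u]mulrC ler_pM2l // ler_pdivrMr.
Qed.

End EstepCells.

(** * Growth of the levels k_n *)

Section Levels.
Context {R : realType}.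
Variable S : sampling R.
Local Notation stepf := (stepf S).

Lemma Estep_haar1 j : Estep 0 1 j.+1 (@haar1 R j).
Proof.
move=> i /andP[i1 iL]; rewrite subr0 div1r !add0r.
have p0 : 0 < 2 ^- j.+1 :> R by rewrite invr_gt0 exprn_gt0.
have e2 : 2 ^- j = 2 * 2 ^- j.+1 :> R by rewrite exprS invfM mulVKf // invrK mulrA divff ?mul1r.
pose c : R := if i is 1%N then Num.sqrt (2 ^+ j) else if i is 2%N then - Num.sqrt (2 ^+ j) else 0.
exists c; rewrite /eq_fin (_ : [set x | _ /\ _] = set0); first exact: finite_set0.
apply/seteqP; split => // x [/=]; rewrite in_itv /= => /andP[h1 h2] /eqP; apply.
rewrite /haar1 /c e2.
case: i i1 iL h1 h2 @c => [|[|[|i]]] //= _ _; rewrite ?mul0r ?mul1r => h1 h2.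
- by rewrite h1 h2.
- have -> : 0 < x by lra.
  have -> : x < 2 ^- j.+1 = false by apply/negbTE; rewrite -leNgt ltW.
  by rewrite /= h1 h2.
- have h3 : 2 * 2 ^- j.+1 < x.
    apply: le_lt_trans h1; rewrite ler_pM2r // (ler_nat R 2 i.+2); lia.
  have -> : x < 2 ^- j.+1 = false by apply/negbTE; rewrite -leNgt; lra.
  have -> : x < 2 * 2 ^- j.+1 = false by apply/negbTE; rewrite -leNgt; lra.
  by rewrite !andbF.
Qed.

(** The last two cells of level T + 1 form one cell of level T. A function that separates them has
    level above T, which is how lower bounds for k_n are obtained. *)
Lemma level_gt (T q : nat) (F : R -> R) : (1 <= T)%N -> (q <= T)%N -> stepf q F ->
  F (pt S T.+1 (2 ^ T.+1 - 2)) = F (pt S T.+1 (2 ^ T.+1 - 1)).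
Proof.
move=> T1 qT sF.
have h4 : (4 <= 2 ^ T.+1)%N by rewrite (@leq_exp2l 2 2).
have l1 : (2 ^ T.+1 - 2 < 2 ^ T.+1)%N by lia.
have l2 : (2 ^ T.+1 - 1 < 2 ^ T.+1)%N by lia.
have [a0 _ _] := pt_unitg S l1; have [b0 _ _] := pt_unitg S l2.
apply: sF; try exact: pt_unitg.
have qT1 : (q <= T.+1)%N by exact: leqW.
rewrite (cell_le (ltW a0) qT1) (cell_le (ltW b0) qT1) !cell_pt // subSn //.
rewrite !expnS !divnMA; congr (_ %/ _)%N; lia.
Qed.

Variables (f : nat -> nat -> R -> R) (k : nat -> nat).

Definition gshift (n : nat) : nat := (k n.-1 + 2 * n ^ 2 + 2)%N.

Lemma g_pattern n i x : (2 <= n)%N -> g f k n i x = pattern f k n i (2 ^+ gshift n * x).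
Proof. by move=> n2; rewrite /g gtn_eqF. Qed.

Hypothesis gS : forall n i, (1 <= n)%N -> (i < 2 ^ (2 * n))%N -> stepf (k n) (g f k n i).

(** The last function of the block, i = N - 1, contains the Rademacher function of index a = k_{n-1}
    + 4 + N - 1 in the variable 2^K x, with K = [gshift n]. It changes sign between the last two
    cells of level K + a + 1. *)
Lemma level_gap n : (2 <= n)%N -> (gshift n + (k n.-1 + 4) + 2 ^ (2 * n) <= k n)%N.
Proof.
move=> n2; rewrite leqNgt; apply/negP => h.
have N0 : (0 < 2 ^ (2 * n))%N by rewrite expn_gt0.
set N := (2 ^ (2 * n))%N in h N0; set K := gshift n in h.
pose a := (k n.-1 + 4 + N.-1)%N; pose T := (K + a)%N.
have a4 : (4 <= a)%N by rewrite /a; lia.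
have T1 : (1 <= T)%N by rewrite /T; lia.
have kT : (k n <= T)%N by rewrite /T /a; lia.
have := level_gt T1 kT (gS (i := N.-1) (ltnW n2) _).
rewrite prednK // => /(_ (leqnn _)).
have h4 : (4 <= 2 ^ T.+1)%N by rewrite (@leq_exp2l 2 2).
have l1 : (2 ^ T.+1 - 2 < 2 ^ T.+1)%N by lia.
have l2 : (2 ^ T.+1 - 1 < 2 ^ T.+1)%N by lia.
have eT : (2 ^ T.+1 = 2 ^ K.+1 * 2 ^ a)%N by rewrite -expnD addSn.
have a2 : (2 < 2 ^ a)%N by rewrite (@ltn_exp2l 2 1); lia.
have val z : (2 ^ T.+1 - 2 <= z < 2 ^ T.+1)%N ->
    g f k n N.-1 (pt S T.+1 z) = (-1) ^+ z.
  move=> /andP[z1 z2]; have ux := pt_unitg S z2; have [x0 _ _] := ux.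
  rewrite g_pattern // -/K -(periodic_frac K _ (@pattern_periodic _ f k n _)).
  have uf := unitg_frac K ux.
  have c1 : cell 1 (2 ^+ K * pt S T.+1 z - (cell K (pt S T.+1 z))%:R) = 1%N.
    rewrite (cell_frac K 1 ux) (@cell_le _ T.+1 _ _ (ltW x0)); last by rewrite /T; lia.
    rewrite cell_pt // (_ : T.+1 - (1 + K) = a)%N; last by rewrite /T; lia.
    rewrite (_ : z %/ 2 ^ a = 2 ^ K.+1 - 1)%N.
      rewrite expnS expn1 modn2; have := expn_gt0 2 K; case: (2 ^ K)%N => // w _.
      by rewrite mul2n doubleS subn1 /= odd_double.
    apply/eqP; rewrite eqn_leq -ltnS -subSn ?expn_gt0 // subn1 /= ltn_divLR ?expn_gt0 // -eT z2 /=.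
    rewrite leq_divRL ?expn_gt0 // mulnBl -eT mul1n; apply: leq_trans z1.
    by apply: leq_sub2l; exact: ltnW.
  rewrite (pattern_high _ _ n2 _ uf c1) (rademacherE _ uf) -/a (cell_frac K a.+1 ux).
  rewrite (_ : a.+1 + K = T.+1)%N; last by rewrite /T; lia.
  by rewrite cell_pt // -signr_odd odd_mod ?signr_odd // oddX.
rewrite !val; try lia.
have e : (2 ^ T.+1 - 1 = (2 ^ T.+1 - 2).+1)%N by lia.
rewrite e exprS mulN1r => /eqP; rewrite -addr_eq0 -mulr2n mulrn_eq0 /= signr_eq0 //.
Qed.

(** The function g_1^3 contains r_12, which changes sign between the last two cells of level 13. *)
Lemma level_first : (13 <= k 1)%N.
Proof.
rewrite leqNgt ltnS; apply/negP => h.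
have := level_gt (isT : (1 <= 12)%N) h (gS (n := 1) (i := 3) _ _) => /(_ isT isT).
have val z : (2 ^ 13 - 2 <= z < 2 ^ 13)%N -> g f k 1 3 (pt S 13 z) = (-1) ^+ z.
  move=> /andP[z1 z2]; have ux := pt_unitg S z2; have [x0 _ _] := ux.
  rewrite /g /= /g_first (cell_le_half ux).
  have -> : cell 1 (pt S 13 z) = 1%N.
    rewrite (@cell_le _ 13 _ _ (ltW x0)) // cell_pt //; move: z1 z2.
    rewrite (expnS 2 12) subn1 /=; have : (4 <= 2 ^ 12)%N by rewrite (@leq_exp2l 2 2).
    move: (2 ^ 12)%N => X X4 z1 z2; apply/eqP.
    by rewrite eqn_leq -ltnS ltn_divLR ?leq_divRL ?z2 ?mul1n /=; lia.
  by rewrite (rademacherE _ ux) cell_pt.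
have h2 : (2 ^ 13 = 2 + (2 ^ 13 - 2))%N by rewrite subnKC // (@leq_exp2l 2 1).
rewrite !val; try lia.
have e : (2 ^ 13 - 1 = (2 ^ 13 - 2).+1)%N by lia.
rewrite e exprS mulN1r => /eqP; rewrite -addr_eq0 -mulr2n mulrn_eq0 /= signr_eq0 //.
Qed.

Lemma level_step n : (1 <= n)%N -> (k n + 2 * n.+1 ^ 2 + 2 < k n.+1)%N.
Proof.
by move=> n1; have := @level_gap n.+1 n1; rewrite /gshift /=; lia.
Qed.

Lemma level_lt n n' : (1 <= n)%N -> (n < n')%N -> (k n + 2 * n' ^ 2 + 2 <= gshift n')%N.
Proof.
move=> n1; elim: n' => // n' IH; rewrite ltnS leq_eqVlt => /predU1P[<-|h].
  by rewrite /gshift.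
have := level_step (leq_trans n1 (ltnW h)); have := IH h; rewrite /gshift /=.
case: n' h IH => // n' h _; rewrite /=; have := @level_step n'.
by move=> h2 h3 h4; have := h2 (leq_trans n1 h); lia.
Qed.

Lemma level_ltk n n' : (1 <= n)%N -> (n < n')%N -> (k n + 2 <= gshift n' <= k n')%N.
Proof.
move=> n1 nn; have := level_lt n1 nn; have := @level_gap n' (leq_ltn_trans n1 nn).
by lia.
Qed.

Lemma level_ge n : (1 <= n)%N -> (12 + n <= k n)%N.
Proof.
elim: n => // -[|n] IH _; first exact: level_first.
have := IH isT; have := @level_step n.+1 isT; lia.
Qed.

(** By the growth of the levels the term 2^(k_n + 2) exceeds all that is subtracted from it. So the
    subtractions in [m] are genuine and no block of functions psi_nu is empty. *)
Lemma m_lt n : (1 <= n)%N -> (m k n.-1 < m k n)%N.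
Proof.
case: n => // -[|n] _ /=.
  rewrite subn_gt0; apply: (@leq_trans (2 ^ 3)) => //.
  by rewrite leq_exp2l //; have := level_first; lia.
have := @level_gap n.+2 isT; rewrite /gshift /= => h.
have h1 : (k n.+1 + 2 <= k n.+2)%N by lia.
have h2 : (2 * n.+2 <= k n.+2)%N.
  have : (n.+2 <= n.+2 ^ 2)%N by rewrite -{1}[n.+2]expn1 leq_exp2l.
  by lia.
have h3 : (3 <= k n.+2)%N by lia.
have e : (2 ^ (k n.+2 + 2) = 4 * 2 ^ k n.+2)%N by rewrite expnD mulnC.
have g1 : (2 ^ (k n.+1 + 2) <= 2 ^ k n.+2)%N by rewrite leq_exp2l.
have g2 : (2 ^ (2 * n.+2) <= 2 ^ k n.+2)%N by rewrite leq_exp2l.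
have g3 : (2 ^ 3 <= 2 ^ k n.+2)%N by rewrite leq_exp2l.
rewrite e; lia.
Qed.

End Levels.

(** * Orthonormality *)

Section BaseSystem.
Context {R : realType}.
Variable S : sampling R.
Local Notation stepf := (stepf S).
Local Notation av := (av S).
Variables (f : nat -> nat -> R -> R) (k : nat -> nat) (psi : nat -> R -> R).
Hypothesis gf : forall r, (2 <= r)%N -> generic_menshov S r (f r).
Hypothesis mf : forall r, (2 <= r)%N -> menshov_system r (f r).
Hypothesis gS : forall n i, (1 <= n)%N -> (i < 2 ^ (2 * n))%N -> stepf (k n) (g f k n i).
Hypothesis gE : forall n i, (1 <= n)%N -> (i < 2 ^ (2 * n))%N -> Estep 0 1 (k n) (g f k n i).
Hypothesis psiS : forall n nu, (1 <= n)%N -> (m k n.-1 < nu <= m k n)%N ->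
  stepf (k n + 2) (psi nu).
Hypothesis psiB : forall n, (1 <= n)%N ->
  orthonormal_basis 0 1 (psi_space f k n) (m k n.-1) (m k n) psi.

Lemma av_g_first L i j : (i < 4)%N -> (j < 4)%N -> (k 1 <= L)%N ->
  av L (fun x => g f k 1 i x * g f k 1 j x) = (i == j)%:R.
Proof.
move=> i4 j4 kL; have [r2 r22] : (2 <= 2)%N /\ (2 <= 2)%N by [].
(* The product has level k_1, so its average may be computed at level k_1 + 20 instead, which leaves
   room for the rescaled functions f_2^i and for r_9, ..., r_12. *)
rewrite (av_stepf kL (stepfM (gS (n := 1) isT i4) (gS (n := 1) isT j4))).
rewrite -(@av_stepf _ S (k 1) (k 1 + 20)) ?leq_addr //; last first.
  exact: (stepfM (gS (n := 1) isT i4) (gS (n := 1) isT j4)).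
rewrite (av_partition S _ _ (isT : (0 < 1)%N)) big_nat1.
pose G w := 4 * (up f 2 i w * up f 2 j w).
have pG : periodic1 G by move=> y n; rewrite /G /up !unit_period_periodic.
rewrite (@av_cell_scale _ S 1 _ 0 _ (fun w => G (w - 1 / 2))) //; first last.
- move=> x ux c0; rewrite /g /= /g_first (cell_le_half ux) c0 /= /G /up /unit_period /fper.
  have -> : 4 * (2 ^+ 1 * x - 1 / 2) = 8 * x - 2 :> R by rewrite expr1; field.
  by ring.
- by move=> y n; rewrite -addrA pG.
- by rewrite addnS.
have e19 : (k 1 + 20 - 1 = (k 1 + 18).+1)%N by lia.
rewrite e19 (av_half_shift S (k 1 + 18) pG) avZ.
rewrite (av_unit_periodM (gf r2) (mf r2)) //; last by lia.
have -> : av (k 1 + 20) (fun x => cell_ind 1 1 x * (g f k 1 i x * g f k 1 j x)) = (i == j)%:R / 2.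
  rewrite -(eqn_add2l 9) -(@av_rademacherM _ S (k 1 + 20)) //; try lia.
  apply: eq_av => x ux; rewrite /cell_ind; case: eqP => [c1|]; last by rewrite !mul0r.
  by rewrite /g /= /g_first (cell_le_half ux) c1.
by rewrite expr1; field.
Qed.

Lemma shift_le n : (2 <= n)%N -> (gshift k n <= k n)%N.
Proof. by move=> n2; have := level_gap gS n2; lia. Qed.

(** Independence at the scale 2^[gshift], together with the zero mean of the pattern. *)
Lemma g_perp L n i F : (2 <= n)%N -> (i < 2 ^ (2 * n))%N -> (k n <= L)%N ->
  stepf (gshift k n) F -> av L (fun x => F x * g f k n i x) = 0.
Proof.
move=> n2 iN kL sF.
have sFG : stepf (k n) (fun x => F x * g f k n i x).
  by apply: stepfM; [exact: stepf_le (shift_le n2) sF | exact: gS (ltnW n2) iN].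
rewrite (av_stepf kL sFG) -(av_stepf (leq_addr (gshift k n + pattern_level k n) _) sFG).
under eq_av => x _ do rewrite g_pattern //.
rewrite (av_indep _ sF (@pattern_periodic _ f k n i)); last by lia.
by rewrite av_pattern ?mulr0 //; lia.
Qed.

Lemma av_gM L n i j : (1 <= n)%N -> (i < 2 ^ (2 * n))%N -> (j < 2 ^ (2 * n))%N -> (k n <= L)%N ->
  av L (fun x => g f k n i x * g f k n j x) = (i == j)%:R.
Proof.
move=> n1 iN jN kL; have [n2|n2] := leqP 2 n; last first.
  have e : n = 1%N by lia.
  by rewrite e in iN jN kL *; exact: av_g_first.
have sFG := stepfM (gS n1 iN) (gS n1 jN).
rewrite (av_stepf kL sFG) -(av_stepf (leq_addr (gshift k n + pattern_level k n) _) sFG).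
under eq_av => x _ do rewrite !g_pattern //.
rewrite (@av_scale _ S _ _ (fun y => pattern f k n i y * pattern f k n j y)).
- by rewrite av_patternM //; lia.
- by lia.
- by move=> y z; rewrite !pattern_periodic.
Qed.

Lemma psi_spaceP n nu : (1 <= n)%N -> (m k n.-1 < nu <= m k n)%N -> psi_space f k n (psi nu).
Proof. by move=> n1 h; have [_ hV _] := psiB n1; exact: hV. Qed.

Lemma psi_Estep n nu : (1 <= n)%N -> (m k n.-1 < nu <= m k n)%N -> Estep 0 1 (k n + 2) (psi nu).
Proof.
move=> n1 h; have [ha _ _ _] := psi_spaceP n1 h.
by move: ha; rewrite /psi_ambient; case: eqP => [->|] // _ [].
Qed.

Lemma psi_perp L n nu q F : (1 <= n)%N -> (m k n.-1 < nu <= m k n)%N -> (k n + 2 <= L)%N ->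
  (1 < n)%N -> (q <= k n.-1 + 2)%N -> stepf q F -> Estep 0 1 q F ->
  av L (fun x => psi nu x * F x) = 0.
Proof.
move=> n1 h kL n2 qk sF EF; have [ha _ _ _] := psi_spaceP n1 h.
move: ha; rewrite /psi_ambient gtn_eqF // => -[_ ho].
have kk : (k n.-1 + 2 <= k n + 2)%N.
  have n1' : (1 <= n.-1)%N by rewrite -ltnS prednK.
  have := level_ltk gS n1' (_ : n.-1 < n)%N; rewrite ltn_predL => /(_ n1); lia.
rewrite -(ho _ (Estep_le qk EF)); apply/esym/inner_stepf.
  exact: stepf_le kL (psiS n1 h).
by apply: stepf_le sF; lia.
Qed.

(** Indices of the system to which the orthogonal matrices are applied: a pair (n, nu) for psi_nu, s
    for the Haar function of index k_s + 1, a pair (n, i) for g_n^i. The block number accompanies nu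
    so that the level can be read off the index. *)
Definition base := (nat * nat + (nat + nat * nat))%type.
Implicit Types b : base.

Definition bfun b : R -> R :=
  match b with
  | inl u => psi u.2
  | inr (inl s) => haar1 (k s + 1)
  | inr (inr u) => g f k u.1 u.2
  end.

Definition bvalid b : bool :=
  match b with
  | inl u => (1 <= u.1)%N && (m k u.1.-1 < u.2 <= m k u.1)%N
  | inr (inl s) => (1 <= s)%N
  | inr (inr u) => (1 <= u.1)%N && (u.2 < 2 ^ (2 * u.1))%N
  end.

Definition blev b : nat :=
  match b with
  | inl u => k u.1 + 2
  | inr (inl s) => k s + 2
  | inr (inr u) => k u.1
  end.

Lemma stepf_bfun b : bvalid b -> stepf (blev b) (bfun b).
Proof.
case: b => [[n nu]|[s|[n i]]] /=.
- by move=> /andP[n1 h]; exact: psiS.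
- by move=> _; rewrite addn1 addn2; exact: stepf_haar1.
- by move=> /andP[n1 h]; exact: gS.
Qed.

Lemma avMC L F G : av L (fun x => F x * G x) = av L (fun x => G x * F x).
Proof. by apply: eq_av => x _; rewrite mulrC. Qed.

Lemma base_psi_psi L n nu n' nu' : bvalid (inl (n, nu)) -> bvalid (inl (n', nu')) ->
  (n < n')%N -> (k n' + 2 <= L)%N -> av L (fun x => psi nu' x * psi nu x) = 0.
Proof.
move=> /= /andP[n1 h] /andP[n1' h'] nn kL.
apply: (psi_perp (n := n') (q := k n + 2)) => //.
- exact: leq_ltn_trans n1 nn.
- have [->|ne] := eqVneq n n'.-1; first by [].
  have lt : (n < n'.-1)%N by lia.
  have := level_ltk gS n1 lt; lia.
- exact: psiS.
- exact: psi_Estep.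
Qed.

Lemma base_psi_haar L n nu s : bvalid (inl (n, nu)) -> (1 <= s)%N -> (k n + 2 <= L)%N ->
  (k s + 2 <= L)%N -> av L (fun x => psi nu x * haar1 (k s + 1) x) = 0.
Proof.
move=> /= /andP[n1 h] s1 kL sL; case: (ltngtP s n) => [sn|ns|sn].
- have n2 : (1 < n)%N by exact: leq_ltn_trans s1 sn.
  apply: (psi_perp (n := n) (q := k s + 2)) => //.
  + have [->|ne] := eqVneq s n.-1; first by [].
    have lt : (s < n.-1)%N by lia.
    have := level_ltk gS s1 lt; lia.
  + by rewrite addn1 addn2; exact: stepf_haar1.
  + by rewrite addn1 addn2; exact: Estep_haar1.
- apply: av_haar1; first by lia.
  apply: stepf_le (psiS n1 h).
  by have := level_ltk gS n1 ns; lia.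
- have [_ _ _ ho] := psi_spaceP n1 h; rewrite sn addn1 -ho; apply/esym/inner_stepf.
    exact: stepf_le kL (psiS n1 h).
  by apply: stepf_le (@stepf_haar1 _ S _); lia.
Qed.

Lemma base_psi_g L n nu n' i : bvalid (inl (n, nu)) -> bvalid (inr (inr (n', i))) ->
  (k n + 2 <= L)%N -> (k n' <= L)%N -> av L (fun x => psi nu x * g f k n' i x) = 0.
Proof.
move=> /= /andP[n1 h] /andP[n1' h'] kL kL'; case: (ltngtP n' n) => [lt|lt|eq].
- have n2 : (1 < n)%N by exact: leq_ltn_trans n1' lt.
  apply: (psi_perp (n := n) (q := k n')) => //.
  + have [->|ne] := eqVneq n' n.-1; first by lia.
    have lt' : (n' < n.-1)%N by lia.
    have := level_ltk gS n1' lt'; lia.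
  + exact: gS.
  + exact: gE.
- apply: g_perp => //; first exact: leq_ltn_trans lt.
  apply: stepf_le (psiS n1 h); have := level_ltk gS n1 lt; lia.
- have [_ ho _ _] := psi_spaceP n1 h; rewrite eq in h' kL' *.
  rewrite -(ho i h'); apply/esym/inner_stepf.
    exact: stepf_le kL (psiS n1 h).
  exact: stepf_le kL' (gS n1 h').
Qed.

Lemma base_haar_g L s n i : (1 <= s)%N -> bvalid (inr (inr (n, i))) ->
  (k s + 2 <= L)%N -> (k n <= L)%N -> av L (fun x => haar1 (k s + 1) x * g f k n i x) = 0.
Proof.
move=> s1 /= /andP[n1 h] sL nL; case: (ltnP s n) => [sn|ns].
- apply: g_perp => //; first exact: leq_ltn_trans s1 sn.
  apply: (@stepf_le _ _ _ (k s + 2)); first by have := level_ltk gS s1 sn; lia.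
  by rewrite addn1 addn2; exact: stepf_haar1.
- rewrite avMC; apply: av_haar1; first by lia.
  apply: stepf_le (gS n1 h).
  move: ns; rewrite leq_eqVlt => /predU1P[->|ns]; first by lia.
  by have := level_ltk gS n1 ns; lia.
Qed.

(** For functions from different blocks the later one is orthogonal to every step function of the
    earlier level: psi_nu by the choice of its ambient space, Haar functions and g_n^i by their
    oscillation. Within a block psi_nu is orthogonal to the others by definition, and the Haar
    function is finer than the g_n^i. *)
Lemma base_orthonormal L b b' : bvalid b -> bvalid b' -> (blev b <= L)%N -> (blev b' <= L)%N ->
  av L (fun x => bfun b x * bfun b' x) = (b == b')%:R.
Proof.
case: b => [[n nu]|[s|[n i]]]; case: b' => [[n' nu']|[s'|[n' i']]] => v v' l l'.
- have [/= /andP[n1 h] /andP[n1' h']] := (conj v v').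
  case: (ltngtP n n') => [lt|lt|eq].
  + rewrite avMC (base_psi_psi v v') // [_ == _](_ : _ = false) //.
    by apply/negbTE; rewrite (inj_eq (@inl_inj _ _)) xpair_eqE ltn_eqF.
  + rewrite (base_psi_psi v' v) // [_ == _](_ : _ = false) //.
    by apply/negbTE; rewrite (inj_eq (@inl_inj _ _)) xpair_eqE gtn_eqF.
  + have [[_ ho] _ _] := psiB n1; rewrite -eq in h' *.
    rewrite (inj_eq (@inl_inj _ _)) xpair_eqE eqxx /= -(ho _ _ h h').
    apply/esym/inner_stepf; first exact: stepf_le l (psiS n1 h).
    by apply: stepf_le l (psiS n1 h').
- exact: base_psi_haar v v' l l'.
- exact: base_psi_g v v' l l'.
- by rewrite avMC; exact: base_psi_haar v' v l' l.
- rewrite !(inj_eq (@inr_inj _ _)) (inj_eq (@inl_inj _ _)) /=; rewrite /= in v v' l l'.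
  have main (a b : nat) : (1 <= a)%N -> (a < b)%N -> (k b + 2 <= L)%N ->
      av L (fun x => haar1 (k a + 1) x * haar1 (k b + 1) x) = 0.
    move=> a1 ab bL; apply: av_haar1; first by lia.
    apply: (@stepf_le _ _ _ (k a + 2)); first by have := level_ltk gS a1 ab; lia.
    by rewrite addn1 addn2; exact: stepf_haar1.
  case: (ltngtP s s') => [ss|ss|<-].
  + by rewrite (main _ _ v ss l').
  + by rewrite avMC (main _ _ v' ss l).
  + by apply: av_haar1_sq; lia.
- exact: base_haar_g v v' l l'.
- by rewrite avMC; exact: base_psi_g v' v l' l.
- by rewrite avMC; exact: base_haar_g v' v l' l.
- rewrite !(inj_eq (@inr_inj _ _)) xpair_eqE /=; rewrite /= in v v' l l'.
  have [/andP[n1 h] /andP[n1' h']] := conj v v'.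
  case: (ltngtP n n') => [lt|lt|eq] /=.
  + apply: g_perp => //; first exact: leq_ltn_trans lt.
    apply: stepf_le (gS n1 h); have := level_ltk gS n1 lt; lia.
  + rewrite avMC; apply: g_perp => //; first exact: leq_ltn_trans lt.
    apply: stepf_le (gS n1' h'); have := level_ltk gS n1' lt; lia.
  + by rewrite -eq in h' *; exact: av_gM.
Qed.

End BaseSystem.

(** * The orthogonal matrices and the change of coordinates in a block *)

Section Kappa.
Context {R : realType}.

Lemma sum_nat_eq (V : nzSemiRingType) a b j : (a <= j < b)%N ->
  \sum_(a <= i < b) (j == i)%:R = 1 :> V.
Proof.
move=> h; rewrite (bigD1_seq j) ?iota_uniq ?mem_index_iota //= eqxx big1 ?addr0 //.
by move=> i /negbTE ij; rewrite eq_sym ij.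
Qed.

(** With s = (N+1)^(-1/2), a column u <= N is s followed by the u-th unit vector minus delta in
    every entry, and the last column is constantly s. Everything reduces to N s^2 + s^2 = 1 and N
    delta = 1 + s. *)
Lemma kappa_columns D j j' : (2 <= D)%N -> (1 <= j <= D)%N -> (1 <= j' <= D)%N ->
  \sum_(1 <= i < D.+1) kappa R D i j * kappa R D i j' = (j == j')%:R.
Proof.
case: D => [|N] // N1 hj hj'; rewrite ltnS in N1.
have N0 : N%:R != 0 :> R by rewrite pnatr_eq0 -lt0n.
have D0 : N.+1%:R != 0 :> R by rewrite pnatr_eq0.
pose s : R := (Num.sqrt N.+1%:R)^-1.
have s2 : s ^+ 2 = N.+1%:R^-1 by rewrite /s exprVn sqr_sqrtr ?ler0n.
have dE : delta R N = N%:R^-1 * (1 + s) by [].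
rewrite big_nat_recl //= {1 2}/kappa /= -/s.
pose e (u i : nat) : R := if u == N.+1 then s else (u == i)%:R - delta R N.
have ke u i : (1 <= i <= N)%N -> kappa R N.+1 i.+1 u = e u i.
  move=> /andP[i1 iN]; rewrite /kappa /e /= eqSS gtn_eqF //; case: eqP => // _.
  by case: eqP => _; rewrite ?add0r.
rewrite (eq_big_nat _ _ (F2 := fun i => e j i * e j' i)); last first.
  by move=> i hi; rewrite !ke.
have cst (c : R) : \sum_(1 <= i < N.+1) c = N%:R * c.
  by rewrite sumr_const_nat subn1 /= mulr_natl.
have s2N : N%:R * s ^+ 2 + s ^+ 2 = 1.
  by rewrite s2 -[X in _ + X]mul1r -mulrDl natr1 mulfV.
have one u : (1 <= u <= N)%N -> \sum_(1 <= i < N.+1) (u == i)%:R = 1 :> R.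
  by move=> hu; rewrite sum_nat_eq.
have oneM u v : (1 <= u <= N)%N ->
    \sum_(1 <= i < N.+1) (u == i)%:R * (v == i)%:R = (u == v)%:R :> R.
  move=> hu; case: (eqVneq u v) => [<-|uv].
    by rewrite -[RHS](one u hu); apply: eq_bigr => i _; case: eqP => _ /=; rewrite ?mulr1 ?mulr0.
  rewrite big1 // => i _; case: eqP => [<-|_]; rewrite ?mul0r // mul1r.
  by rewrite eq_sym (negbTE uv).
have lastN u : (1 <= u <= N)%N -> \sum_(1 <= i < N.+1) s * ((u == i)%:R - delta R N) + s * s = 0.
  move=> hu; rewrite -mulr_sumr sumrB one // cst dE -expr2.
  transitivity (s * (1 - (1 + s)) + s ^+ 2); last ring.
  by congr (s * (1 - _) + _); rewrite mulrA mulfV // mul1r.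
have bnd u : (1 <= u <= N.+1)%N -> u != N.+1 -> (1 <= u <= N)%N by lia.
rewrite /e addrC; case: (eqVneq j N.+1) => [jD|jD]; case: (eqVneq j' N.+1) => [jD'|jD'].
- by rewrite cst jD jD' eqxx -expr2.
- rewrite lastN ?bnd //; rewrite jD; have -> // : (N.+1 == j') = false.
  by rewrite eq_sym (negbTE jD').
- under eq_bigr => i _ do rewrite mulrC.
  by rewrite lastN ?bnd //; have -> // : (j == j') = false; rewrite jD' (negbTE jD).
- have hu := bnd _ hj jD; have hv := bnd _ hj' jD'.
  transitivity (\sum_(1 <= i < N.+1) ((j == i)%:R * (j' == i)%:R
     - delta R N * (j == i)%:R - delta R N * (j' == i)%:R + delta R N ^+ 2) + s * s).
    by congr (_ + _); apply: eq_bigr => i _ /=; ring.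
  rewrite big_split /= cst !sumrB oneM // -!mulr_sumr !one // dE.
  transitivity ((j == j')%:R + (N%:R^-1 * (s ^+ 2 - 1) + s ^+ 2)); first by field.
  have -> : s ^+ 2 - 1 = - (N%:R * s ^+ 2) by rewrite -[X in _ - X]s2N; ring.
  by field.
Qed.

Definition comb (D j : nat) (U : nat -> R -> R) (x : R) : R :=
  \sum_(1 <= i < D.+1) kappa R D i j * U i x.

(** The coordinate on U_i of the combination of the functions [comb D j U] with coefficients b_j.
    For i = 1 it is the sum of the entries divided by the square root of D. *)
Definition transform (D : nat) (b : nat -> R) (i : nat) : R :=
  \sum_(1 <= j < D.+1) kappa R D i j * b j.

Lemma sum_comb D (b : nat -> R) U x :
  \sum_(1 <= j < D.+1) b j * comb D j U x = \sum_(1 <= i < D.+1) transform D b i * U i x.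
Proof.
under eq_bigr => j _ do rewrite mulr_sumr.
rewrite exchange_big /=; apply: eq_bigr => i _; rewrite mulr_suml.
by apply: eq_bigr => j _; ring.
Qed.

Lemma sum_transform_sq D (b : nat -> R) : (2 <= D)%N ->
  \sum_(1 <= i < D.+1) transform D b i ^+ 2 = \sum_(1 <= j < D.+1) b j ^+ 2.
Proof.
move=> D2; transitivity (\sum_(1 <= j < D.+1) \sum_(1 <= j' < D.+1)
    b j * b j' * \sum_(1 <= i < D.+1) kappa R D i j * kappa R D i j').
  under eq_bigr => i _ do rewrite expr2 /transform mulr_suml.
  rewrite exchange_big /=; apply: eq_bigr => j _.
  under eq_bigr => i _ do rewrite mulr_sumr.
  rewrite exchange_big /=; apply: eq_bigr => j' _; rewrite mulr_sumr.
  by apply: eq_bigr => i _; ring.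
apply: eq_big_nat => j hj; rewrite (bigD1_seq j) ?iota_uniq ?mem_index_iota //=.
rewrite kappa_columns // eqxx mulr1 big_seq_cond big1 ?addr0 ?expr2 //.
move=> j' /andP[]; rewrite mem_index_iota => hj' /negbTE jj.
by rewrite kappa_columns // eq_sym jj mulr0.
Qed.

Variable S : sampling R.
Local Notation av := (av S).

Lemma av_comb L D j U D' j' U' :
  av L (fun x => comb D j U x * comb D' j' U' x) =
  \sum_(1 <= i < D.+1) \sum_(1 <= i' < D'.+1)
    kappa R D i j * kappa R D' i' j' * av L (fun x => U i x * U' i' x).
Proof.
rewrite /comb; under eq_av => x _ do rewrite mulr_suml.
rewrite av_sum; apply: eq_bigr => i _.
under eq_av => x _ do rewrite mulr_sumr.
rewrite av_sum; apply: eq_bigr => i' _.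
by rewrite -avZ; apply: eq_av => x _; ring.
Qed.

Lemma av_comb_orthonormal L D j j' U : (2 <= D)%N -> (1 <= j <= D)%N -> (1 <= j' <= D)%N ->
  (forall i i', (1 <= i <= D)%N -> (1 <= i' <= D)%N ->
     av L (fun x => U i x * U i' x) = (i == i')%:R) ->
  av L (fun x => comb D j U x * comb D j' U x) = (j == j')%:R.
Proof.
move=> D2 hj hj' hU; rewrite av_comb -(kappa_columns D2 hj hj').
apply: eq_big_nat => i hi; rewrite (bigD1_seq i) ?iota_uniq ?mem_index_iota //=.
rewrite hU // eqxx mulr1 big_seq_cond big1 ?addr0 //.
move=> i' /andP[]; rewrite mem_index_iota => hi' /negbTE ii.
by rewrite hU // eq_sym ii mulr0.
Qed.

Lemma av_comb_perp L D j D' j' U U' :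
  (forall i i', (1 <= i <= D)%N -> (1 <= i' <= D')%N ->
     av L (fun x => U i x * U' i' x) = 0) ->
  av L (fun x => comb D j U x * comb D' j' U' x) = 0.
Proof.
move=> hU; rewrite av_comb big_seq_cond big1 // => i /andP[]; rewrite mem_index_iota => hi _.
rewrite big_seq_cond big1 // => i' /andP[]; rewrite mem_index_iota => hi' _.
by rewrite hU // mulr0.
Qed.

Lemma av_comb_perp1 L D j U (G : R -> R) :
  (forall i, (1 <= i <= D)%N -> av L (fun x => U i x * G x) = 0) ->
  av L (fun x => comb D j U x * G x) = 0.
Proof.
move=> hU; rewrite /comb; under eq_av => x _ do rewrite mulr_suml.
rewrite av_sum big_seq_cond big1 // => i /andP[]; rewrite mem_index_iota => hi _.
under eq_av => x _ do rewrite -mulrA.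
by rewrite avZ hU // mulr0.
Qed.

End Kappa.

Lemma block_decode (len : nat -> nat) l : (forall n, (1 <= n)%N -> (1 <= len n)%N) ->
  (1 <= l)%N -> exists n j, [/\ (1 <= n)%N, (1 <= j <= len n)%N &
    l = (\sum_(1 <= i < n) len i + j)%N].
Proof.
move=> len1; elim: l => // -[|l] IH _.
  by exists 1%N, 1%N; rewrite big_geq // len1.
have [n [j [n1 /andP[j1 jn] e]]] := IH isT.
have [lt|ge] := ltnP j (len n).
  by exists n, j.+1; rewrite e addnS.
exists n.+1, 1%N; rewrite len1 // big_nat_recr //= e; split=> //; lia.
Qed.

(** * The functions xi_l: orthonormality and decay *)

Section Xi.
Context {R : realType}.
Variable S : sampling R.
Local Notation unitg := (unitg S).
Local Notation stepf := (stepf S).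
Local Notation av := (av S).
Variables (f : nat -> nat -> R -> R) (k : nat -> nat) (psi xi : nat -> R -> R).
Hypothesis gf : forall r, (2 <= r)%N -> generic_menshov S r (f r).
Hypothesis mf : forall r, (2 <= r)%N -> menshov_system r (f r).
Hypothesis gS : forall n i, (1 <= n)%N -> (i < 2 ^ (2 * n))%N -> stepf (k n) (g f k n i).
Hypothesis gE : forall n i, (1 <= n)%N -> (i < 2 ^ (2 * n))%N -> Estep 0 1 (k n) (g f k n i).
Hypothesis psiS : forall n nu, (1 <= n)%N -> (m k n.-1 < nu <= m k n)%N ->
  stepf (k n + 2) (psi nu).
Hypothesis psiB : forall n, (1 <= n)%N ->
  orthonormal_basis 0 1 (psi_space f k n) (m k n.-1) (m k n) psi.
Hypothesis xi_def : forall n nu j : nat, (1 <= n)%N ->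
  (m k n.-1 + 1 <= nu <= m k n)%N -> (1 <= j <= p k n)%N ->
  xi (rhonu k n nu + j)%N = phi k psi n nu j.

Local Notation bfun := (bfun f k psi).
Local Notation bvalid := (bvalid k).
Local Notation blev := (blev k).

Definition xibase (n nu i : nat) : base :=
  if i == 1%N then inl (n, nu) else inr (inl (qnu k n nu + i - 1)%N).

Definition xi_index (n nu j l : nat) : Prop :=
  [/\ (1 <= n)%N, (m k n.-1 < nu <= m k n)%N, (1 <= j <= p k n)%N &
    l = (rhonu k n nu + j)%N].

Lemma p_ge2 n : (2 <= p k n)%N.
Proof. by rewrite /p (@leq_exp2l 2 1) // addn1 mulnS. Qed.

Lemma m_ltS n : (1 <= n)%N -> (m k n.-1 < m k n)%N.
Proof. exact: m_lt gS n. Qed.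

Lemma xi_decode l : (1 <= l)%N -> exists n nu j, xi_index n nu j l.
Proof.
have pos n : (1 <= n)%N -> (1 <= p k n * (m k n - m k n.-1))%N.
  by move=> n1; rewrite muln_gt0 subn_gt0 m_ltS // (leq_trans _ (p_ge2 n)).
move=> l1; have [n [t [n1 /andP[t1 tn] ->]]] := block_decode pos l1.
have P0 : (0 < p k n)%N by exact: leq_trans (p_ge2 n).
exists n, (m k n.-1 + 1 + t.-1 %/ p k n)%N, (t.-1 %% p k n).+1.
have e := divn_eq t.-1 (p k n).
have h : (t.-1 %/ p k n < m k n - m k n.-1)%N by rewrite ltn_divLR // mulnC prednK.
split=> //.
- by clear e; move: h; move: (t.-1 %/ p k n)%N => z; have := m_ltS n1; lia.
- by rewrite ltn_mod.
rewrite /rhonu /rho prednK //.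
have -> : (m k n.-1 + 1 + t.-1 %/ p k n - m k n.-1 - 1 = t.-1 %/ p k n)%N.
  by move: (t.-1 %/ p k n)%N => z; lia.
by rewrite -addnA addnS -e prednK.
Qed.

Lemma xi_comb n nu j l x : xi_index n nu j l ->
  xi l x = comb (p k n) j (fun i => bfun (xibase n nu i)) x.
Proof.
move=> [n1 h hj ->]; rewrite xi_def ?addn1 // /phi /comb [in RHS]big_ltn; last first.
  by rewrite ltnS (leq_trans _ (p_ge2 n)).
congr (_ + _); apply: eq_big_nat => i /andP[i2 _].
by rewrite /xibase gtn_eqF.
Qed.

Lemma xibase_valid n nu i : (1 <= n)%N -> (m k n.-1 < nu <= m k n)%N -> (1 <= i)%N ->
  bvalid (xibase n nu i).
Proof.
move=> n1 h i1; rewrite /xibase; case: eqVneq => [_|ne] /=; first by rewrite n1 h.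
by rewrite subn_gt0 (leq_trans _ (leq_addl _ _)) // ltn_neqAle eq_sym ne.
Qed.

(** Each pair (n, nu) consumes p(n) - 1 consecutive Haar indices and the next pair starts after
    them, so no Haar function is used for two different psi_nu. *)
Lemma qnu_lt n nu n' nu' : (1 <= n)%N -> (m k n.-1 < nu <= m k n)%N ->
  (m k n'.-1 < nu' <= m k n')%N -> (n < n')%N || (n == n') && (nu < nu')%N ->
  (qnu k n nu + (p k n - 1) <= qnu k n' nu')%N.
Proof.
move=> n1 h h'; have := p_ge2 n; rewrite /qnu => p2.
case/orP => [nn|/andP[/eqP <- vv]].
  apply: (@leq_trans (\sum_(1 <= i < n.+1) q k i)).
    rewrite big_nat_recr //= -addnA leq_add2l /q -mulSnr mulnC leq_mul2l.
    by apply/orP; right; lia.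
  apply: leq_trans (leq_addr _ _).
  by rewrite [X in (_ <= X)%N](@big_cat_nat _ _ _ n.+1) //= leq_addr.
by rewrite -addnA leq_add2l -mulSnr leq_mul2r; apply/orP; right; lia.
Qed.

Lemma xibase_eq n nu i n' nu' i' : (1 <= n)%N -> (1 <= n')%N ->
  (m k n.-1 < nu <= m k n)%N -> (m k n'.-1 < nu' <= m k n')%N ->
  (1 <= i <= p k n)%N -> (1 <= i' <= p k n')%N ->
  xibase n nu i = xibase n' nu' i' -> [/\ n = n', nu = nu' & i = i'].
Proof.
move=> n1 n1' h h' hi hi'; rewrite /xibase.
case: eqP => [->|ni]; case: eqP => [->|ni'] //; first by case.
move=> [e].
have i2 : (2 <= i <= p k n)%N by lia.
have i2' : (2 <= i' <= p k n')%N by lia.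
have H := qnu_lt n1 h h'; have H' := qnu_lt n1' h' h.
case: (ltngtP n n') H H' => [lt|lt|en] /= H H'.
- by have := H isT; lia.
- by have := H' isT; lia.
- subst n'; case: (ltngtP nu nu') H H' => [lt|lt|en] /= H H'.
  + by have := H isT; lia.
  + by have := H' isT; lia.
  + by subst nu'; split=> //; lia.
Qed.

(** The sum serves as a simple common upper bound of the levels. *)
Definition xi_level n nu : nat := \sum_(1 <= i < (p k n).+1) blev (xibase n nu i).

Lemma xibase_level n nu i : (1 <= i <= p k n)%N -> (blev (xibase n nu i) <= xi_level n nu)%N.
Proof.
move=> hi; rewrite /xi_level (bigD1_seq i) ?iota_uniq ?mem_index_iota //=.
exact: leq_addr.
Qed.

Lemma stepf_xi n nu j l : xi_index n nu j l -> stepf (xi_level n nu) (xi l).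
Proof.
move=> hl; have [n1 h hj _] := hl.
apply: stepf_eq (fun x _ => xi_comb x hl) _.
apply: stepf_sum_nat => i hi; apply: stepfZ.
apply: stepf_le (xibase_level nu hi) _.
by apply: stepf_bfun => //; apply: xibase_valid => //; case/andP: hi.
Qed.

Lemma av_xi_index L n nu j l n' nu' j' l' : xi_index n nu j l -> xi_index n' nu' j' l' ->
  (xi_level n nu <= L)%N -> (xi_level n' nu' <= L)%N ->
  av L (fun x => xi l x * xi l' x) = [&& n == n', nu == nu' & j == j']%:R.
Proof.
move=> hl hl' lL lL'; have [n1 h hj el] := hl; have [n1' h' hj' el'] := hl'.
under eq_av => x _ do rewrite (xi_comb x hl) (xi_comb x hl').
have ort i i' : (1 <= i <= p k n)%N -> (1 <= i' <= p k n')%N ->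
    av L (fun x => bfun (xibase n nu i) x * bfun (xibase n' nu' i') x) =
    (xibase n nu i == xibase n' nu' i')%:R.
  move=> hi hi'; have [/andP[i1 _] /andP[i1' _]] := conj hi hi'.
  apply: base_orthonormal => //; try exact: xibase_valid.
  - exact: leq_trans (xibase_level nu hi) lL.
  - exact: leq_trans (xibase_level nu' hi') lL'.
rewrite andbA; have [|ne] := boolP ((n == n') && (nu == nu')).
  case/andP=> /eqP en /eqP ev; subst n' nu'.
  apply: av_comb_orthonormal => //; first exact: p_ge2.
  move=> i i' hi hi'; rewrite ort //; congr (nat_of_bool _)%:R.
  apply/eqP/eqP => [e|-> //].
  by have [] := xibase_eq n1 n1 h h hi hi' e.
apply: av_comb_perp => i i' hi hi'; rewrite ort //.
case: eqP => // e; have [en ev _] := xibase_eq n1 n1' h h' hi hi' e.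
by rewrite en ev !eqxx in ne.
Qed.

Lemma av_xi_g L n nu j l n' i : xi_index n nu j l -> bvalid (inr (inr (n', i))) ->
  (xi_level n nu <= L)%N -> (k n' <= L)%N -> av L (fun x => xi l x * g f k n' i x) = 0.
Proof.
move=> hl vg lL gL; have [n1 h hj el] := hl.
under eq_av => x _ do rewrite (xi_comb x hl).
apply: av_comb_perp1 => s hs; have /andP[s1 _] := hs.
have := @base_orthonormal _ _ _ _ _ gf mf gS gE psiS psiB L (xibase n nu s) (inr (inr (n', i))).
move=> -> //; first by rewrite /xibase; case: (s == 1)%N.
- exact: xibase_valid.
- exact: leq_trans (xibase_level nu hs) lL.
Qed.

Lemma xi_system : exists lx : nat -> nat,
  [/\ forall l, (1 <= l)%N -> stepf (lx l) (xi l),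
      forall L l l', (1 <= l)%N -> (1 <= l')%N -> (lx l <= L)%N -> (lx l' <= L)%N ->
        av L (fun x => xi l x * xi l' x) = (l == l')%:R &
      forall L l n i, (1 <= l)%N -> (1 <= n)%N -> (i < 2 ^ (2 * n))%N ->
        (lx l <= L)%N -> (k n <= L)%N -> av L (fun x => xi l x * g f k n i x) = 0].
Proof.
have : forall l, exists d : nat * nat * nat, (1 <= l)%N -> xi_index d.1.1 d.1.2 d.2 l.
  case=> [|l]; first by exists (0, 0, 0)%N.
  by have [n [nu [j h]]] := @xi_decode l.+1 isT; exists (n, nu, j).
move=> /choice[d dP]; exists (fun l => xi_level (d l).1.1 (d l).1.2); split.
- by move=> l l1; exact: stepf_xi (dP l l1).
- move=> L l l' l1 l1' lL lL'; rewrite (av_xi_index (dP l l1) (dP l' l1')) //.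
  congr (nat_of_bool _)%:R; apply/and3P/eqP => [[/eqP e1 /eqP e2 /eqP e3]|-> //].
  have [_ _ _ ->] := dP l l1; have [_ _ _ ->] := dP l' l1'.
  by rewrite e1 e2 e3.
- move=> L l n i l1 n1 iN lL nL; apply: (av_xi_g (dP l l1)) => //=.
  by rewrite n1.
Qed.

(** The squares of the values on the 2^(k_n + 2) cells have average 1, so none exceeds their
    number. *)
Lemma psi_bound n nu x : (1 <= n)%N -> (m k n.-1 < nu <= m k n)%N -> unitg x ->
  psi nu x ^+ 2 <= 2 ^+ (k n + 2).
Proof.
move=> n1 h ux; have [x0 x1 _] := ux.
have v : bvalid (inl (n, nu)) by rewrite /= n1 h.
have := base_orthonormal gf mf gS gE psiS psiB v v (leqnn _) (leqnn _).
rewrite eqxx /= /av; set L := (k n + 2)%N => e.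
have cL : (cell L x < 2 ^ L)%N by apply: cell_lt; rewrite x1 ltW.
rewrite (stepf_pt (psiS n1 h) ux) -/L.
have p0 : 0 < 2 ^+ L :> R by rewrite exprn_gt0.
have : \sum_(z < 2 ^ L) psi nu (pt S L z) * psi nu (pt S L z) = 2 ^+ L.
  by have := congr1 (fun y => 2 ^+ L * y) e; rewrite mulVKf ?gt_eqF // mulr1.
rewrite (bigD1 (Ordinal cL)) //= => <-.
by rewrite expr2 lerDl sumr_ge0 // => z _; rewrite -expr2 sqr_ge0.
Qed.

Lemma qnu_ge n nu : (1 <= n)%N -> (n <= qnu k n nu + 1)%N.
Proof.
move=> n1; rewrite /qnu; apply: (@leq_trans (\sum_(1 <= i < n) q k i + 1)); last first.
  by rewrite leq_add2r leq_addr.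
have : (\sum_(1 <= i < n) 1 <= \sum_(1 <= i < n) q k i)%N.
  rewrite big_nat_cond [X in (_ <= X)%N]big_nat_cond; apply: leq_sum => i /andP[/andP[i1 _] _].
  by rewrite /q muln_gt0 !subn_gt0 p_ge2 m_ltS.
by rewrite sum_nat_const_nat muln1; lia.
Qed.

(** The Haar functions involved have index above n and vanish to the right of 2^-n. What remains is
    psi_nu divided by the square root of p(n), whose square is at most 2^(k_n + 2) / 2^(2 k_n + 2) =
    2^-k_n. *)
Lemma xi_small n nu j l x : xi_index n nu j l -> unitg x -> (1 <= cell n x)%N ->
  xi l x ^+ 2 <= 2 ^- n.
Proof.
move=> hl ux cx; have [n1 h hj _] := hl; have [x0 x1 _] := ux.
rewrite (xi_comb x hl) /comb big_ltn; last by rewrite ltnS (leq_trans _ (p_ge2 n)).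
rewrite big_nat_cond big1 ?addr0; last first.
  move=> i /andP[/andP[i2 _] _]; rewrite /xibase gtn_eqF //=.
  rewrite (haar1E _ ux) /cell_ind gtn_eqF ?mul0r ?mulr0 //.
  have le : (n <= k (qnu k n nu + i - 1) + 1)%N.
    have h1 : (n <= qnu k n nu + i - 1)%N by have := qnu_ge nu n1; lia.
    have := level_ge gS (leq_trans n1 h1); lia.
  rewrite lt0n; apply/eqP => c0; move: cx; rewrite (cell_le (ltW x0) le) c0 div0n //.
rewrite /xibase /= /kappa /= exprMn exprVn sqr_sqrtr ?ler0n //.
have pE : (p k n)%:R = 2 ^+ (k n + 2) * 2 ^+ k n :> R.
  by rewrite -exprD natrX; congr (_ ^+ _); lia.
rewrite pE invfM -mulrA; apply: (@le_trans _ _ (2 ^- k n)).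
  rewrite mulrCA ler_piMr ?invr_ge0 ?exprn_ge0 //.
  by rewrite ler_pdivrMl ?exprn_gt0 // mulr1 psi_bound.
rewrite lef_pV2 ?posrE ?exprn_gt0 // ler_eXn2l ?ltr1n //.
by have := level_ge gS n1; lia.
Qed.

Lemma xi_index_large M : exists L0, forall n nu j l, (L0 <= l)%N -> xi_index n nu j l -> (M <= n)%N.
Proof.
exists (rho k M).+1 => n nu j l lM [n1 h hj el].
rewrite leqNgt; apply/negP => nM.
have : (l <= rho k n)%N.
  rewrite el /rhonu /rho prednK // [X in (_ <= X)%N]big_nat_recr //= -addnA leq_add2l.
  case/andP: hj => _ jp; apply: (@leq_trans ((nu - m k n.-1 - 1).+1 * p k n)).
    by rewrite mulSnr leq_add2l.
  by rewrite mulnC leq_mul2l; apply/orP; right; lia.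
apply/negP; rewrite -ltnNge; apply: leq_trans lM; rewrite ltnS /rho.
by rewrite [X in (_ <= X)%N](@big_cat_nat _ _ _ n.+1) ?ltnS ?(ltnW nM) //= leq_addr.
Qed.

(** A fixed x > 0 lies to the right of 2^-n for large n, and n tends to infinity with l. *)
Lemma xi_cvg0 x (e : R) : unitg x -> 0 < e -> exists L0, forall l, (L0 <= l)%N -> `|xi l x| <= e.
Proof.
move=> ux e0; have [x0 x1 _] := ux.
have [M1 hM1] : exists M, forall n, (M <= n)%N -> (1 <= cell n x)%N.
  exists (Num.bound x^-1) => n hn; rewrite /cell truncn_ge_nat; last first.
    by rewrite mulr_ge0 // ltW.
  rewrite -ler_pdivrMr // div1r; apply: (@le_trans _ _ (Num.bound x^-1)%:R).
    by apply: ltW; apply: archi_boundP; rewrite invr_ge0 ltW.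
  rewrite -natrX ler_nat; apply: leq_trans hn _; apply: ltnW; exact: ltn_expl.
have [M2 hM2] : exists M, forall n, (M <= n)%N -> 2 ^- n <= e ^+ 2.
  have e2 : 0 < e ^+ 2 by rewrite exprn_gt0.
  exists (Num.bound (e ^+ 2)^-1) => n hn.
  rewrite -[e ^+ 2]invrK lef_pV2 ?posrE ?invr_gt0 ?exprn_gt0 //.
  apply: (@le_trans _ _ (Num.bound (e ^+ 2)^-1)%:R).
    by apply: ltW; apply: archi_boundP; rewrite invr_ge0 ltW.
  rewrite -natrX ler_nat; apply: leq_trans hn _; apply: ltnW; exact: ltn_expl.
have [L0 hL0] := xi_index_large (maxn M1 M2).
exists (maxn L0 1) => l hl.
have [n [nu [j hi]]] := @xi_decode l (leq_trans (leq_maxr _ _) hl).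
have := hL0 _ _ _ _ (leq_trans (leq_maxl _ _) hl) hi; rewrite geq_max => /andP[n1 n2].
rewrite -(ler_pXn2r (ltn0Sn 1)) ?nnegrE ?normr_ge0 ?(ltW e0) // real_normK ?num_real //.
exact: le_trans (xi_small hi ux (hM1 _ n1)) (hM2 _ n2).
Qed.

End Xi.

(** * The system Upsilon_k: orthonormality and block sums *)

Section Upsilon.
Context {R : realType}.
Variable S : sampling R.
Local Notation stepf := (stepf S).
Local Notation av := (av S).
Variables (f : nat -> nat -> R -> R) (k : nat -> nat) (xi Ups : nat -> R -> R).
Variable lx : nat -> nat.
Hypothesis gS : forall n i, (1 <= n)%N -> (i < 2 ^ (2 * n))%N -> stepf (k n) (g f k n i).
Hypothesis xiS : forall l, (1 <= l)%N -> stepf (lx l) (xi l).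
Hypothesis xiM : forall L l l', (1 <= l)%N -> (1 <= l')%N -> (lx l <= L)%N -> (lx l' <= L)%N ->
  av L (fun x => xi l x * xi l' x) = (l == l')%:R.
Hypothesis xi_g : forall L l n i, (1 <= l)%N -> (1 <= n)%N -> (i < 2 ^ (2 * n))%N ->
  (lx l <= L)%N -> (k n <= L)%N -> av L (fun x => xi l x * g f k n i x) = 0.
Hypothesis ggM : forall L n i n' i', (1 <= n)%N -> (1 <= n')%N ->
  (i < 2 ^ (2 * n))%N -> (i' < 2 ^ (2 * n'))%N -> (k n <= L)%N -> (k n' <= L)%N ->
  av L (fun x => g f k n i x * g f k n' i' x) = ((n == n') && (i == i'))%:R.
Hypothesis Ups_def : forall n j : nat, (1 <= n)%N ->
  (1 <= j <= 2 ^ (2 * n) + 1)%N -> Ups (mu n.-1 + j)%N = upsilon f k xi n j.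

Definition block_size (n : nat) : nat := (2 ^ (2 * n) + 1)%N.

Definition block_fun (n i : nat) : R -> R := if i == 1%N then xi n else g f k n (i - 2).

Definition block_level (n : nat) : nat := (lx n + k n)%N.

Lemma block_size_ge2 n : (2 <= block_size n)%N.
Proof. by rewrite /block_size addn1 ltnS expn_gt0. Qed.

Lemma stepf_block_fun n i : (1 <= n)%N -> (1 <= i <= block_size n)%N ->
  stepf (block_level n) (block_fun n i).
Proof.
move=> n1 hi; rewrite /block_fun; case: eqVneq => [_|ne].
  by apply: stepf_le (xiS n1); exact: leq_addr.
apply: (@stepf_le _ _ _ (k n)); first exact: leq_addl.
apply: gS => //; move: hi; rewrite /block_size; lia.
Qed.

Lemma av_block_fun L n i n' i' : (1 <= n)%N -> (1 <= n')%N ->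
  (1 <= i <= block_size n)%N -> (1 <= i' <= block_size n')%N ->
  (block_level n <= L)%N -> (block_level n' <= L)%N ->
  av L (fun x => block_fun n i x * block_fun n' i' x) = ((n == n') && (i == i'))%:R.
Proof.
rewrite /block_size /block_level /block_fun => n1 n1' hi hi' lL lL'.
have lx1 : (lx n <= L)%N by lia.
have lx2 : (lx n' <= L)%N by lia.
have k1 : (k n <= L)%N by lia.
have k2 : (k n' <= L)%N by lia.
case: (altP (i =P 1%N)) => [ei|ni]; case: (altP (i' =P 1%N)) => [ei'|ni'].
- by rewrite xiM // ei ei' eqxx andbT.
- rewrite xi_g //; last by lia.
  by rewrite ei [(1 == i')%N]eq_sym (negbTE ni') andbF.
- under eq_av => x _ do rewrite mulrC.
  rewrite xi_g //; last by lia.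
  by rewrite ei' (negbTE ni) andbF.
- rewrite ggM //; try lia; congr (nat_of_bool _)%:R; congr (_ && _).
  by apply/eqP/eqP; lia.
Qed.

Lemma upsilon_comb n j x : (1 <= n)%N -> (1 <= j <= block_size n)%N ->
  Ups (mu n.-1 + j) x = comb (block_size n) j (block_fun n) x.
Proof.
move=> n1 hj; rewrite Ups_def // /upsilon /comb [in RHS]big_ltn; last first.
  by rewrite ltnS (leq_trans _ (block_size_ge2 n)).
congr (_ + _); apply: eq_big_nat => i /andP[i2 _].
by rewrite /block_fun gtn_eqF.
Qed.

Lemma mu_sum n : (1 <= n)%N -> mu n.-1 = (\sum_(1 <= i < n) block_size i)%N.
Proof. by move=> n1; rewrite /mu prednK. Qed.

Lemma upsilon_decode l : (1 <= l)%N -> exists n j, [/\ (1 <= n)%N, (1 <= j <= block_size n)%N &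
  l = (mu n.-1 + j)%N].
Proof.
move=> l1; have pos n : (1 <= n)%N -> (1 <= block_size n)%N.
  by move=> _; exact: leq_trans (block_size_ge2 n).
have [n [j [n1 hj e]]] := block_decode pos l1.
by exists n, j; rewrite mu_sum.
Qed.

Lemma stepf_upsilon n j : (1 <= n)%N -> (1 <= j <= block_size n)%N ->
  stepf (block_level n) (Ups (mu n.-1 + j)).
Proof.
move=> n1 hj; apply: (stepf_eq (fun x _ => @upsilon_comb n j x n1 hj)).
by apply: stepf_sum_nat => i hi; apply: stepfZ; exact: stepf_block_fun.
Qed.

Lemma av_upsilon L n j n' j' : (1 <= n)%N -> (1 <= n')%N ->
  (1 <= j <= block_size n)%N -> (1 <= j' <= block_size n')%N ->
  (block_level n <= L)%N -> (block_level n' <= L)%N ->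
  av L (fun x => Ups (mu n.-1 + j) x * Ups (mu n'.-1 + j') x) = ((n == n') && (j == j'))%:R.
Proof.
move=> n1 n1' hj hj' L1 L2.
under eq_av => x _ do rewrite !upsilon_comb //.
case: (eqVneq n n') => [en|nn] /=.
  subst n'; apply: av_comb_orthonormal => //; first exact: block_size_ge2.
  by move=> i i' hi hi'; rewrite av_block_fun // eqxx.
by apply: av_comb_perp => i i' hi hi'; rewrite av_block_fun // (negbTE nn).
Qed.

Lemma upsilon_orthonormal : Defs.orthonormal 0 1 [set l | (1 <= l)%N] Ups.
Proof.
have : forall l, exists d : nat * nat, (1 <= l)%N ->
    [/\ (1 <= d.1)%N, (1 <= d.2 <= block_size d.1)%N & l = (mu d.1.-1 + d.2)%N].
  case=> [|l]; first by exists (0, 0)%N.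
  by have [n [j h]] := @upsilon_decode l.+1 isT; exists (n, j).
move=> /choice[d dP]; split=> [l l1|l l' l1 l1'] /=.
  by have [n1 hj ->] := dP l l1; exact: L2_stepf (stepf_upsilon n1 hj).
have [n1 hj el] := dP l l1; have [n1' hj' el'] := dP l' l1'.
have -> : (l == l') = ((d l).1 == (d l').1) && ((d l).2 == (d l').2).
  by apply/eqP/andP => [->|[/eqP e1 /eqP e2]]; rewrite ?eqxx // el el' e1 e2.
pose L := (block_level (d l).1 + block_level (d l').1)%N.
have L1 : (block_level (d l).1 <= L)%N by exact: leq_addr.
have L2 : (block_level (d l').1 <= L)%N by exact: leq_addl.
have s1 : stepf L (Ups l) by rewrite el; exact: stepf_le L1 (stepf_upsilon n1 hj).
have s2 : stepf L (Ups l') by rewrite el'; exact: stepf_le L2 (stepf_upsilon n1' hj').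
rewrite (inner_stepf s1 s2).
have := av_upsilon n1 n1' hj hj' L1 L2; rewrite -el -el'; exact.
Qed.

Lemma block_partial_sum (a : nat -> R) n x : (1 <= n)%N ->
  \sum_(1 <= l < (mu n).+1) a l * Ups l x = \sum_(1 <= l < (mu n.-1).+1) a l * Ups l x +
  \sum_(1 <= j < (block_size n).+1) a (mu n.-1 + j)%N * Ups (mu n.-1 + j)%N x.
Proof.
move=> n1; have e : mu n = (mu n.-1 + block_size n)%N.
  by rewrite (mu_sum n1) /mu big_nat_recr.
rewrite e (@big_cat_nat _ _ _ (mu n.-1).+1) //= ?ltnS ?leq_addr //; congr (_ + _).
rewrite -(add1n (mu n.-1)) big_addn.
have -> : ((mu n.-1 + block_size n).+1 - mu n.-1 = (block_size n).+1)%N by lia.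
by apply: eq_big_nat => j _; rewrite addnC.
Qed.

End Upsilon.

(** * Oscillation within a block *)

Section Menshov.
Context {R : realType}.
Variables (n : nat) (Mval : nat -> nat -> R) (b : nat -> R) (beta theta dlt : R).
Local Notation N := (2 ^ (2 * n))%N.

Definition harmonic_sum (q : nat) : R := \sum_(t < q) t.+1%:R^-1.

Lemma harmonic_sum_ge0 q : 0 <= harmonic_sum q.
Proof. by apply: sumr_ge0 => t _; rewrite invr_ge0 ler0n. Qed.

(** For j = 2n this is H >= n, which compensates the factor 1/n of ghat_n^i. *)
Lemma harmonic_sum_pow2 j : j%:R / 2 <= harmonic_sum (2 ^ j - 1).
Proof.
elim: j => [|j IH]; first by rewrite mul0r harmonic_sum_ge0.
have p0 : (0 < 2 ^ j)%N by rewrite expn_gt0.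
have e : (2 ^ j.+1 - 1 = (2 ^ j - 1) + 2 ^ j)%N by rewrite expnS; lia.
rewrite /harmonic_sum e -(big_mkord xpredT (fun t => t.+1%:R^-1)).
rewrite (@big_cat_nat _ _ _ (2 ^ j - 1)) ?leq_addr //= big_mkord.
apply: (@le_trans _ _ (j%:R / 2 + 2^-1)); first by rewrite -natr1; lra.
apply: lerD => //; rewrite -{1}[(2 ^ j - 1)%N]add0n big_addn addnC addnK.
apply: (@le_trans _ _ (\sum_(0 <= i < 2 ^ j) (2 ^ j.+1)%:R^-1)).
  rewrite sumr_const_nat subn0 -(mulr_natl _ (2 ^ j)) expnS natrM invfM.
  by rewrite mulrCA mulfV ?mulr1 // pnatr_eq0 -lt0n.
apply: ler_sum_nat => i /andP[_ hi].
rewrite lef_pV2 ?posrE ?ltr0n ?expn_gt0 // ler_nat expnS; lia.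
Qed.

(** The indices i for which cell t lies on the positive branch of the i-th shifted Menshov function;
    that branch has N - 1 cells. *)
Definition in_window (t i : nat) : bool := (i <= t)%N && (t - i < N - 1)%N.

Definition window_weight (t i : nat) : R :=
  if in_window t i then (t - i).+1%:R^-1 else 0.

Let H : R := harmonic_sum (N - 1).

Lemma N_gt0 : (0 < N)%N. Proof. by rewrite expn_gt0. Qed.

(** Splitting by the diagonals t - i = s makes the row and column sums of the weights mere
    counts. *)
Lemma window_weightE t i :
  window_weight t i = \sum_(s < N - 1) (i + s == t)%N%:R * s.+1%:R^-1.
Proof.
rewrite /window_weight /in_window; case: ifP => [/andP[it tN]|h].
  rewrite (bigD1 (Ordinal tN)) //= subnKC // eqxx mul1r big1 ?addr0 // => s hs.
  case: eqP => [e|]; last by rewrite mul0r.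
  by case/eqP: hs; apply/val_inj; rewrite /= -e addKn.
rewrite big1 // => s _; case: eqP => [e|]; last by rewrite mul0r.
by move: h; rewrite -e leq_addr addKn ltn_ord.
Qed.

Lemma sum_window_col i : (i < N)%N -> \sum_(t < 2 * N) window_weight t i = H.
Proof.
move=> iN; under eq_bigr do rewrite window_weightE.
rewrite exchange_big /=; apply: eq_bigr => s _; rewrite -mulr_suml.
have lt : (i + s < 2 * N)%N by have := ltn_ord s; lia.
rewrite (bigD1 (Ordinal lt)) //= eqxx big1 ?addr0 ?mul1r // => t ht.
by case: eqP => // e; case/eqP: ht; apply/val_inj.
Qed.

Lemma sum_window_row t : \sum_(i < N) window_weight t i <= H.
Proof.
under eq_bigr do rewrite window_weightE.
rewrite exchange_big /=; apply: ler_sum => s _; rewrite -mulr_suml.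
rewrite ler_piMl ?invr_ge0 ?ler0n //.
have [lt|ge] := boolP ((s <= t)%N && (t - s < N)%N).
  case/andP: lt => st lt; rewrite (bigD1 (Ordinal lt)) //= subnK // eqxx big1 ?addr0 // => i hi.
  by case: eqP => // e; case/eqP: hi; apply/val_inj; rewrite /= -e addnK.
rewrite big1 // => i _; case: eqP => // e; case/negP: ge.
by rewrite -e leq_addl addnK ltn_ord.
Qed.

Let m (t : nat) : R := \sum_(i < N) Mval t i.

(** The subtracted multiple of the total [m t] mirrors the form of Upsilon_j, which is g_n^{j-1}
    minus delta times the sum of all g_n^i, apart from the xi_n term. *)
Definition oscillation (t : nat) : R :=
  \sum_(i < N | in_window t i) b i * (Mval t i - dlt * m t).

(** Only a sum over an interval of indices is a difference of two partial sums of the series. *)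
Lemma oscillation_interval t : exists J1 J2, [/\ (J1 <= J2)%N, (J2 <= N)%N &
  oscillation t = \sum_(J1 <= i < J2) b i * (Mval t i - dlt * m t)].
Proof.
(* The window is t + 2 - N <= i <= t, clipped to 0 <= i < N; truncated subtraction does the clipping
   at 0. *)
pose J1 := minn (t.+2 - N) (minn t.+1 N); pose J2 := minn t.+1 N.
exists J1, J2; have J12 : (J1 <= J2)%N by rewrite /J1; exact: geq_minr.
have J2N : (J2 <= N)%N by exact: geq_minr.
split=> //; rewrite /oscillation.
pose F i := b i * (Mval t i - dlt * m t).
rewrite -(big_mkord (fun i => in_window t i) F).
rewrite (@big_cat_nat _ _ _ J2) //= (@big_cat_nat _ _ _ J1 0) //=.
have N0 := N_gt0.
rewrite big_nat_cond big1 ?add0r; last first.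
  move=> i /andP[/andP[_ i1]]; rewrite /in_window => /andP[h1 h2].
  by exfalso; move: i1; rewrite /J1; lia.
rewrite addrC big_nat_cond big1 ?add0r; last first.
  move=> i /andP[/andP[i1 i2]]; rewrite /in_window => /andP[h1 h2].
  by exfalso; move: i1; rewrite /J2; lia.
rewrite big_nat_cond [RHS]big_nat_cond; apply: eq_bigl => i; rewrite andbT.
case: (boolP (J1 <= i < J2)%N) => //= /andP[i1 i2]; rewrite /in_window.
by move: i1 i2; rewrite /J1 /J2; lia.
Qed.

Hypothesis M_window : forall t i, (t < 2 * N)%N -> (i < N)%N -> in_window t i ->
  Mval t i = 2 ^+ n / 8 * (t - i).+1%:R^-1.
Hypothesis M_total : \sum_(t < 2 * N) (\sum_(i < N) Mval t i) ^+ 2 <= N%:R ^+ 2.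
Hypotheses (dlt0 : 0 <= dlt) (dltN : dlt * N%:R <= 2).
Hypotheses (beta0 : 0 < beta) (b_beta : \sum_(i < N) b i ^+ 2 <= beta ^+ 2).
Hypotheses (theta0 : 0 < theta) (b_sum : theta / 2 * 2 ^+ n * beta <= `|\sum_(i < N) b i|).
Hypotheses (H96 : 96 <= theta * H) (H3 : 3 <= H).

Let T (t : nat) : R := 2 ^+ n / 8 * \sum_(i < N) window_weight t i * b i.
Let Bw (t : nat) : R := \sum_(i < N | in_window t i) b i.
Let Q (t : nat) : R := dlt * (Bw t * m t).

Let NE : N%:R = 2 ^+ n ^+ 2 :> R.
Proof. by rewrite natrX mulnC exprM. Qed.

Let c0 : 0 < 2 ^+ n :> R. Proof. by rewrite exprn_gt0. Qed.
Let H0 : 0 < H. Proof. by apply: lt_le_trans H3. Qed.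

Lemma oscillationE t : (t < 2 * N)%N -> oscillation t = T t - Q t.
Proof.
move=> tN; rewrite /oscillation /T /Q /Bw; move: (m t) => mt.
rewrite mulr_sumr mulr_suml mulr_sumr.
rewrite [X in _ = X - _](_ : _ = \sum_(i < N | in_window t i) b i * Mval t i).
  by rewrite -sumrB; apply: eq_bigr => i _; ring.
rewrite [RHS]big_mkcond; apply: eq_bigr => i _; rewrite /window_weight.
by case: ifP => w; [rewrite M_window //; ring | rewrite mul0r mulr0].
Qed.

(** All columns of the weights have the same sum H, so nothing cancels beyond the cancellation in
    the sum of the b_i itself. *)
Lemma sum_T : \sum_(t < 2 * N) T t = 2 ^+ n / 8 * H * \sum_(i < N) b i.
Proof.
rewrite -mulr_sumr exchange_big /= -mulrA; congr (_ * _).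
rewrite mulr_sumr; apply: eq_bigr => i _.
by rewrite -mulr_suml sum_window_col.
Qed.

Lemma window_weight_ge0 t i : 0 <= window_weight t i.
Proof. by rewrite /window_weight; case: ifP => _; rewrite ?invr_ge0 ?ler0n. Qed.

(** Schur's test: row sums at most H and column sums equal to H bound the operator norm of the
    weights by H. *)
Lemma sum_T_sq : \sum_(t < 2 * N) T t ^+ 2 <= N%:R / 64 * H ^+ 2 * beta ^+ 2.
Proof.
have Tsq t : T t ^+ 2 <= N%:R / 64 * H * \sum_(i < N) window_weight t i * b i ^+ 2.
  rewrite /T exprMn.
  have -> : (2 ^+ n / 8) ^+ 2 = N%:R / 64 :> R by rewrite NE; field.
  rewrite -mulrA; apply: ler_wpM2l; first by rewrite divr_ge0 ?ler0n.
  have := @weighted_cauchy_schwarz R 'I_N (index_enum _) xpredT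
    (fun i => window_weight t i) (fun=> 1) (fun i => b i) (fun i _ => window_weight_ge0 t i).
  under eq_bigr do rewrite mul1r; move=> h; apply: le_trans h _.
  apply: ler_wpM2r.
    by apply: sumr_ge0 => i _; rewrite mulr_ge0 ?window_weight_ge0 ?sqr_ge0.
  under eq_bigr do rewrite expr1n mulr1; exact: sum_window_row.
apply: le_trans (ler_sum _ (fun (t : 'I__) _ => Tsq t)) _.
rewrite -mulr_sumr exchange_big /=.
rewrite (eq_bigr (fun i : 'I_N => H * b i ^+ 2)); last first.
  by move=> i _; rewrite -mulr_suml sum_window_col.
rewrite -mulr_sumr.
have -> : N%:R / 64 * H ^+ 2 * beta ^+ 2 = N%:R / 64 * H * (H * beta ^+ 2) :> R by ring.
apply: ler_wpM2l; first by rewrite mulr_ge0 ?divr_ge0 ?ler0n ?ltW.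
by apply: ler_wpM2l => //; exact: ltW.
Qed.

Lemma Bw_sq t : Bw t ^+ 2 <= N%:R * beta ^+ 2.
Proof.
have := @sum_cauchy_schwarz R 'I_N (index_enum _) (fun i => in_window t i) (fun=> 1) (fun i => b i).
under eq_bigr do rewrite mul1r; move=> h; apply: le_trans h _.
apply: ler_pM.
- by apply: sumr_ge0 => i _; rewrite sqr_ge0.
- by apply: sumr_ge0 => i _; rewrite sqr_ge0.
- under eq_bigr do rewrite expr1n; rewrite sumr_const ler_nat.
  by apply: leq_trans (max_card _) _; rewrite card_ord.
- apply: le_trans b_beta; rewrite [leRHS](bigID (fun i : 'I_N => in_window t i)) /= lerDl.
  by apply: sumr_ge0 => i _; rewrite sqr_ge0.
Qed.

(** The bound 2 / N on delta outweighs the number of functions. There is no factor H, so this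
    correction is negligible against T once H is large. *)
Lemma sum_Q_sq : \sum_(t < 2 * N) Q t ^+ 2 <= 4 * N%:R * beta ^+ 2.
Proof.
apply: (@le_trans _ _ (\sum_(t < 2 * N) dlt ^+ 2 * (N%:R * beta ^+ 2) * m t ^+ 2)).
  apply: ler_sum => t _; rewrite /Q !exprMn mulrA; apply: ler_wpM2r; first exact: sqr_ge0.
  by apply: ler_wpM2l; [exact: sqr_ge0 | exact: Bw_sq].
rewrite -mulr_sumr; apply: le_trans (_ : dlt ^+ 2 * (N%:R * beta ^+ 2) * N%:R ^+ 2 <= _).
  apply: ler_wpM2l M_total; apply: mulr_ge0; first exact: sqr_ge0.
  by apply: mulr_ge0; [rewrite ler0n | exact: sqr_ge0].
have -> : dlt ^+ 2 * (N%:R * beta ^+ 2) * N%:R ^+ 2 =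
    (dlt * N%:R) ^+ 2 * (N%:R * beta ^+ 2) by ring.
rewrite -[leRHS]mulrA; apply: ler_wpM2r; first by rewrite mulr_ge0 ?ler0n ?sqr_ge0.
have h0 : 0 <= dlt * N%:R by rewrite mulr_ge0 ?ler0n.
by move: h0 dltN; move: (dlt * N%:R) => z; nra.
Qed.

Lemma sum_Q : `|\sum_(t < 2 * N) Q t| <= 3 * N%:R * beta.
Proof.
have n0 : 0 <= 3 * N%:R * beta by rewrite !mulr_ge0 ?ler0n ?ltW.
rewrite -(ler_pXn2r (ltn0Sn 1)) ?nnegrE // real_normK ?num_real //.
have := @sum_cauchy_schwarz R 'I_(2 * N) (index_enum _) xpredT (fun=> 1) (fun t => Q t).
under eq_bigr do rewrite mul1r; move=> h; apply: le_trans h _.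
under eq_bigr do rewrite expr1n; rewrite sumr_const card_ord.
apply: le_trans (ler_wpM2l (ler0n _ _) sum_Q_sq) _.
rewrite natrM; have : 0 <= (N%:R * beta) ^+ 2 by exact: sqr_ge0.
by move=> ?; nra.
Qed.

(** A Paley-Zygmund argument. The main part gives a sum of at least N beta theta H / 16, and the
    correction costs at most 3 N beta <= N beta theta H / 32 by the condition 96 <= theta H. The
    threshold e is half of the resulting mean over the 2N cells, so the values above e retain N beta
    theta H / 64; Cauchy-Schwarz against the second moment N H^2 beta^2 then counts them. *)
Lemma oscillation_frequent :
  N%:R * (theta / 64) ^+ 2 <=
  \sum_(t < 2 * N) (theta / 128 * H * beta <= `|oscillation t|)%R%:R :> R.
Proof.
set e := theta / 128 * H * beta.
have e0 : 0 <= e by rewrite /e !mulr_ge0 ?ltW // divr_gt0.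
set C := \sum_(t < 2 * N) _.
have N0 : 0 < N%:R :> R by rewrite ltr0n N_gt0.
have V2 : \sum_(t < 2 * N) oscillation t ^+ 2 <= N%:R * H ^+ 2 * beta ^+ 2.
  apply: (@le_trans _ _ (\sum_(t < 2 * N) (2 * T t ^+ 2 + 2 * Q t ^+ 2))).
    apply: ler_sum => t _; rewrite oscillationE // -subr_ge0.
    have -> : 2 * T t ^+ 2 + 2 * Q t ^+ 2 - (T t - Q t) ^+ 2 = (T t + Q t) ^+ 2 by ring.
    exact: sqr_ge0.
  rewrite big_split /= -!mulr_sumr; have := sum_T_sq; have := sum_Q_sq.
  have : 0 <= N%:R * beta ^+ 2 by rewrite mulr_ge0 ?ler0n ?sqr_ge0.
  set u := N%:R * beta ^+ 2 => u0.
  have -> : 4 * N%:R * beta ^+ 2 = 4 * u by rewrite /u; ring.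
  have -> : N%:R / 64 * H ^+ 2 * beta ^+ 2 = u * H ^+ 2 / 64 by rewrite /u; field.
  have -> : N%:R * H ^+ 2 * beta ^+ 2 = u * H ^+ 2 by rewrite /u; ring.
  have h9 : 9 * u <= u * H ^+ 2.
    by rewrite mulrC; apply: ler_wpM2l => //; move: H3; nra.
  by move=> h1 h2; lra.
have V1 : N%:R * beta * theta * H / 32 <= \sum_(t < 2 * N) `|oscillation t|.
  apply: le_trans (ler_norm_sum _ _ _).
  have -> : \sum_(t < 2 * N) oscillation t = \sum_(t < 2 * N) T t - \sum_(t < 2 * N) Q t.
    by rewrite -sumrB; apply: eq_bigr => t _; rewrite oscillationE.
  rewrite sum_T; apply: le_trans (lerB_dist _ _); have := sum_Q.
  rewrite normrM ger0_norm; last by rewrite mulr_ge0 ?ltW // divr_gt0.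
  have : 2 ^+ n / 8 * H * (theta / 2 * 2 ^+ n * beta) <= 2 ^+ n / 8 * H * `|\sum_(i < N) b i|.
    by apply: ler_wpM2l b_sum; rewrite mulr_ge0 ?ltW // divr_gt0.
  have -> : 2 ^+ n / 8 * H * (theta / 2 * 2 ^+ n * beta) = N%:R * beta * (theta * H) / 16.
    by rewrite NE; field.
  have Nb : 0 < N%:R * beta by rewrite mulr_gt0.
  have h96 : N%:R * beta * 96 <= N%:R * beta * (theta * H) by rewrite ler_pM2l.
  have -> : N%:R * beta * theta * H / 32 = N%:R * beta * (theta * H) / 32 by ring.
  by move=> h1 h2; lra.
pose G (t : 'I_(2 * N)) : R := (e <= `|oscillation t|)%R%:R.
have split1 : \sum_(t < 2 * N) `|oscillation t| <=
    2 * N%:R * e + \sum_(t < 2 * N) G t * `|oscillation t|.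
  have -> : 2 * N%:R * e = \sum_(t < 2 * N) e.
    by rewrite sumr_const card_ord -(mulr_natl e) natrM.
  rewrite -big_split /=; apply: ler_sum => t _; rewrite /G; case: (leP e `|oscillation t|) => h.
    by rewrite mul1r lerDr.
  by rewrite mul0r addr0 ltW.
have G2 : (\sum_(t < 2 * N) G t * `|oscillation t|) ^+ 2 <= C * (N%:R * H ^+ 2 * beta ^+ 2).
  apply: le_trans (sum_cauchy_schwarz _ _ _ _) _; apply: ler_pM.
  - by apply: sumr_ge0 => t _; exact: sqr_ge0.
  - by apply: sumr_ge0 => t _; exact: sqr_ge0.
  - apply: ler_sum => t _; rewrite /G; case: (e <= `|oscillation t|); by rewrite ?expr1n ?expr0n.
  - by under eq_bigr do rewrite real_normK ?num_real //.
set X := \sum_(t < 2 * N) G t * _ in split1 G2.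
have X1 : N%:R * (beta * (theta * H)) / 64 <= X.
  have : 2 * N%:R * e = N%:R * (beta * (theta * H)) / 64 by rewrite /e; field.
  have : N%:R * beta * theta * H / 32 = N%:R * (beta * (theta * H)) / 32 by ring.
  by move=> h1 h2; rewrite h2 in split1; rewrite h1 in V1; lra.
have X2 : (N%:R * (beta * (theta * H)) / 64) ^+ 2 <= C * (N%:R * H ^+ 2 * beta ^+ 2).
  apply: le_trans G2; rewrite ler_pXn2r ?nnegrE //.
    by rewrite divr_ge0 // !mulr_ge0 ?ler0n ?ltW.
  apply: le_trans X1; by rewrite divr_ge0 // !mulr_ge0 ?ler0n ?ltW.
have K0 : 0 < N%:R * H ^+ 2 * beta ^+ 2 by rewrite !mulr_gt0 // exprn_gt0.
rewrite -(ler_pM2r K0); apply: le_trans X2; rewrite le_eqVlt; apply/orP; left; apply/eqP.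
by field.
Qed.

End Menshov.

(** * From the matrix of Menshov values to the rescaled functions of a block *)

Section BlockOscillation.
Context {R : realType}.
Variable S : sampling R.
Local Notation unitg := (unitg S).
Local Notation av := (av S).
Variables (f : nat -> nat -> R -> R) (k : nat -> nat).
Hypothesis gf : forall r, (2 <= r)%N -> generic_menshov S r (f r).
Hypothesis mf : forall r, (2 <= r)%N -> menshov_system r (f r).
Variable n : nat.
Hypothesis n3 : (3 <= n)%N.
Local Notation r := (2 * n)%N.
Local Notation N := (2 ^ (2 * n))%N.
Local Notation T := (2 * n ^ 2)%N.
Let r2 : (2 <= r)%N. Proof. by lia. Qed.
Let n2 : (2 <= n)%N. Proof. by lia. Qed.

Definition Mval (t i : nat) : R := menshov_value r (t%:Z - i%:Z).

Lemma sqrt_pow2_even : Num.sqrt (2 ^+ r) = 2 ^+ n :> R.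
Proof. by rewrite mulnC exprM sqrtr_sqr ger0_norm // exprn_ge0. Qed.

Lemma Mval_window t i : in_window n t i -> Mval t i = 2 ^+ n / 8 * (t - i).+1%:R^-1.
Proof.
move=> /andP[it h]; rewrite /Mval subzn // menshov_value_window ?sqrt_pow2_even //.
by have := N_gt0 n; lia.
Qed.

(* On the first and the last quarter of its period the rescaled f_r^i is the
   Menshov function; t ranges over the 2N cells of these two quarters. *)
Lemma quarters_av L (F : R -> R) (Phi : nat -> R) : (r + 2 <= L)%N ->
  (forall w, unitg w -> 0 <= F w) ->
  (forall w, unitg w -> cell 2 w = 0%N -> F w = Phi (cell (r + 2) w)) ->
  (forall w, unitg w -> cell 2 w = 3 -> F w = Phi (cell (r + 2) w - 2 * N)%N) ->
  (4 * N%:R)^-1 * \sum_(t < 2 * N) Phi t <= av L F.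
Proof.
move=> rL F0 Fq0 Fq3.
pose Psi z := if (z < N)%N then Phi z else if (3 * N <= z)%N then Phi (z - 2 * N)%N else 0.
have N0 := N_gt0 n.
have e4 : (2 ^ (r + 2) = N + (2 * N + N))%N by rewrite expnD; lia.
have cell2 w : unitg w -> cell 2 w = (cell (r + 2) w %/ N)%N.
  by move=> [w0 _ _]; exact: cellD (ltW w0).
apply: (@le_trans _ _ (av L (fun w => Psi (cell (r + 2) w)))); last first.
  apply: av_le => w uw; have [w0 w1 _] := uw; rewrite /Psi.
  have lt : (cell (r + 2) w < 4 * N)%N.
    by have : (cell (r + 2) w < 2 ^ (r + 2))%N; [apply: cell_lt; rewrite w1 ltW | lia].
  case: ltnP => h0; first by rewrite Fq0 // cell2 // divn_small.
  case: leqP => h3; last exact: F0.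
  rewrite Fq3 // cell2 //; apply/eqP.
  by rewrite eqn_leq leq_divRL // h3 -ltnS ltn_divLR // lt.
rewrite (@av_stepf _ S (r + 2)) //; last exact: (stepf_comp Psi (@stepf_cell _ S (r + 2))).
rewrite /av; have -> : 2 ^- (r + 2) = (4 * N%:R)^-1 :> R.
  by rewrite exprD natrX [4](_ : _ = 2 ^+ 2) ?[_ * 2 ^+ 2]mulrC // expr2; lra.
apply: ler_wpM2l; first by rewrite invr_ge0 mulr_ge0 ?ler0n.
rewrite (eq_bigr (fun z : 'I_(2 ^ (r + 2)) => Psi z)); last first.
  by move=> z _; rewrite cell_pt.
rewrite -(big_mkord xpredT Psi) -(big_mkord xpredT Phi) e4.
rewrite [leRHS](@big_cat_nat _ _ _ N) ?leq_addr //= (@big_cat_nat _ _ _ (N + 2 * N) N) /=; try lia.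
rewrite [X in _ + (X + _)](_ : _ = 0) ?add0r; last first.
  rewrite big_nat_cond big1 // => z /andP[/andP[z1 z2] _]; rewrite /Psi ltnNge z1 /=.
  by have -> : (3 * N <= z)%N = false by lia.
rewrite [leLHS](@big_cat_nat _ _ _ N) /=; try lia.
rewrite le_eqVlt; apply/orP; left; apply/eqP; congr (_ + _).
  by apply: eq_big_nat => z /andP[_ zN]; rewrite /Psi zN.
have -> : (N + (2 * N + N) = 2 * N + 2 * N)%N by lia.
rewrite [RHS]big_addn.
have -> : (2 * N + 2 * N - 2 * N = 2 * N)%N by lia.
apply: eq_big_nat => z /andP[z1 z2]; rewrite /Psi addnK.
have -> : (z + 2 * N < N)%N = false by lia.
by have -> : (3 * N <= z + 2 * N)%N by lia.
Qed.

Lemma up_quarter0 i w : (i < N)%N -> unitg w -> cell 2 w = 0%N ->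
  up f r i w = Mval (cell (r + 2) w) i.
Proof.
by move=> iN uw c; rewrite /up (unit_period_window (gf r2) iN uw) // c.
Qed.

Lemma up_quarter3 i w : (i < N)%N -> unitg w -> cell 2 w = 3 ->
  up f r i w = Mval (cell (r + 2) w - 2 * N)%N i.
Proof.
move=> iN uw c; rewrite /up (unit_period_window (gf r2) iN uw) ?c //.
have [w0 _ _] := uw; have h : (3 * N <= cell (r + 2) w)%N.
  have : cell 2 w = (cell (r + 2) w %/ N)%N by exact: cellD (ltW w0).
  by rewrite c => e; rewrite -leq_divRL ?N_gt0 // -e.
rewrite /Mval -[RHS](menshov_value_periodic r _ 1) mul1r.
have e2 : (2 ^+ r : int) = N%:Z by rewrite -natrX natz.
congr menshov_value; rewrite e2; lia.
Qed.

(** By orthogonality the square of the sum of the rescaled f_r^i has average N/4 over a period, and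
    the outer quarters, with cells of measure 1/(4N), contribute at most that. *)
Lemma Mval_total : \sum_(t < 2 * N) (\sum_(i < N) Mval t i) ^+ 2 <= N%:R ^+ 2 :> R.
Proof.
have N0 : 0 < N%:R :> R by rewrite ltr0n N_gt0.
have := @quarters_av (r + 3) (fun w => (\sum_(i < N) up f r i w) ^+ 2)
  (fun t => (\sum_(i < N) Mval t i) ^+ 2).
have -> : av (r + 3) (fun w => (\sum_(i < N) up f r i w) ^+ 2) = N%:R / 4.
  under eq_av => w _ do rewrite expr2 mulr_suml.
  rewrite av_sum (eq_bigr (fun=> 4^-1)); first by rewrite sumr_const card_ord -(mulr_natl 4^-1).
  move=> i _; under eq_av => w _ do rewrite mulr_sumr.
  rewrite av_sum (bigD1 i) //= (av_unit_periodM (gf r2) (mf r2)) // eqxx mul1r.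
  rewrite big1 ?addr0 // => j ji; rewrite (av_unit_periodM (gf r2) (mf r2)) //.
  have -> : (nat_of_ord i == j) = false by rewrite eq_sym; exact: negbTE ji.
  by rewrite mul0r.
move=> h; have {}h := h (leq_add (leqnn _) (isT : 2 <= 3)%N) (fun w _ => sqr_ge0 _).
have : (4 * N%:R)^-1 * \sum_(t < 2 * N) (\sum_(i < N) Mval t i) ^+ 2 <= N%:R / 4 :> R.
  apply: h => w uw c; congr (_ ^+ 2); apply: eq_bigr => i _.
    exact: up_quarter0.
  exact: up_quarter3.
rewrite ler_pdivrMl ?mulr_gt0 // => /le_trans; apply.
by rewrite le_eqVlt; apply/orP; left; apply/eqP; field.
Qed.

(** Coefficients are numbered from 1 and functions from 0, hence the shift. The last coefficient, of
    index N + 1, never enters: its matrix column is constant and singles out no function. *)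
Definition block_oscillation (F : nat -> R -> R) (b : nat -> R) (c : R) (y : R) : Prop :=
  exists J1 J2, [/\ (J1 <= J2)%N, (J2 <= N)%N & c <= `|\sum_(J1 <= i < J2)
    b i.+1 * (F i y - delta R N * \sum_(i' < N) F i' y)|].

Lemma delta_bounds : 0 <= delta R N /\ delta R N * N%:R <= 2.
Proof.
have N0 : 0 < N%:R :> R by rewrite ltr0n N_gt0.
have s0 : 0 <= (Num.sqrt N.+1%:R)^-1 :> R by rewrite invr_ge0 sqrtr_ge0.
have s1 : (Num.sqrt N.+1%:R)^-1 <= 1 :> R.
  rewrite invf_le1 ?sqrtr_gt0 ?ltr0n // -[leLHS](@sqrtr1 R) ler_wsqrtr //.
  by rewrite (ler_nat R 1).
split; first by rewrite /delta mulr_ge0 ?invr_ge0 ?ler0n //; lra.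
rewrite /delta mulrAC mulVf ?mul1r; [lra | by rewrite gt_eqF].
Qed.

Lemma up_oscillation L (b : nat -> R) (beta theta : R) :
  (r + 3 <= L)%N -> 0 < beta -> \sum_(i < N) b i.+1 ^+ 2 <= beta ^+ 2 ->
  0 < theta -> theta / 2 * 2 ^+ n * beta <= `|\sum_(i < N) b i.+1| ->
  96 <= theta * n%:R ->
  (theta / 128) ^+ 2 <= av L (fun w =>
    (`[< block_oscillation (up f r) b (theta / 128 * harmonic_sum (N - 1) * beta) w >])%:R).
Proof.
move=> rL b0 bb t0 bs t96; have [d0 d2] := delta_bounds.
have Hn : n%:R <= harmonic_sum (N - 1) :> R.
  by apply: le_trans (harmonic_sum_pow2 _); rewrite natrM; lra.
have H96 : 96 <= theta * harmonic_sum (N - 1).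
  by apply: le_trans t96 _; rewrite ler_pM2l.
have H3 : 3 <= harmonic_sum (N - 1) :> R by apply: le_trans Hn; rewrite (ler_nat R 3).
have N0 : 0 < N%:R :> R by rewrite ltr0n N_gt0.
have := @oscillation_frequent R n Mval (fun i => b i.+1) beta theta (delta R N)
  (fun t i _ _ => @Mval_window t i) Mval_total d0 d2 b0 bb t0 bs H96 H3.
set c := theta / 128 * _ * _; pose V t := oscillation n Mval (fun i => b i.+1) (delta R N) t.
rewrite -/(V _) => freq.
have := @quarters_av L (fun w => (`[< block_oscillation (up f r) b c w >])%:R)
  (fun t => (`[< block_oscillation (fun i _ => Mval t i) b c 0 >])%:R).
have dom : N%:R * (theta / 64) ^+ 2 <=
    \sum_(t < 2 * N) (`[< block_oscillation (fun i _ => Mval t i) b c 0 >])%:R :> R.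
  apply: le_trans freq _; apply: ler_sum => t _; rewrite ler_nat.
  case: (leP c `|V t|) => //= h; rewrite lt0b; apply/asboolP.
  have [J1 [J2 [j1 j2 e]]] : exists J1 J2, [/\ (J1 <= J2)%N, (J2 <= N)%N &
      V t = \sum_(J1 <= i < J2) b i.+1 * (Mval t i - delta R N * \sum_(i' < N) Mval t i')].
    exact: (@oscillation_interval R n Mval (fun i => b i.+1) (delta R N) t).
  by exists J1, J2; split=> //; rewrite -e.
(* At least N (theta / 64)^2 cells, each of measure 1/(4N), amount to (theta / 128)^2. *)
move=> h; apply: (@le_trans _ _ ((4 * N%:R)^-1 *
    \sum_(t < 2 * N) (`[< block_oscillation (fun i _ => Mval t i) b c 0 >])%:R)).
  apply: le_trans (ler_wpM2l _ dom); last by rewrite invr_ge0 mulr_ge0 ?ler0n.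
  by rewrite le_eqVlt; apply/orP; left; apply/eqP; field; rewrite gt_eqF.
have eqosc t w : (forall i, (i < N)%N -> up f r i w = Mval t i) ->
    block_oscillation (up f r) b c w = block_oscillation (fun i _ => Mval t i) b c 0.
  move=> e; apply/propext; split=> -[J1 [J2 [j1 j2 hc]]]; exists J1, J2; split=> //;
  apply: le_trans hc _; rewrite le_eqVlt; apply/orP; left; apply/eqP; congr `|_|;
  apply: eq_big_nat => i /andP[_ iJ]; rewrite e ?(leq_trans iJ) //;
  congr (_ * (_ - _ * _)); apply: eq_bigr => i' _; by rewrite e.
apply: h => //.
- by apply: leq_trans rL; rewrite leq_add2l.
- by move=> w uw c0; rewrite (eqosc (cell (r + 2) w)) // => i iN; exact: up_quarter0.
- by move=> w uw c3; rewrite (eqosc (cell (r + 2) w - 2 * N)%N) // => i iN; exact: up_quarter3.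
Qed.

Lemma sqrt_block_size_ge : 2 ^+ n <= Num.sqrt (N + 1)%:R :> R.
Proof.
rewrite -sqrt_pow2_even ler_wsqrtr // -natrX ler_nat; exact: leq_addr.
Qed.

Lemma transform1 (b : nat -> R) :
  transform (N + 1) b 1 = (Num.sqrt (N + 1)%:R)^-1 * (\sum_(i < N) b i.+1 + b N.+1).
Proof.
rewrite /transform (eq_bigr (fun j => (Num.sqrt (N + 1)%:R)^-1 * b j)) //.
rewrite -mulr_sumr addn1; congr (_ * _).
by rewrite big_nat_recr //= big_add1 big_mkord.
Qed.

(** The first coordinate times the square root of N + 1 is the sum of all entries. The last entry is
    at most beta, hence at most 1/96 of theta 2^n beta, so leaving it out costs less than half. *)
Lemma sum_large (b : nat -> R) (beta theta : R) : 0 < beta ->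
  `|b N.+1| <= beta -> 0 < theta -> 96 <= theta * n%:R ->
  theta * beta <= `|transform (N + 1) b 1| ->
  theta / 2 * 2 ^+ n * beta <= `|\sum_(i < N) b i.+1|.
Proof.
move=> b0 bN t0 t96; rewrite transform1 normrM => h.
have q0 : 0 < Num.sqrt (N + 1)%:R :> R by rewrite sqrtr_gt0 ltr0n addn1.
have es : `|(Num.sqrt (N + 1)%:R)^-1| = (Num.sqrt (N + 1)%:R)^-1 :> R.
  by rewrite ger0_norm // invr_ge0 ltW.
rewrite es ler_pdivlMl // in h.
have h2 := ler_normD (\sum_(i < N) b i.+1) (b N.+1).
have h3 : n%:R <= 2 ^+ n :> R by rewrite -natrX ler_nat ltnW // ltn_expl.
have h4 : theta * n%:R <= theta * 2 ^+ n by rewrite ler_pM2l.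
have h5 : theta * beta * 2 ^+ n <= theta * beta * Num.sqrt (N + 1)%:R.
  by rewrite ler_pM2l ?mulr_gt0 //; exact: sqrt_block_size_ge.
have h6 : 96 * beta <= theta * 2 ^+ n * beta by rewrite ler_pM2r //; lra.
have e : theta / 2 * 2 ^+ n * beta = theta * 2 ^+ n * beta / 2 by field.
have e2 : theta * beta * 2 ^+ n = theta * 2 ^+ n * beta by ring.
by rewrite e; lra.
Qed.

(** The least l >= 2 with 2^l beta^2 >= 1. If l > 2, minimality gives 2^-l > beta^2 / 2; the factor
    1/4 in the bound is what l = 2 requires. *)
Lemma scale_choice (beta : R) : 0 < beta -> 1 <= 2 ^+ T * beta ^+ 2 ->
  exists l, [/\ (2 <= l <= T)%N, 1 <= 2 ^+ l * beta ^+ 2 &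
    Num.min 1 (beta ^+ 2) / 4 <= 2 ^- l].
Proof.
move=> b0 hT; have T2 : (2 <= T)%N.
  by rewrite (leq_trans (isT : 2 <= 2 * 1)%N) // leq_mul2l expn_gt0; lia.
have ex : exists l, (2 <= l)%N && (1 <= 2 ^+ l * beta ^+ 2) by exists T; rewrite T2.
case: (ex_minnP ex) => l /andP[l2 hl] lmin; exists l; split=> //.
  by rewrite l2 lmin // T2.
have b2 : 0 < beta ^+ 2 by rewrite exprn_gt0.
have [e|lt] : l = 2 \/ (2 < l)%N by lia.
  rewrite e ler_pdivrMr // (_ : 2 ^- 2 * 4 = 1) ?ge_min ?lexx //.
  by rewrite expr2; field.
have : ~~ (1 <= 2 ^+ l.-1 * beta ^+ 2).
  apply/negP => h; have := lmin l.-1; rewrite h andbT; lia.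
rewrite -ltNge => h; apply: (@le_trans _ _ (beta ^+ 2 / 4)).
  by rewrite ler_pM2r ?invr_gt0 // ge_min lexx orbT.
have p0 : 0 < 2 ^+ l.-1 :> R by rewrite exprn_gt0.
have -> : 2 ^- l = (2 * 2 ^+ l.-1)^-1 :> R by rewrite -exprS prednK // ltnW.
rewrite ler_pdivrMr // invfM.
have -> : 2^-1 * (2 ^+ l.-1)^-1 * 4 = 2 / 2 ^+ l.-1 :> R by field; rewrite gt_eqF.
by rewrite ler_pdivlMr // mulrC; lra.
Qed.

Lemma pattern_level_ge l L : (l <= T)%N -> (pattern_level k n <= L)%N ->
  (l <= L)%N /\ (r + 3 <= L - l)%N.
Proof. by rewrite /pattern_level; lia. Qed.

(** On the piece of scale l the oscillation of [up] is multiplied by n^-1 2^(l/2). Since H >= n,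
    2^(l/2) >= 1 and 2^(l/2) beta >= 1, the product exceeds both theta / 128 and theta beta / 128.
    The second bound is there to beat the xi_n term, which is only known to be at most beta
    |xi_n|. *)
Lemma menshov_block L (b : nat -> R) (beta theta : R) :
  (pattern_level k n <= L)%N -> 0 < beta -> \sum_(1 <= j < (N + 1).+1) b j ^+ 2 = beta ^+ 2 ->
  0 < theta -> 96 <= theta * n%:R -> theta * beta <= `|transform (N + 1) b 1| ->
  1 <= 2 ^+ T * beta ^+ 2 ->
  (theta / 128) ^+ 2 * (Num.min 1 (beta ^+ 2) / 4) <=
  av L (fun y => (`[< block_oscillation (pattern f k n) b (theta / 128 * Num.max 1 beta) y >])%:R).
Proof.
move=> lL b0 bE t0 t96 tb hT.
have bsplit : \sum_(i < N) b i.+1 ^+ 2 + b N.+1 ^+ 2 = beta ^+ 2.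
  by rewrite -bE addn1 big_nat_recr //= big_add1 big_mkord.
have bb : \sum_(i < N) b i.+1 ^+ 2 <= beta ^+ 2 by rewrite -bsplit lerDl sqr_ge0.
have bN : `|b N.+1| <= beta.
  rewrite -(ler_pXn2r (ltn0Sn 1)) ?nnegrE ?normr_ge0 ?(ltW b0) // real_normK ?num_real //.
  by rewrite -bsplit lerDr sumr_ge0 // => i _; exact: sqr_ge0.
have bs := sum_large b0 bN t0 t96 tb.
have [l [/andP[l2 lT] hl lmin]] := scale_choice b0 hT.
have [lLe rL] := pattern_level_ge lT lL.
have := up_oscillation rL b0 bb t0 bs t96.
set c := theta / 128 * _ * _; set G := fun w => _.
have : 0 <= (theta / 128) ^+ 2 by exact: sqr_ge0.
move: ((theta / 128) ^+ 2) => q q0 hG.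
have pG : periodic1 G.
  move=> w z; rewrite /G; congr (nat_of_bool _)%:R; congr (`[< _ >]).
  apply: eq_exists => J1; apply: eq_exists => J2; apply/propext.
  split=> -[j1 j2 h]; split=> //; apply: le_trans h _; rewrite le_eqVlt; apply/orP; left; apply/eqP;
  by congr `|_|; apply: eq_big_nat => i _; rewrite /up unit_period_periodic;
    congr (_ * (_ - _ * _)); apply: eq_bigr => i' _; rewrite unit_period_periodic.
have two_l : (1 < 2 ^ l)%N by rewrite -{1}(expn0 2) ltn_exp2l // ltnW.
have := @av_cell_scale _ S l L 1 (fun y => G (2 ^+ l * y)) G two_l lLe pG (fun _ _ _ => erefl).
move=> eG; apply: (@le_trans _ _ (2 ^- l * av (L - l) G)).
  apply: (@le_trans _ _ (2 ^- l * q)).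
    by rewrite mulrC; apply: ler_wpM2r.
  by apply: ler_wpM2l hG; rewrite invr_ge0 exprn_ge0.
rewrite -eG; apply: av_le => y uy; rewrite /cell_ind; case: eqP => [c1|]; last first.
  by rewrite mul0r ler0n.
rewrite mul1r /G ler_nat; case: asboolP => //= -[J1 [J2 [j1 j2 hJ]]].
rewrite lt0b; apply/asboolP; exists J1, J2; split=> //.
pose A : R := n%:R^-1 * Num.sqrt (2 ^+ l).
have pA i : pattern f k n i y = A * up f r i (2 ^+ l * y).
  by rewrite (@pattern_mid _ S f k n n2 i y l) // l2.
have -> : \sum_(J1 <= i < J2) b i.+1 *
      (pattern f k n i y - delta R N * \sum_(i' < N) pattern f k n i' y)
    = A * \sum_(J1 <= i < J2) b i.+1 * (up f r i (2 ^+ l * y) -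
        delta R N * \sum_(i' < N) up f r i' (2 ^+ l * y)).
  rewrite mulr_sumr; apply: eq_bigr => i _.
  rewrite (eq_bigr (fun i' : 'I_N => A * up f r i' (2 ^+ l * y))) // pA -mulr_sumr; ring.
have n0 : 0 < n%:R :> R by rewrite ltr0n ltnW // ltnW.
have A0 : 0 <= A by rewrite mulr_ge0 ?invr_ge0 ?sqrtr_ge0 // ltW.
rewrite normrM ger0_norm //; apply: le_trans (ler_wpM2l A0 hJ).
have Hn : n%:R <= harmonic_sum (N - 1) :> R.
  by apply: le_trans (harmonic_sum_pow2 _); rewrite natrM; lra.
have -> : A * c = theta / 128 * (Num.sqrt (2 ^+ l) * beta * (n%:R^-1 * harmonic_sum (N - 1))).
  by rewrite /A /c; ring.
rewrite ler_pM2l ?divr_gt0 //.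
have q1 : 1 <= n%:R^-1 * harmonic_sum (N - 1) :> R by rewrite ler_pdivlMl // mulr1.
have q2 : 1 <= Num.sqrt (2 ^+ l) :> R.
  by rewrite -[leLHS](@sqrtr1 R) ler_wsqrtr // exprn_ege1 // (ler_nat R 1).
have q3 : 1 <= Num.sqrt (2 ^+ l) * beta.
  rewrite -(ler_pXn2r (ltn0Sn 1)) ?nnegrE ?mulr_ge0 ?sqrtr_ge0 ?(ltW b0) //.
  by rewrite expr1n exprMn sqr_sqrtr ?exprn_ge0.
rewrite ge_max; apply/andP; split.
  by rewrite -[leLHS]mulr1 ler_pM.
rewrite -[leLHS]mulr1; apply: ler_pM => //; first exact: ltW.
by rewrite ler_peMl // ltW.
Qed.

End BlockOscillation.

(** * Null sets by way of step events *)

Section NullSets.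
Context {R : realType}.
Variable S : sampling R.
Local Notation unitg := (unitg S).
Local Notation stepf := (stepf S).
Local Notation av := (av S).
Local Notation mu := (@lebesgue_measure R).

Definition indicator (B : R -> Prop) (x : R) : R := (`[< B x >])%:R.

Lemma stepf_indicator L (B : R -> Prop) : stepf L B -> stepf L (indicator B).
Proof. by move=> sB x y ux uy e; rewrite /indicator (sB x y). Qed.

Lemma measure_step_le L (B : R -> Prop) : stepf L B ->
  exists D : set R, [/\ measurable D, (mu D <= (av L (indicator B))%:E)%E &
    forall x, unitg x -> B x -> D x].
Proof.
move=> sB; pose I (z : nat) : set R :=
  if `[< B (pt S L z) >] then `]z%:R / 2 ^+ L, z.+1%:R / 2 ^+ L[%classic else set0.
have mI z : measurable (I z).
  by rewrite /I; case: ifP => _; [exact: measurable_itv | exact: measurable0].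
exists (\big[setU/set0]_(z < 2 ^ L) I z); split.
- by apply: bigsetU_measurable => z _; exact: mI.
- apply: le_trans (Boole_inequality mu (fun z _ => mI z)) _.
  rewrite /av mulr_sumr -sumEFin; apply: lee_sum => z _.
  rewrite /I /indicator; case: ifP => _; last by rewrite measure0 mulr0.
  have := @lebesgue_measure_itv R `]z%:R / 2 ^+ L, z.+1%:R / 2 ^+ L[.
  rewrite /= lte_fin ltr_pM2r ?invr_gt0 ?exprn_gt0 // ltr_nat leqnn => e.
  apply: (@le_trans _ _ (z.+1%:R / 2 ^+ L - z%:R / 2 ^+ L)%:E); first by rewrite e.
  by rewrite lee_fin -mulrBl -natrB // subSnn mul1r mulr1.
move=> x ux Bx; have [x0 x1 _] := ux.
have cL : (cell L x < 2 ^ L)%N by apply: cell_lt; rewrite x1 ltW.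
rewrite -bigcup_mkord; exists (cell L x) => //.
rewrite /I asboolT; last by rewrite -(stepf_pt sB ux).
by rewrite /= in_itv /=; apply/(cell_eqP _ _ ux).
Qed.

Lemma negligible_nongeneric : mu.-negligible [set x | 0 <= x <= 1 /\ ~ unitg x].
Proof.
have c : countable [set x | ~ generic (exceptional S) x].
  exact: countable_nongeneric (@exceptional_countable R S).
have nN : mu.-negligible [set x | ~ generic (exceptional S) x].
  exists [set x | ~ generic (exceptional S) x]; split=> //; first exact: measurable_countable.
  exact: countable_lebesgue_measure0.
apply: negligibleS nN => x [/andP[x0 x1] nu] /= gx; apply: nu.
have rn n : x != n%:R.
  exact: (generic_irrational (exceptional0 S) gx (rational_nat n)).
by split=> //; [rewrite lt_neqAle eq_sym (rn 0%N) x0 | rewrite lt_neqAle (rn 1%N) x1].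
Qed.

(** No measurability of A is asked for: its generic points lie in an intersection of finite unions
    of cells of arbitrarily small total length. *)
Lemma negligible_step (A : set R) :
  (forall e : R, 0 < e -> exists L (B : R -> Prop), [/\ stepf L B,
     forall x, unitg x -> A x -> B x & av L (indicator B) <= e]) ->
  mu.-negligible (A `&` [set x | 0 <= x <= 1]).
Proof.
move=> hA.
have : forall j : nat, exists D : set R, [/\ measurable D, (mu D <= (j.+1%:R^-1)%:E)%E &
    forall x, unitg x -> A x -> D x].
  move=> j; have [|L [B [sB AB le]]] := hA j.+1%:R^-1; first by rewrite invr_gt0 ltr0n.
  have [D [mD muD BD]] := measure_step_le sB.
  exists D; split=> //; last by move=> x ux /(AB x ux)/(BD x ux).
  by apply: le_trans muD _; rewrite lee_fin.
move=> /choice[D hD].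
have nD : mu.-negligible (\bigcap_j D j).
  have mD : measurable (\bigcap_j D j).
    by apply: bigcap_measurable => [|j _]; [exists 0%N | have [] := hD j].
  exists (\bigcap_j D j); split=> //.
  apply/eqP; rewrite eq_le measure_ge0 andbT; apply/lee_addgt0Pr => e e0; rewrite add0e.
  have [j hj] : exists j : nat, j.+1%:R^-1 <= e.
    exists (Num.bound e^-1); rewrite invf_ple ?posrE ?ltr0n //; apply: ltW.
    apply: lt_le_trans (archi_boundP _) _; first by rewrite invr_ge0 ltW.
    by rewrite ler_nat.
  apply: (@le_trans _ _ (mu (D j))).
    by apply: le_measure; rewrite ?inE //; [have [] := hD j | exact: bigcap_inf].
  have [_ h _] := hD j; apply: le_trans h _; by rewrite lee_fin.
apply: negligibleS (negligibleU negligible_nongeneric nD).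
move=> x [Ax /= x01]; case: (pselect (unitg x)) => [ux|nu]; [right|left] => //.
by move=> j _; have [_ _ h] := hD j; exact: h.
Qed.

End NullSets.

(** * Avoiding independent events *)

Section Independence.
Context {R : realType}.
Variable S : sampling R.
Local Notation stepf := (stepf S).
Local Notation av := (av S).
Variables (K k lev : nat -> nat) (M : nat) (Ev : nat -> R -> Prop) (v : nat -> R).
Hypothesis kK : forall n, (M <= n)%N -> (k n <= K n.+1)%N.
Hypothesis Kk : forall n, (M <= n)%N -> (K n <= k n)%N.
Hypothesis pEv : forall n, (M <= n)%N -> periodic1 (Ev n).
Hypothesis sEv : forall n, (M <= n)%N -> stepf (k n) (fun x => Ev n (2 ^+ K n * x)).
Hypothesis v0 : forall n, (M <= n)%N -> 0 <= v n.
Hypothesis vEv : forall n L, (M <= n)%N -> (lev n <= L)%N -> v n <= av L (indicator (Ev n)).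

Definition avoid (q : nat) (x : R) : Prop :=
  forall n, (M <= n < M + q)%N -> ~ Ev n (2 ^+ K n * x).

Lemma avoidS q x : avoid q.+1 x <-> avoid q x /\ ~ Ev (M + q) (2 ^+ K (M + q) * x).
Proof.
split=> [h|[h1 h2] n].
  split=> [n /andP[n1 n2]|]; last by apply: h; rewrite leq_addr addnS ltnS leqnn.
  by apply: h; rewrite n1 addnS ltnW.
move=> /andP[n1]; rewrite addnS ltnS leq_eqVlt => /predU1P[->|n2] //.
by apply: h1; rewrite n1.
Qed.

Lemma K_mono n n' : (M <= n)%N -> (n <= n')%N -> (K n <= K n')%N.
Proof.
move=> Mn; elim: n' => [|n' IH]; first by rewrite leqn0 => /eqP->.
rewrite leq_eqVlt => /predU1P[<-//|]; rewrite ltnS => h.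
by apply: leq_trans (IH h) _; apply: leq_trans (Kk _) (kK _); exact: leq_trans h.
Qed.

Lemma stepf_avoid q : stepf (K (M + q)) (avoid q).
Proof.
move=> x y ux uy e; apply/propext.
have main n : (M <= n < M + q)%N -> Ev n (2 ^+ K n * x) = Ev n (2 ^+ K n * y).
  move=> /andP[n1 n2]; apply: (stepf_le (L := k n) _ (sEv n1)) e => //.
  by apply: leq_trans (kK n1) _; apply: K_mono => //; exact: leqW.
by split=> h n hn; [rewrite -main | rewrite main] => //; exact: h.
Qed.

(** A quantitative second Borel-Cantelli lemma. The earlier events are step functions of level K (M
    + q) and the next event is periodic at that scale, so the probabilities multiply; (1 - w) / (1 +
    s) <= 1 / (1 + s + w) carries the induction. *)
Lemma avoid_prob q L : (forall n, (M <= n < M + q)%N -> (K n + lev n <= L)%N) ->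
  av L (indicator (avoid q)) <= (1 + \sum_(M <= n < M + q) v n)^-1.
Proof.
elim: q => [|q IH] hL.
  rewrite addn0 big_geq // addr0 invr1 -[leRHS](@av_cst _ S L 1); apply: av_le => x _.
  by rewrite /indicator; case: asboolP.
have Mq : (M <= M + q)%N by exact: leq_addr.
have := hL (M + q)%N; rewrite Mq addnS ltnS leqnn => /(_ isT) hq.
have {}IH : av L (indicator (avoid q)) <= (1 + \sum_(M <= n < M + q) v n)^-1.
  by apply: IH => n /andP[n1 n2]; apply: hL; rewrite n1 addnS ltnW.
pose G y : R := 1 - indicator (Ev (M + q)) y.
have pG : periodic1 G by move=> y z; rewrite /G /indicator pEv.
have -> : av L (indicator (avoid q.+1)) =
    av L (fun x => indicator (avoid q) x * G (2 ^+ K (M + q) * x)).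
  apply: eq_av => x _; rewrite /G /indicator.
  case: asboolP => [/avoidS[h1 h2]|h]; first by rewrite asboolT // asboolF // subr0 mulr1.
  case: asboolP => h1; rewrite ?mul0r // asboolT ?subrr ?mulr0 //.
  by apply: contrapT => h2; apply: h; apply/avoidS.
have KL : (K (M + q) <= L)%N by apply: leq_trans hq; exact: leq_addr.
rewrite (av_indep KL (stepf_indicator (@stepf_avoid q)) pG).
have levL : (lev (M + q) <= L - K (M + q))%N by rewrite leq_subRL.
have := vEv Mq levL => hv.
have -> : av (L - K (M + q)) G = 1 - av (L - K (M + q)) (indicator (Ev (M + q))).
  by rewrite avB av_cst.
rewrite big_nat_recr //=; set s := \sum_(_ <= _ < _) _ in IH *.
have s0 : 0 <= s.
  by rewrite /s big_nat_cond sumr_ge0 // => n /andP[/andP[n1 _] _]; exact: v0.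
have w0 := v0 Mq; have a0 : 0 <= av L (indicator (avoid q)).
  by apply: av_ge0 => x _; rewrite /indicator ler0n.
have p1 : av (L - K (M + q)) (indicator (Ev (M + q))) <= 1.
  rewrite -[leRHS](@av_cst _ S (L - K (M + q)) 1); apply: av_le => x _.
  by rewrite /indicator; case: asboolP.
move: (av (L - _) _) hv p1 => P hv p1; move: (av L _) IH a0 => A IH a0.
move: (v (M + q)) hv w0 => w hv w0.
apply: (@le_trans _ _ ((1 + s)^-1 * (1 - w))).
  by apply: ler_pM => //; lra.
rewrite ler_pdivrMl ?ltr_wpDr //; have s1 : 0 < 1 + (s + w) by lra.
rewrite ler_pdivlMr //; nra.
Qed.

End Independence.

(** * Divergence when blocks with a large mean abound *)

Section LargeMean.
Context {R : realType}.
Variable S : sampling R.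
Local Notation unitg := (unitg S).
Local Notation stepf := (stepf S).
Local Notation av := (av S).
Variables (f : nat -> nat -> R -> R) (k : nat -> nat) (xi Ups : nat -> R -> R).
Hypothesis gf : forall r, (2 <= r)%N -> generic_menshov S r (f r).
Hypothesis mf : forall r, (2 <= r)%N -> menshov_system r (f r).
Hypothesis gS : forall n i, (1 <= n)%N -> (i < 2 ^ (2 * n))%N -> stepf (k n) (g f k n i).
Hypothesis xi0 : forall x (e : R), unitg x -> 0 < e ->
  exists L0, forall l, (L0 <= l)%N -> `|xi l x| <= e.
Hypothesis Ups_def : forall n j : nat, (1 <= n)%N ->
  (1 <= j <= 2 ^ (2 * n) + 1)%N -> Ups (mu n.-1 + j)%N = upsilon f k xi n j.
Variable a : nat -> R.

Definition block_coef (n j : nat) : R := a (mu n.-1 + j)%N.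

Definition block_norm (n : nat) : R :=
  Num.sqrt (\sum_(1 <= j < (block_size n).+1) block_coef n j ^+ 2).

Lemma block_norm_sq n : \sum_(1 <= j < (block_size n).+1) block_coef n j ^+ 2 = block_norm n ^+ 2.
Proof. by rewrite sqr_sqrtr // sumr_ge0 // => j _; exact: sqr_ge0. Qed.

Variable theta : R.
Hypothesis theta0 : 0 < theta.

(** The conditions under which [menshov_block] applies: 96 <= theta n ensures 96 <= theta H, and the
    last clause makes some scale l <= 2n^2 available. *)
Definition good_block (n : nat) : Prop :=
  [/\ (3 <= n)%N, 96 <= theta * n%:R, 0 < block_norm n,
      theta * block_norm n <= `|transform (block_size n) (block_coef n) 1| &
      1 <= 2 ^+ (2 * n ^ 2) * block_norm n ^+ 2].

Definition block_weight (n : nat) : R :=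
  if `[< good_block n >] then (theta / 128) ^+ 2 * (Num.min 1 (block_norm n ^+ 2) / 4) else 0.

Definition block_event (n : nat) (y : R) : Prop :=
  good_block n /\ block_oscillation n (pattern f k n) (block_coef n)
    (theta / 128 * Num.max 1 (block_norm n)) y.

Lemma block_weight_ge0 n : 0 <= block_weight n.
Proof.
rewrite /block_weight; case: ifP => // _; apply: mulr_ge0; first exact: sqr_ge0.
by apply: divr_ge0 => //; rewrite le_min ler01 sqr_ge0.
Qed.

Lemma block_event_periodic n : periodic1 (block_event n).
Proof.
move=> y z; congr (_ /\ _); apply: eq_exists => J1; apply: eq_exists => J2; apply/propext.
have e i : pattern f k n i (z%:R + y) = pattern f k n i y by exact: pattern_periodic.
rewrite (eq_bigr (fun i => block_coef n i.+1 * (pattern f k n i y -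
    delta R (2 ^ (2 * n)) * \sum_(i' < 2 ^ (2 * n)) pattern f k n i' y))) // => i _.
by rewrite e; congr (_ * (_ - _ * _)); apply: eq_bigr => i' _; rewrite e.
Qed.

Lemma block_event_step n : (2 <= n)%N ->
  stepf (k n) (fun x => block_event n (2 ^+ gshift k n * x)).
Proof.
move=> n2 x y ux uy exy; congr (_ /\ _).
have e i : (i < 2 ^ (2 * n))%N -> pattern f k n i (2 ^+ gshift k n * x) =
    pattern f k n i (2 ^+ gshift k n * y).
  by move=> iN; rewrite -!g_pattern //; exact: gS (ltnW n2) iN _ _ ux uy exy.
apply: eq_exists => J1; apply: eq_exists => J2; apply/propext.
have E : (J2 <= 2 ^ (2 * n))%N -> forall i, (J1 <= i < J2)%N ->
    block_coef n i.+1 * (pattern f k n i (2 ^+ gshift k n * x) -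
      delta R (2 ^ (2 * n)) * \sum_(i' < 2 ^ (2 * n)) pattern f k n i' (2 ^+ gshift k n * x)) =
    block_coef n i.+1 * (pattern f k n i (2 ^+ gshift k n * y) -
      delta R (2 ^ (2 * n)) * \sum_(i' < 2 ^ (2 * n)) pattern f k n i' (2 ^+ gshift k n * y)).
  move=> JN i /andP[_ iJ]; rewrite e ?(leq_trans iJ) //.
  by congr (_ * (_ - _ * _)); apply: eq_bigr => i' _; rewrite e.
by split=> -[j1 j2 h]; split=> //; move: h; rewrite (eq_big_nat _ _ (E j2)).
Qed.

Lemma block_event_prob n L : (pattern_level k n <= L)%N ->
  block_weight n <= av L (indicator (block_event n)).
Proof.
move=> lL; rewrite /block_weight; case: asboolP => h; last first.
  by apply: av_ge0 => x _; rewrite /indicator ler0n.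
have [n3 t96 b0 tb hT] := h.
have := menshov_block gf mf n3 lL b0 (block_norm_sq n) theta0 t96 tb hT.
move=> /le_trans; apply; apply: av_le => y _; rewrite /indicator ler_nat.
by case: asboolP => //= ho; rewrite lt0b; apply/asboolP.
Qed.

(* Below their first entry, the columns of the orthogonal matrix other than the last
   are perturbed unit vectors, which isolates g_n^i. *)
Lemma upsilon_small n i x : (1 <= n)%N -> (i < 2 ^ (2 * n))%N ->
  Ups (mu n.-1 + i.+1)%N x = (Num.sqrt (2 ^ (2 * n) + 1)%:R)^-1 * xi n x +
    (g f k n i x - delta R (2 ^ (2 * n)) * \sum_(i' < 2 ^ (2 * n)) g f k n i' x).
Proof.
move=> n1 iN; rewrite Ups_def //; last by lia.
rewrite /upsilon /kappa /=; congr (_ + _).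
rewrite addn1 big_add1 /= big_add1 /= big_mkord.
transitivity (\sum_(i' < 2 ^ (2 * n)) ((i == i' :> nat)%:R * g f k n i' x -
    delta R (2 ^ (2 * n)) * g f k n i' x)).
  apply: eq_bigr => i' _; rewrite eqSS (ltn_eqF iN) eqSS subSS subn1 /=.
  by case: eqP => _ /=; ring.
rewrite sumrB -mulr_sumr; congr (_ - _).
rewrite (bigD1 (Ordinal iN)) //= eqxx mul1r big1 ?addr0 // => i' hi'.
case: eqP => [e|]; last by rewrite mul0r.
by case/eqP: hi'; apply/val_inj.
Qed.

(** The xi_n part of a sub-block has coefficient (N + 1)^(-1/2) times a sum of at most N + 1
    entries, which Cauchy-Schwarz bounds by the norm of the block. *)
Lemma upsilon_oscillation n x J1 J2 : (2 <= n)%N -> (J1 <= J2)%N -> (J2 <= 2 ^ (2 * n))%N ->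
  `|\sum_(J1 <= i < J2) block_coef n i.+1 * (pattern f k n i (2 ^+ gshift k n * x) -
      delta R (2 ^ (2 * n)) * \sum_(i' < 2 ^ (2 * n)) pattern f k n i' (2 ^+ gshift k n * x))|
  - block_norm n * `|xi n x| <=
  `|\sum_((mu n.-1 + J1).+1 <= l < (mu n.-1 + J2).+1) a l * Ups l x|.
Proof.
move=> n2 J12 J2N; set s : R := (Num.sqrt (2 ^ (2 * n) + 1)%:R)^-1.
set V := \sum_(J1 <= i < J2) _.
have -> : \sum_((mu n.-1 + J1).+1 <= l < (mu n.-1 + J2).+1) a l * Ups l x =
    V + (s * \sum_(J1 <= i < J2) block_coef n i.+1) * xi n x.
  have -> : (mu n.-1 + J1).+1 = (J1 + (mu n.-1).+1)%N by lia.
  rewrite big_addn; have -> : ((mu n.-1 + J2).+1 - (mu n.-1).+1 = J2)%N by lia.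
  have -> : (s * \sum_(J1 <= i < J2) block_coef n i.+1) * xi n x =
      \sum_(J1 <= i < J2) s * block_coef n i.+1 * xi n x by rewrite mulr_sumr mulr_suml.
  rewrite /V -big_split /=; apply: eq_big_nat => i /andP[_ iJ].
  have -> : (i + (mu n.-1).+1 = mu n.-1 + i.+1)%N by lia.
  rewrite /block_coef upsilon_small ?(leq_trans iJ) //; last exact: ltnW.
  rewrite -!g_pattern // (eq_bigr (fun i' : 'I_(2 ^ (2 * n)) => g f k n i' x)); last first.
    by move=> i' _; rewrite -g_pattern.
  by rewrite -/s; ring.
have hb : `|s * \sum_(J1 <= i < J2) block_coef n i.+1| <= block_norm n.
  rewrite -(ler_pXn2r (ltn0Sn 1)) ?nnegrE ?normr_ge0 ?sqrtr_ge0 // real_normK ?num_real //.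
  have N0 : 0 < (2 ^ (2 * n) + 1)%:R :> R by rewrite ltr0n addn1.
  rewrite exprMn /s exprVn sqr_sqrtr ?ler0n // ler_pdivrMl //.
  have := @sum_cauchy_schwarz R nat (index_iota J1 J2) xpredT (fun=> 1)
    (fun i => block_coef n i.+1).
  under eq_bigr do rewrite mul1r; move=> h; apply: le_trans h _.
  apply: ler_pM.
  - by apply: sumr_ge0 => i _; exact: sqr_ge0.
  - by apply: sumr_ge0 => i _; exact: sqr_ge0.
  - under eq_bigr do rewrite expr1n; rewrite sumr_const_nat ler_nat.
    by apply: leq_trans (leq_subr _ _) _; apply: leq_trans J2N _; exact: leq_addr.
  - rewrite -block_norm_sq big_add1 /= [leRHS](@big_cat_nat _ _ _ J1) //=; last first.
      by apply: leq_trans J12 _; apply: leq_trans J2N _; exact: leq_addr.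
    rewrite [X in _ <= _ + X](@big_cat_nat _ _ _ J2) //=; last first.
      by apply: leq_trans J2N _; exact: leq_addr.
    rewrite addrCA lerDl addr_ge0 // sumr_ge0 // => i _; exact: sqr_ge0.
have h1 := ler_wpM2r (normr_ge0 (xi n x)) hb; rewrite -normrM in h1.
have := lerB_normD V ((s * \sum_(J1 <= i < J2) block_coef n i.+1) * xi n x); lra.
Qed.

Lemma cvg_oscillation (u : nat -> R) (e : R) : 0 < e -> cvgn u ->
  exists P : nat, forall p q : nat, (P <= p)%N -> (P <= q)%N -> `|u q - u p| < e.
Proof.
move=> e0 /cvg_ex[l ul].
have e2 : 0 < e / 2 by rewrite divr_gt0.
move/cvgrPdist_lt: ul => /(_ _ e2)[P _ hP].
exists P => p q Pp Pq; have h1 := hP p Pp; have h2 := hP q Pq.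
have -> : u q - u p = (l - u p) - (l - u q) by ring.
apply: le_lt_trans (ler_normB _ _) _; rewrite /= in h1 h2; lra.
Qed.

Lemma mu_ge n : (n <= mu n)%N.
Proof.
rewrite /mu; have : (\sum_(1 <= l < n.+1) 1 <= \sum_(1 <= l < n.+1) (2 ^ (2 * l) + 1))%N.
  by apply: leq_sum => l _; exact: leq_addl.
by rewrite sum_nat_const_nat subSS subn0 muln1.
Qed.

(** With eta = theta / 128, an event would give a sub-block sum of at least eta max(1, beta). At a
    point of convergence late sub-blocks of the series are below eta / 2 and |xi_n| <= eta / 2,
    leaving less than eta / 2 + beta eta / 2. *)
Lemma cvg_avoid x : unitg x ->
  cvgn (fun N : nat => \sum_(1 <= l < N.+1) a l * Ups l x) ->
  exists M, (2 <= M)%N /\ forall n, (M <= n)%N -> ~ block_event n (2 ^+ gshift k n * x).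
Proof.
move=> ux cx; pose eta := theta / 128.
have eta0 : 0 < eta by rewrite divr_gt0.
have e2 : 0 < eta / 2 by rewrite divr_gt0.
have [P hP] := cvg_oscillation e2 cx.
have [L0 hL0] := xi0 ux e2.
exists (P + L0 + 3)%N; split=> [|n hn]; first by lia.
move=> [[n3 _ b0 _ _] [J1 [J2 [J12 J2N h]]]].
have n2 : (2 <= n)%N by exact: leq_trans n3.
have := upsilon_oscillation x n2 J12 J2N.
set V := \sum_(J1 <= i < J2) _ in h *.
have xn : `|xi n x| <= eta / 2 by apply: hL0; lia.
have mP : (P <= mu n.-1)%N by apply: leq_trans (mu_ge _); lia.
have := hP (mu n.-1 + J1)%N (mu n.-1 + J2)%N
  (leq_trans mP (leq_addr _ _)) (leq_trans mP (leq_addr _ _)).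
rewrite [X in `|X - _|](@big_cat_nat _ _ _ (mu n.-1 + J1).+1) //=; last first.
  by rewrite ltnS leq_add2l.
rewrite addrAC subrr add0r => h1 h2.
have h3 := ler_wpM2l (ltW b0) xn.
have h4 : block_norm n <= Num.max 1 (block_norm n) by rewrite le_max lexx orbT.
have h5 : 1 <= Num.max 1 (block_norm n) by rewrite le_max lexx.
have h6 := ler_wpM2l (ltW e2) h4; have h7 := ler_wpM2l (ltW e2) h5.
have h8 : eta * Num.max 1 (block_norm n) <= `|V| by [].
have : `|V| <= eta / 2 + block_norm n * (eta / 2) by lra.
rewrite mulrC in h3; lra.
Qed.

Lemma large_mean_negligible :
  (forall M (C : R), exists q, C <= \sum_(M <= n < M + q) block_weight n) ->
  (@lebesgue_measure R).-negligible
    ([set x | cvgn (fun N : nat => \sum_(1 <= l < N.+1) a l * Ups l x)] `&` [set x | 0 <= x <= 1]).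
Proof.
move=> hv.
pose A M := [set x : R | forall n, (M + 2 <= n)%N -> ~ block_event n (2 ^+ gshift k n * x)].
have nA M : (@lebesgue_measure R).-negligible (A M `&` [set x | 0 <= x <= 1]).
  apply: (@negligible_step R S) => e e0.
  (* Weights of total at least 1/e bring the probability of avoiding all the events down to 1 / (1 +
     1/e) < e. *)
  have [q hq] := hv (M + 2)%N e^-1.
  pose L := (\sum_(M + 2 <= n < M + 2 + q) (gshift k n + pattern_level k n) +
    gshift k (M + 2 + q))%N.
  exists L, (avoid (gshift k) (M + 2) block_event q).
  have kK n : (M + 2 <= n)%N -> (k n <= gshift k n.+1)%N.
    by move=> hn; rewrite /gshift /= -!addnA leq_addr.
  have Kk n : (M + 2 <= n)%N -> (gshift k n <= k n)%N.
    by move=> hn; have := level_gap gS (leq_trans (leq_addl _ _) hn); lia.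
  have sE n : (M + 2 <= n)%N -> stepf (k n) (fun x => block_event n (2 ^+ gshift k n * x)).
    by move=> hn; apply: block_event_step; exact: leq_trans (leq_addl _ _) hn.
  split.
  - apply: stepf_le (stepf_avoid kK Kk sE (q := q)); exact: leq_addl.
  - by move=> x ux Ax n /andP[hn _]; exact: Ax.
  have w0 n (_ : (M + 2 <= n)%N) := block_weight_ge0 n.
  have wE n L' (_ : (M + 2 <= n)%N) (h : (pattern_level k n <= L')%N) := block_event_prob h.
  have hL n : (M + 2 <= n < M + 2 + q)%N -> (gshift k n + pattern_level k n <= L)%N.
    move=> hn; rewrite /L (bigD1_seq n) ?iota_uniq ?mem_index_iota //=.
    by rewrite -addnA; exact: leq_addr.
  have := avoid_prob kK Kk (fun n _ => block_event_periodic n) sE w0 wE hL.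
  move=> /le_trans; apply; rewrite invf_ple ?posrE //; first by lra.
  by apply: ltr_pwDl => //; rewrite big_nat_cond sumr_ge0 // => n _; exact: block_weight_ge0.
have nU := @negligible_bigcup _ _ _ (@lebesgue_measure R) _ nA.
apply: negligibleS (negligibleU (negligible_nongeneric S) nU) => x [cx /= x01].
case: (pselect (unitg x)) => [ux|nu]; [right|left] => //.
have [M [_ hM]] := cvg_avoid ux cx.
exists M => //; split=> // n hn; apply: hM; exact: leq_trans (leq_addr _ _) hn.
Qed.

End LargeMean.

(** * The second moment on a set of bounded partial sums *)

Section SecondMoment.
Context {R : realType}.
Variable S : sampling R.
Local Notation stepf := (stepf S).
Variables (L p q : nat) (K : nat -> nat) (Y A : nat -> R -> R) (d : nat -> R).
Local Notation av := (av S L).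
Hypothesis K_mono : forall n n', (p <= n)%N -> (n <= n')%N -> (K n <= K n')%N.
Hypothesis Y_step : forall n, (p <= n < q)%N -> stepf (K n.+1) (Y n).
Hypothesis A01 : forall n x, (p <= n < q)%N -> A n x ^+ 2 = A n x.
Hypothesis Y_mean : forall n F, (p <= n < q)%N -> stepf (K n) F -> av (fun x => F x * Y n x) = 0.
Hypothesis Y_var : forall n F, (p <= n < q)%N -> stepf (K n) F ->
  av (fun x => F x * Y n x ^+ 2) = av F * d n.
Hypothesis Y_half : forall n F, (p <= n < q)%N -> stepf (K n) F ->
  av (fun x => F x * (A n x * Y n x ^+ 2)) = av F * (d n / 2).
Hypothesis Y_four : forall n, (p <= n < q)%N -> av (fun x => A n x * Y n x ^+ 4) <= 4 * d n ^+ 2.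
Hypothesis d_ge0 : forall n, 0 <= d n.

(** The Y n are martingale differences for the dyadic levels K n, with conditional variance d n.
    Half of this variance sits where A n = 1, and there the fourth moments are controlled as
    well. *)
Definition psum (r : nat) (x : R) : R := \sum_(p <= n < r) Y n x.
Definition dsum (r : nat) : R := \sum_(p <= n < r) d n.
Definition cross (r : nat) (x : R) : R := \sum_(p <= n < r) psum n x * Y n x.

Lemma dsum_ge0 r : 0 <= dsum r.
Proof. by apply: sumr_ge0. Qed.

Lemma psumS r x : (p <= r)%N -> psum r.+1 x = psum r x + Y r x.
Proof. by move=> pr; rewrite /psum big_nat_recr. Qed.

Lemma crossS r x : (p <= r)%N -> cross r.+1 x = cross r x + psum r x * Y r x.
Proof. by move=> pr; rewrite /cross big_nat_recr. Qed.

Lemma dsumS r : (p <= r)%N -> dsum r.+1 = dsum r + d r.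
Proof. by move=> pr; rewrite /dsum big_nat_recr. Qed.

Lemma psum_sq r x : (p <= r)%N -> psum r x ^+ 2 = \sum_(p <= n < r) Y n x ^+ 2 + 2 * cross r x.
Proof.
elim: r => [|r IH] pr.
  by rewrite /psum /cross !big_geq //; ring.
case: (leqP p r) => h; last first.
  by rewrite /psum /cross !big_geq //; ring.
rewrite psumS // crossS // big_nat_recr //= sqrrD IH //; ring.
Qed.

Lemma stepf_psum r : (p <= r <= q)%N -> stepf (K r) (psum r).
Proof.
move=> /andP[pr rq]; apply: stepf_sum_nat => n /andP[n1 n2].
by apply: stepf_le (K_mono (leqW n1) n2) (Y_step _); rewrite n1 (leq_trans n2).
Qed.

Lemma stepf_cross r : (p <= r <= q)%N -> stepf (K r) (cross r).
Proof.
move=> /andP[pr rq]; apply: stepf_sum_nat => n /andP[n1 n2].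
have nq : (n < q)%N by exact: leq_trans n2 rq.
apply: stepfM; last by apply: stepf_le (K_mono (leqW n1) n2) (Y_step _); rewrite n1.
by apply: stepf_le (K_mono n1 (ltnW n2)) (stepf_psum _); rewrite n1 ltnW.
Qed.

Lemma av_psum_sq r : (p <= r <= q)%N -> av (fun x => psum r x ^+ 2) = dsum r.
Proof.
elim: r => [|r IH] /andP[pr rq].
  have -> : dsum 0 = 0 by rewrite /dsum big_geq.
  by rewrite -[RHS](@av_cst _ S L 0); apply: eq_av => x _; rewrite /psum big_geq // expr0n.
move: pr; rewrite leq_eqVlt => /predU1P[e|pr].
  have -> : dsum r.+1 = 0 by rewrite /dsum big_geq ?e.
  by rewrite -[RHS](@av_cst _ S L 0); apply: eq_av => x _; rewrite /psum big_geq ?e // expr0n.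
rewrite ltnS in pr; have hr : (p <= r < q)%N by rewrite pr rq.
have hr' : (p <= r <= q)%N by rewrite pr ltnW.
rewrite dsumS // -IH //.
transitivity (av (fun x => psum r x ^+ 2 + (2 * psum r x * Y r x + 1 * Y r x ^+ 2))).
  by apply: eq_av => x _; rewrite psumS //; ring.
rewrite !avD Y_mean //; last by apply: stepfZ; exact: stepf_psum.
by rewrite (Y_var (F := fun=> 1)) // av_cst mul1r add0r.
Qed.

(** [cross] is again a martingale: the increment at r has mean square [dsum r] times d r, and these
    add up to at most the square of [dsum]. *)
Lemma av_cross_sq r : (p <= r <= q)%N -> av (fun x => cross r x ^+ 2) <= dsum r ^+ 2.
Proof.
elim: r => [|r IH] /andP[pr rq].
  rewrite (eq_av L (G := fun=> 0)) ?av_cst ?sqr_ge0 // => x _.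
  by rewrite /cross big_geq // expr0n.
move: pr; rewrite leq_eqVlt => /predU1P[e|pr].
  rewrite (eq_av L (G := fun=> 0)) ?av_cst ?sqr_ge0 // => x _.
  by rewrite /cross big_geq ?e // expr0n.
rewrite ltnS in pr; have hr : (p <= r < q)%N by rewrite pr rq.
have hr' : (p <= r <= q)%N by rewrite pr ltnW.
have -> : av (fun x => cross r.+1 x ^+ 2) =
    av (fun x => cross r x ^+ 2 +
      (2 * (cross r x * psum r x) * Y r x + psum r x ^+ 2 * Y r x ^+ 2)).
  by apply: eq_av => x _; rewrite crossS //; ring.
rewrite !avD Y_mean //; last first.
  by apply: stepfZ; apply: stepfM; [exact: stepf_cross | exact: stepf_psum].
rewrite Y_var //; last by apply: (stepf_comp (fun y => y ^+ 2)); exact: stepf_psum.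
rewrite av_psum_sq // add0r dsumS //.
have := IH hr'; have := dsum_ge0 r; have := d_ge0 r.
move: (av _) (dsum r) (d r) => a D e e0 D0 h; nra.
Qed.

Variables (P Q : R -> R) (eps : R).
Hypothesis pq : (p <= q)%N.
Hypothesis P_step : stepf (K p) P.
Hypothesis P01 : forall x, P x ^+ 2 = P x.
Hypothesis Q01 : forall x, Q x ^+ 2 = Q x.
Hypothesis QP : forall x, Q x * P x = Q x.
Hypothesis eps0 : 0 <= eps.
Hypothesis PQ_eps : av P - av Q <= eps ^+ 2.

Let D (x : R) : R := P x - Q x.

Lemma D01 x : D x ^+ 2 = D x.
Proof.
rewrite /D; have -> : (P x - Q x) ^+ 2 = P x ^+ 2 - 2 * (Q x * P x) + Q x ^+ 2 by ring.
by rewrite P01 Q01 QP; ring.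
Qed.

(** D is the indicator of what P loses in passing to Q; its average is at most eps^2. *)
Lemma cauchy_schwarz_le F c : 0 <= c -> av (fun x => F x ^+ 2) <= c ^+ 2 ->
  `|av (fun x => D x * F x)| <= eps * c.
Proof.
move=> c0 Fc; rewrite -(ler_pXn2r (ltn0Sn 1)) ?nnegrE ?normr_ge0 ?mulr_ge0 //.
rewrite real_normK ?num_real //; apply: le_trans (@av_cauchy_schwarz _ S L D F) _.
rewrite exprMn; apply: ler_pM => //.
- by apply: av_ge0 => x _; exact: sqr_ge0.
- by apply: av_ge0 => x _; exact: sqr_ge0.
- rewrite (eq_av L (G := D)) ?avB // => x _; exact: D01.
Qed.

(** The square of [psum] is its diagonal plus twice [cross]. Against P, the diagonal restricted to A
    n yields half of [dsum] and [cross] averages to zero. Replacing P by Q costs 2 eps on the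
    diagonal, through the fourth moments, and eps on [cross], which counts twice. *)
Lemma energy_lower_bound :
  (av P / 2 - 4 * eps) * dsum q <= av (fun x => Q x * psum q x ^+ 2).
Proof.
have diag : av (fun x => Q x * \sum_(p <= n < q) Y n x ^+ 2) >= (av P / 2 - 2 * eps) * dsum q.
  have -> : av (fun x => Q x * \sum_(p <= n < q) Y n x ^+ 2) =
      \sum_(p <= n < q) av (fun x => Q x * Y n x ^+ 2).
    by rewrite -av_sum; apply: eq_av => x _; rewrite mulr_sumr.
  rewrite /dsum mulr_sumr; apply: ler_sum_nat => n hn.
  have h1 : av (fun x => P x * (A n x * Y n x ^+ 2)) = av P * (d n / 2).
    by rewrite Y_half //; apply: stepf_le P_step; apply: K_mono => //; case/andP: hn.
  have h2 : `|av (fun x => D x * (A n x * Y n x ^+ 2))| <= eps * (2 * d n).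
    apply: cauchy_schwarz_le; first by rewrite mulr_ge0.
    rewrite (eq_av L (G := fun x => A n x * Y n x ^+ 4)).
      by apply: le_trans (Y_four hn) _; rewrite le_eqVlt; apply/orP; left; apply/eqP; ring.
    by move=> x _; rewrite exprMn A01 // -exprM.
  have h3 : av (fun x => Q x * (A n x * Y n x ^+ 2)) <= av (fun x => Q x * Y n x ^+ 2).
    apply: av_le => x _; rewrite -Q01 -(A01 x hn).
    have a1 : A n x ^+ 2 <= 1 by have := A01 x hn; have := sqr_ge0 (A n x - 1); nra.
    apply: ler_wpM2l; first exact: sqr_ge0.
    by apply: ler_piMl => //; exact: sqr_ge0.
  have h4 : av (fun x => Q x * (A n x * Y n x ^+ 2)) = av (fun x => P x * (A n x * Y n x ^+ 2)) -
      av (fun x => D x * (A n x * Y n x ^+ 2)).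
    by rewrite -avB; apply: eq_av => x _; rewrite /D; ring.
  have h5 := ler_norm (av (fun x => D x * (A n x * Y n x ^+ 2))).
  apply: le_trans h3; rewrite h4 h1; nra.
have off : `|av (fun x => Q x * cross q x)| <= eps * dsum q.
  have -> : av (fun x => Q x * cross q x) = - av (fun x => D x * cross q x).
    have -> : av (fun x => Q x * cross q x) =
        av (fun x => P x * cross q x) - av (fun x => D x * cross q x).
      by rewrite -avB; apply: eq_av => x _; rewrite /D; ring.
    suff -> : av (fun x => P x * cross q x) = 0 by rewrite sub0r.
    transitivity (\sum_(p <= n < q) av (fun x => P x * psum n x * Y n x)).
      by rewrite -av_sum; apply: eq_av => x _; rewrite mulr_sumr; apply: eq_bigr => n _; ring.
    rewrite big_nat_cond big1 // => n /andP[/andP[n1 n2] _]; apply: Y_mean; first by rewrite n1.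
    apply: stepfM; first by apply: stepf_le P_step; exact: K_mono.
    by apply: stepf_psum; rewrite n1 ltnW.
  rewrite normrN; apply: cauchy_schwarz_le; first exact: dsum_ge0.
  by apply: av_cross_sq; rewrite pq leqnn.
have -> : av (fun x => Q x * psum q x ^+ 2) =
    av (fun x => Q x * \sum_(p <= n < q) Y n x ^+ 2) + 2 * av (fun x => Q x * cross q x).
  by rewrite -avZ -avD; apply: eq_av => x _; rewrite psum_sq //; ring.
move: off; rewrite ler_norml => /andP[off _]; lra.
Qed.

End SecondMoment.

(** * Moments of Rademacher sums on a half interval *)

Section RademacherMoments.
Context {R : realType}.
Variable S : sampling R.
Local Notation stepf := (stepf S).
Local Notation av := (av S).
Variables (c : nat -> R) (off L : nat).
Hypothesis off1 : (1 <= off)%N.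

Definition rsum (q : nat) (y : R) : R := \sum_(i < q) c i * rademacher (off + i) y.

Lemma rsumS q y : rsum q.+1 y = rsum q y + c q * rademacher (off + q) y.
Proof. by rewrite /rsum big_ord_recr. Qed.

Lemma stepf_rsum q : stepf (off + q) (rsum q).
Proof.
apply: (stepf_sum_ord (F := fun i y => c i * rademacher (off + i) y)) => i iq.
apply: stepfZ; apply: stepf_le (@stepf_rademacher _ S (off + i)).
by rewrite -addnS leq_add2l.
Qed.

Lemma stepf_ind_rsum q j : stepf (off + q) (fun y => cell_ind 1 1 y * rsum q y ^+ j).
Proof.
apply: stepfM; first by apply: stepf_le (@stepf_cell_ind _ S 1 1); exact: leq_trans (leq_addr _ _).
by apply: (stepf_comp (fun z => z ^+ j)); exact: stepf_rsum.
Qed.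

Lemma av_rsum_odd q j : (off + q < L)%N ->
  av L (fun y => cell_ind 1 1 y * rsum q y ^+ j * rademacher (off + q) y) = 0.
Proof. by move=> h; apply: av_rademacher => //; exact: stepf_ind_rsum. Qed.

Lemma av_rsum_sq q : (off + q <= L)%N ->
  av L (fun y => cell_ind 1 1 y * rsum q y ^+ 2) = (\sum_(i < q) c i ^+ 2) / 2.
Proof.
elim: q => [|q IH] qL.
  rewrite big_ord0 mul0r -[RHS](@av_cst _ S L 0); apply: eq_av => y _.
  by rewrite /rsum big_ord0 expr0n mulr0.
rewrite addnS in qL; rewrite big_ord_recr /= mulrDl -IH; last exact: ltnW.
transitivity (av L (fun y => cell_ind 1 1 y * rsum q y ^+ 2 +
    ((2 * c q) * (cell_ind 1 1 y * rsum q y ^+ 1 * rademacher (off + q) y) +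
     c q ^+ 2 * cell_ind 1 1 y))).
  apply: eq_av => y uy; rewrite rsumS expr1.
  transitivity (cell_ind 1 1 y * rsum q y ^+ 2 +
    ((2 * c q) * (cell_ind 1 1 y * rsum q y * rademacher (off + q) y) +
     c q ^+ 2 * cell_ind 1 1 y * rademacher (off + q) y ^+ 2)); first ring.
  by rewrite (rademacher_sq _ uy) mulr1.
by rewrite !avD !avZ av_rsum_odd // mulr0 add0r av_cell_ind //; lia.
Qed.

(** Khinchin's constant 3 times the measure 1/2 of the half interval. In the induction the odd
    powers of the newest Rademacher function average out, and the mixed term 6 c^2 (s / 2) is
    exactly the one in 3/2 (s + c^2)^2. *)
Lemma av_rsum_four q : (off + q <= L)%N ->
  av L (fun y => cell_ind 1 1 y * rsum q y ^+ 4) <= 3 / 2 * (\sum_(i < q) c i ^+ 2) ^+ 2.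
Proof.
elim: q => [|q IH] qL.
  rewrite big_ord0 expr0n mulr0 -[leRHS](@av_cst _ S L 0); apply: av_le => y _.
  by rewrite /rsum big_ord0 expr0n mulr0.
rewrite addnS in qL; rewrite big_ord_recr /=.
have -> : av L (fun y => cell_ind 1 1 y * rsum q.+1 y ^+ 4) =
    av L (fun y => cell_ind 1 1 y * rsum q y ^+ 4 +
    ((4 * c q) * (cell_ind 1 1 y * rsum q y ^+ 3 * rademacher (off + q) y) +
     ((6 * c q ^+ 2) * (cell_ind 1 1 y * rsum q y ^+ 2) +
     ((4 * c q ^+ 3) * (cell_ind 1 1 y * rsum q y ^+ 1 * rademacher (off + q) y) +
     c q ^+ 4 * cell_ind 1 1 y)))).
  apply: eq_av => y uy; rewrite rsumS expr1.
  have r2 := rademacher_sq (off + q) uy.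
  have r3 : rademacher (off + q) y ^+ 3 = rademacher (off + q) y by rewrite exprS r2 mulr1.
  have r4 : rademacher (off + q) y ^+ 4 = 1 by rewrite -[4%N]/(2 * 2)%N exprM r2 expr1n.
  transitivity (cell_ind 1 1 y * rsum q y ^+ 4 +
    ((4 * c q) * (cell_ind 1 1 y * rsum q y ^+ 3 * rademacher (off + q) y) +
     ((6 * c q ^+ 2) * (cell_ind 1 1 y * rsum q y ^+ 2 * rademacher (off + q) y ^+ 2) +
     ((4 * c q ^+ 3) * (cell_ind 1 1 y * rsum q y * rademacher (off + q) y ^+ 3) +
     c q ^+ 4 * cell_ind 1 1 y * rademacher (off + q) y ^+ 4)))); first ring.
  by rewrite r2 r3 r4 !mulr1.
rewrite !avD !avZ !av_rsum_odd // !mulr0 !add0r av_cell_ind //; last lia.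
rewrite av_rsum_sq; last exact: ltnW.
have {}IH := IH (ltnW qL).
have s0 : 0 <= \sum_(i < q) c i ^+ 2 by apply: sumr_ge0 => i _; exact: sqr_ge0.
have -> : c q ^+ 4 = (c q ^+ 2) ^+ 2 by rewrite -exprM.
have := sqr_ge0 (c q); rewrite expr1.
move: (c q ^+ 2) (\sum_(i < q) c i ^+ 2) (av _ _) IH s0 => u s A IH s0 u0; nra.
Qed.

End RademacherMoments.

(** * Moments of the g part of a block *)

Section BlockMoments.
Context {R : realType}.
Variable S : sampling R.
Local Notation unitg := (unitg S).
Local Notation av := (av S).
Variables (f : nat -> nat -> R -> R) (k : nat -> nat).
Hypothesis gf : forall r, (2 <= r)%N -> generic_menshov S r (f r).
Hypothesis mf : forall r, (2 <= r)%N -> menshov_system r (f r).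
Variables (n : nat) (c : nat -> R).
Hypothesis n2 : (2 <= n)%N.
Local Notation N := (2 ^ (2 * n))%N.

Let off1 : (1 <= k n.-1 + 4)%N. Proof. by rewrite addn4. Qed.

Definition block_pattern (y : R) : R := \sum_(i < N) c i * pattern f k n i y.

(* The half of the period on which the functions ghat_n^i are Rademacher
   functions. *)
Definition rademacher_half (y : R) : R := periodize 0 1 (cell_ind 1 1) y.

Lemma rademacher_half_sq y : rademacher_half y ^+ 2 = rademacher_half y.
Proof. by rewrite /rademacher_half /periodize expr2 cell_ind_sq. Qed.

Lemma rademacher_half_periodic : periodic1 rademacher_half.
Proof.
move=> y z; rewrite /rademacher_half -[z%:R]/(z%:Z%:~R) -[z%:Z%:~R]mulr1.
exact: periodize_add.
Qed.

Lemma rademacher_halfE y : unitg y -> rademacher_half y = cell_ind 1 1 y.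
Proof.
move=> [y0 y1 _]; rewrite /rademacher_half periodize_id //.
by rewrite add0r y1 ltW.
Qed.

Lemma block_pattern_periodic : periodic1 block_pattern.
Proof.
move=> y z; apply: eq_bigr => i _; congr (_ * _); exact: pattern_periodic.
Qed.

Lemma av_block_pattern L : (pattern_level k n <= L)%N -> av L block_pattern = 0.
Proof.
move=> lL; rewrite av_sum big1 // => i _.
by rewrite avZ (av_pattern gf mf n2) ?mulr0.
Qed.

Lemma av_block_pattern_sq L : (pattern_level k n <= L)%N ->
  av L (fun y => block_pattern y ^+ 2) = \sum_(i < N) c i ^+ 2.
Proof.
move=> lL; under eq_av => y _ do rewrite expr2 mulr_suml.
rewrite av_sum; apply: eq_bigr => i _.
under eq_av => y _ do rewrite mulr_sumr.
rewrite av_sum (bigD1 i) //= big1 ?addr0 => [|j ji].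
  transitivity (av L (fun y => c i ^+ 2 * (pattern f k n i y * pattern f k n i y))).
    by apply: eq_av => y _; ring.
  by rewrite avZ (av_patternM gf mf n2) // eqxx mulr1.
transitivity (av L (fun y => (c i * c j) * (pattern f k n i y * pattern f k n j y))).
  by apply: eq_av => y _; ring.
rewrite avZ (av_patternM gf mf n2) //.
have -> : (nat_of_ord i == j) = false by rewrite eq_sym; exact: negbTE ji.
by rewrite mulr0.
Qed.

Lemma half_block_pattern y j : unitg y -> rademacher_half y * block_pattern y ^+ j =
  cell_ind 1 1 y * rsum c (k n.-1 + 4) N y ^+ j.
Proof.
move=> uy; rewrite rademacher_halfE // /cell_ind; case: eqP => [c1|]; last by rewrite !mul0r.
congr (_ * _ ^+ _); apply: eq_bigr => i _.
by rewrite (@pattern_high _ S).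
Qed.

Lemma pattern_level_off L : (pattern_level k n <= L)%N -> (k n.-1 + 4 + N <= L)%N.
Proof. by rewrite /pattern_level; lia. Qed.

Lemma av_half_sq L : (pattern_level k n <= L)%N ->
  av L (fun y => rademacher_half y * block_pattern y ^+ 2) = (\sum_(i < N) c i ^+ 2) / 2.
Proof.
move=> /pattern_level_off lL; rewrite -(av_rsum_sq S c off1 lL).
by apply: eq_av => y uy; rewrite half_block_pattern.
Qed.

(** The constant 3/2 is relaxed to 4 so that the bound becomes the square of twice the variance. *)
Lemma av_half_four L : (pattern_level k n <= L)%N ->
  av L (fun y => rademacher_half y * block_pattern y ^+ 4) <= 4 * (\sum_(i < N) c i ^+ 2) ^+ 2.
Proof.
move=> /pattern_level_off lL; apply: (@le_trans _ _ (3 / 2 * (\sum_(i < N) c i ^+ 2) ^+ 2)).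
  rewrite (eq_av L (G := fun y => cell_ind 1 1 y * rsum c (k n.-1 + 4) N y ^+ 4)).
    exact: av_rsum_four.
  by move=> y uy; rewrite half_block_pattern.
by apply: ler_wpM2r; [exact: sqr_ge0 | lra].
Qed.

End BlockMoments.

Lemma telescope_pred (V : zmodType) (F : nat -> V) p q : (1 <= p)%N -> (p <= q)%N ->
  \sum_(p <= n < q) (F n - F n.-1) = F q.-1 - F p.-1.
Proof.
move=> p1; elim: q => [|q IH]; first by rewrite leqn0; case: p p1.
rewrite leq_eqVlt => /predU1P[<-|]; first by rewrite big_geq // subrr.
rewrite ltnS => pq; rewrite big_nat_recr //= IH // addrC subrKA //.
Qed.

(** * The energy of the blocks against the bound on the partial sums *)

Section SmallMean.
Context {R : realType}.
Variable S : sampling R.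
Local Notation stepf := (stepf S).
Local Notation av := (av S).
Variables (f : nat -> nat -> R -> R) (k : nat -> nat) (xi Ups : nat -> R -> R).
Variables (lx : nat -> nat) (a : nat -> R).
Hypothesis gf : forall r, (2 <= r)%N -> generic_menshov S r (f r).
Hypothesis mf : forall r, (2 <= r)%N -> menshov_system r (f r).
Hypothesis gS : forall n i, (1 <= n)%N -> (i < 2 ^ (2 * n))%N -> stepf (k n) (g f k n i).
Hypothesis xiS : forall l, (1 <= l)%N -> stepf (lx l) (xi l).
Hypothesis xiM : forall L l l', (1 <= l)%N -> (1 <= l')%N -> (lx l <= L)%N -> (lx l' <= L)%N ->
  av L (fun x => xi l x * xi l' x) = (l == l')%:R.
Hypothesis Ups_def : forall n j : nat, (1 <= n)%N ->
  (1 <= j <= 2 ^ (2 * n) + 1)%N -> Ups (mu n.-1 + j)%N = upsilon f k xi n j.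

Definition partial (N : nat) (x : R) : R := \sum_(1 <= l < N.+1) a l * Ups l x.

Definition rotated (n i : nat) : R := transform (block_size n) (block_coef a n) i.

(** Row 1 of the matrix carries xi_n and row i + 2 carries g_n^i, hence the shift by two. *)
Definition block_main (n : nat) (x : R) : R :=
  \sum_(i < 2 ^ (2 * n)) rotated n i.+2 * g f k n i x.

Definition block_energy (n : nat) : R := \sum_(i < 2 ^ (2 * n)) rotated n i.+2 ^+ 2.

Lemma partial_step n x : (1 <= n)%N ->
  partial (mu n) x = partial (mu n.-1) x + (rotated n 1 * xi n x + block_main n x).
Proof.
move=> n1; rewrite /partial (block_partial_sum Ups a x n1); congr (_ + _).
rewrite (eq_big_nat _ _ (F2 := fun j => block_coef a n j *
    comb (block_size n) j (block_fun f k xi n) x)).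
  rewrite sum_comb big_ltn; last by rewrite ltnS (leq_trans _ (block_size_ge2 n)).
  congr (_ + _); rewrite /block_main /block_size addn1 big_add1 /= big_add1 /= big_mkord.
  by apply: eq_bigr => i _; rewrite /block_fun subSS subn1 /= -addn1.
by move=> j hj; rewrite (upsilon_comb Ups_def).
Qed.

Lemma rotated_energy n : rotated n 1 ^+ 2 + block_energy n = block_norm a n ^+ 2.
Proof.
rewrite -block_norm_sq -(sum_transform_sq _ (block_size_ge2 n)) big_ltn; last first.
  by rewrite ltnS (leq_trans _ (block_size_ge2 n)).
congr (_ + _); rewrite /block_energy /block_size addn1 big_add1 /= big_add1 /= big_mkord.
by apply: eq_bigr => i _; rewrite /rotated /block_size addn1.
Qed.

Lemma block_energy_ge0 n : 0 <= block_energy n.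
Proof. by apply: sumr_ge0 => i _; exact: sqr_ge0. Qed.

Definition partial_level (n : nat) : nat := \sum_(1 <= i < n.+1) block_level k lx i.

Lemma partial_level_mono n n' : (n <= n')%N -> (partial_level n <= partial_level n')%N.
Proof.
move=> h; rewrite /partial_level [X in (_ <= X)%N](@big_cat_nat _ _ _ n.+1) ?ltnS //=.
exact: leq_addr.
Qed.

Lemma block_level_partial n n' : (1 <= n <= n')%N -> (block_level k lx n <= partial_level n')%N.
Proof.
move=> hn; rewrite /partial_level (bigD1_seq n) ?iota_uniq ?mem_index_iota //=.
exact: leq_addr.
Qed.

Lemma stepf_partial n : stepf (partial_level n) (partial (mu n)).
Proof.
elim: n => [|n IH].
  apply: (@stepf_eq _ _ _ _ _ (fun=> 0)) => // x _.
  by rewrite /partial /mu [in LHS]big_geq // big_geq.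
apply: (stepf_eq (fun x _ => @partial_step n.+1 x isT)).
apply: stepfD; first by apply: stepf_le IH; exact: partial_level_mono.
apply: (@stepf_le _ _ _ (block_level k lx n.+1)).
  by apply: block_level_partial; rewrite ltnS leqnn.
apply: stepfD.
  by apply: stepfZ; apply: stepf_le (xiS _); [exact: leq_addr | by []].
apply: (stepf_sum_ord (F := fun i x => rotated n.+1 i.+2 * g f k n.+1 i x)) => i iN.
by apply: stepfZ; apply: stepf_le (gS _ iN); [exact: leq_addl | by []].
Qed.

Variable lam : R.

Definition bounded_upto (q : nat) (x : R) : Prop :=
  forall n, (n <= q)%N -> `|partial (mu n) x| <= lam.

Lemma stepf_bounded q : stepf (partial_level q) (bounded_upto q).
Proof.
move=> x y ux uy e; apply/propext.
have E n : (n <= q)%N -> partial (mu n) x = partial (mu n) y.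
  by move=> nq; apply: (stepf_le (partial_level_mono nq) (@stepf_partial n)).
by split=> h n nq; [rewrite -E | rewrite E] => //; exact: h.
Qed.

Lemma indicator01 (B : R -> Prop) (x : R) : indicator B x ^+ 2 = indicator B x.
Proof. by rewrite /indicator; case: asboolP => _; rewrite ?expr1n ?expr0n. Qed.

Lemma indicator_sub (B B' : R -> Prop) (x : R) : (B x -> B' x) ->
  indicator B x * indicator B' x = indicator B x.
Proof.
move=> BB; rewrite /indicator; case: asboolP => [/BB h|_]; last by rewrite mul0r.
by rewrite asboolT // mulr1.
Qed.

Definition bounded_measure (q : nat) : R := av (partial_level q) (indicator (bounded_upto q)).

Lemma bounded_measureE q L : (partial_level q <= L)%N ->
  av L (indicator (bounded_upto q)) = bounded_measure q.
Proof. by move=> h; apply: av_stepf => //; apply: stepf_indicator; exact: stepf_bounded. Qed.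

Lemma bounded_measure_ge0 q : 0 <= bounded_measure q.
Proof. by apply: av_ge0 => x _; rewrite /indicator ler0n. Qed.

Lemma bounded_measure_le1 q : bounded_measure q <= 1.
Proof.
rewrite -[leRHS](@av_cst _ S (partial_level q) 1); apply: av_le => x _.
by rewrite /indicator; case: asboolP.
Qed.

Lemma bounded_measure_mono q q' : (q <= q')%N -> bounded_measure q' <= bounded_measure q.
Proof.
move=> qq; rewrite -(bounded_measureE (partial_level_mono qq)) /bounded_measure.
apply: av_le => x _; rewrite /indicator ler_nat; case: asboolP => // h.
by rewrite asboolT // => n nq; apply: h; exact: leq_trans qq.
Qed.

(* The set on which the partial sums have stayed bounded up to block M is a step set
   of a level that the blocks from p on no longer see, so it is independent of them;
   losing little measure between M and q, it can replace the set for q. *)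
Lemma energy_bound (M p q : nat) (eps : R) : (2 <= p)%N -> (M <= p)%N -> (p <= q)%N ->
  (partial_level M <= gshift k p)%N -> 0 <= eps -> 0 <= lam ->
  bounded_measure M - bounded_measure q <= eps ^+ 2 ->
  (bounded_measure M / 2 - 4 * eps) * \sum_(p <= n < q) block_energy n <=
  8 * lam ^+ 2 + 2 * \sum_(p <= n < q) rotated n 1 ^+ 2.
Proof.
move=> p2 Mp pq hM eps0 lam0 hq.
pose L := (partial_level q + \sum_(p <= n < q) (gshift k n + pattern_level k n))%N.
have Lq : (partial_level q <= L)%N by exact: leq_addr.
have LM : (partial_level M <= L)%N.
  by apply: leq_trans Lq; apply: partial_level_mono; exact: leq_trans pq.
have Ln n : (p <= n < q)%N -> (gshift k n <= L)%N /\ (pattern_level k n <= L - gshift k n)%N.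
  move=> hn; have h : (gshift k n + pattern_level k n <= L)%N.
    rewrite /L (bigD1_seq n) ?iota_uniq ?mem_index_iota //=.
    by rewrite addnCA; exact: leq_addr.
  by split; [exact: leq_trans (leq_addr _ _) h | rewrite leq_subRL // (leq_trans _ h) ?leq_addr].
have n2 n : (p <= n < q)%N -> (2 <= n)%N by move=> /andP[h _]; exact: leq_trans h.
have mainE n x : (p <= n < q)%N ->
    block_main n x = block_pattern f k n (fun i => rotated n i.+2) (2 ^+ gshift k n * x).
  by move=> hn; apply: eq_bigr => i _; rewrite g_pattern // (n2 n hn).
have indep n F (G : R -> R) : (p <= n < q)%N -> stepf (gshift k n) F -> periodic1 G ->
    av L (fun x => F x * G (2 ^+ gshift k n * x)) = av L F * av (L - gshift k n) G.
  by move=> hn sF pG; apply: av_indep => //; case: (Ln n hn).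
pose A n x : R := rademacher_half (2 ^+ gshift k n * x).
pose Bp n := block_pattern f k n (fun i => rotated n i.+2).
have pP n : periodic1 (Bp n) by exact: block_pattern_periodic.
have K_mono n n' : (p <= n)%N -> (n <= n')%N -> (gshift k n <= gshift k n')%N.
  move=> h1 h2; move: h2; rewrite leq_eqVlt => /predU1P[->//|h2].
  have h3 : (1 <= n)%N by exact: leq_trans (ltnW p2) h1.
  have := level_gap gS (leq_trans p2 h1); have := level_lt gS h3 h2.
  rewrite /gshift; lia.
have Y_step n : (p <= n < q)%N -> stepf (gshift k n.+1) (block_main n).
  move=> hn; apply: (@stepf_le _ _ _ (k n)).
    by rewrite /gshift /= -!addnA leq_addr.
  apply: (stepf_sum_ord (F := fun i x => rotated n i.+2 * g f k n i x)) => i iN.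
  by apply: stepfZ; apply: gS => //; exact: ltnW (n2 n hn).
have A01 n x : (p <= n < q)%N -> A n x ^+ 2 = A n x.
  by move=> _; exact: rademacher_half_sq.
have Y_mean n F : (p <= n < q)%N -> stepf (gshift k n) F ->
    av L (fun x => F x * block_main n x) = 0.
  move=> hn sF; rewrite (eq_av L (G := fun x => F x *
      Bp n (2 ^+ gshift k n * x))).
    by rewrite indep // (av_block_pattern gf mf) ?mulr0 ?n2 //; case: (Ln n hn).
  by move=> x _; rewrite mainE.
have Y_var n F : (p <= n < q)%N -> stepf (gshift k n) F ->
    av L (fun x => F x * block_main n x ^+ 2) = av L F * block_energy n.
  move=> hn sF; rewrite (eq_av L (G := fun x => F x *
      (fun y => Bp n y ^+ 2) (2 ^+ gshift k n * x))).
    rewrite (indep n F (fun y => Bp n y ^+ 2)) //; last by move=> y z /=; rewrite pP.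
    by rewrite (av_block_pattern_sq gf mf) ?n2 //; case: (Ln n hn).
  by move=> x _; rewrite mainE.
have Y_half n F : (p <= n < q)%N -> stepf (gshift k n) F ->
    av L (fun x => F x * (A n x * block_main n x ^+ 2)) = av L F * (block_energy n / 2).
  move=> hn sF; rewrite (eq_av L (G := fun x => F x *
      (fun y => rademacher_half y * Bp n y ^+ 2)
        (2 ^+ gshift k n * x))).
    rewrite (indep n F (fun y => rademacher_half y * Bp n y ^+ 2)) //; last first.
      by move=> y z /=; rewrite pP rademacher_half_periodic.
    by rewrite av_half_sq ?n2 //; case: (Ln n hn).
  by move=> x _; rewrite mainE.
have Y_four n : (p <= n < q)%N ->
    av L (fun x => A n x * block_main n x ^+ 4) <= 4 * block_energy n ^+ 2.
  move=> hn; rewrite (eq_av L (G := fun x =>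
      (fun y => rademacher_half y * Bp n y ^+ 4)
        (2 ^+ gshift k n * x))); last by move=> x _; rewrite mainE.
  have [h1 h2] := Ln n hn.
  rewrite (@av_scale _ S (gshift k n) L (fun y => rademacher_half y * Bp n y ^+ 4)) //; last first.
    by move=> y z /=; rewrite pP rademacher_half_periodic.
  by apply: av_half_four; rewrite ?n2.
pose P := indicator (bounded_upto M); pose Q := indicator (bounded_upto q).
have P_step : stepf (gshift k p) P.
  exact: stepf_le hM (stepf_indicator (@stepf_bounded M)).
have QP x : Q x * P x = Q x.
  by apply: indicator_sub => h n nM; apply: h; apply: leq_trans nM (leq_trans Mp pq).
have PQ : av L P - av L Q <= eps ^+ 2 by rewrite !bounded_measureE.
have := energy_lower_bound K_mono Y_step A01 Y_mean Y_var Y_half Y_four block_energy_ge0 pq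
  P_step (indicator01 (bounded_upto M)) (indicator01 (bounded_upto q)) QP eps0 PQ.
rewrite [av L P]bounded_measureE // => /le_trans; apply.
(* The xi part of the blocks p, ..., q - 1. Together with the g part it telescopes to a difference
   of two partial sums at block ends. *)
pose U x : R := \sum_(p <= n < q) rotated n 1 * xi n x.
have UY x : U x + psum p block_main q x = partial (mu q.-1) x - partial (mu p.-1) x.
  rewrite /U /psum -big_split /=.
  have -> : partial (mu q.-1) x - partial (mu p.-1) x =
      \sum_(p <= n < q) (partial (mu n) x - partial (mu n.-1) x).
    by rewrite (telescope_pred (fun n => partial (mu n) x)) // ltnW.
  apply: eq_big_nat => n hn; rewrite partial_step; last exact: ltnW (n2 n hn).
  by ring.
have U2 : av L (fun x => U x ^+ 2) = \sum_(p <= n < q) rotated n 1 ^+ 2.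
  have lev n : (p <= n < q)%N -> (1 <= n)%N /\ (lx n <= L)%N.
    move=> hn; have n1 := ltnW (n2 n hn); split=> //.
    apply: leq_trans Lq; apply: leq_trans (block_level_partial (n := n) _).
      exact: leq_addr.
    by case/andP: hn => _ nq; rewrite n1 ltnW.
  under eq_av => x _ do rewrite expr2 mulr_suml.
  rewrite av_sum; apply: eq_big_nat => n hn; have [n1 nL] := lev n hn.
  under eq_av => x _ do rewrite mulr_sumr.
  rewrite av_sum (bigD1_seq n) ?iota_uniq ?mem_index_iota //= big_seq_cond big1 ?addr0.
    transitivity (av L (fun x => rotated n 1 ^+ 2 * (xi n x * xi n x))).
      by apply: eq_av => x _; ring.
    by rewrite avZ xiM // eqxx mulr1.
  move=> n' /andP[]; rewrite mem_index_iota => hn' nn'; have [n1' nL'] := lev n' hn'.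
  transitivity (av L (fun x => (rotated n 1 * rotated n' 1) * (xi n x * xi n' x))).
    by apply: eq_av => x _; ring.
  by rewrite avZ xiM // eq_sym (negbTE nn') mulr0.
rewrite -U2 -[8 * _](@av_cst _ S L) -avZ -avD; apply: av_le => x _.
rewrite /Q /indicator; case: asboolP => h; last first.
  by rewrite mul0r addr_ge0 // mulr_ge0 // sqr_ge0.
have h1 := h q.-1 (leq_pred _); have h2 := h p.-1 (leq_trans (leq_pred _) pq).
have := UY x; move: (psum _ _ _ _) (U x) (partial _ x) (partial _ x) h1 h2 => y u s t.
(* Where the partial sums s, t stay within lam, the g part y = (t - s) - u satisfies y^2 <= 2 (t -
   s)^2 + 2 u^2 <= 8 lam^2 + 2 u^2. *)
rewrite !ler_norml => /andP[s1 s2] /andP[t1 t2] e.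
have -> : y = t - s - u by rewrite -e; ring.
have h3 : (t - s) ^+ 2 <= 4 * lam ^+ 2.
  have -> : 4 * lam ^+ 2 = (2 * lam) ^+ 2 by ring.
  rewrite -ler_sqrt ?sqr_ge0 // !sqrtr_sqr [leRHS]ger0_norm ?mulr_ge0 // ler_norml.
  by apply/andP; split; lra.
have h4 := sqr_ge0 (t - s + u); rewrite mul1r; nra.
Qed.

End SmallMean.

(** * Divergence when the mean parts of the blocks are small *)

Section SmallMeanNull.
Context {R : realType}.
Variable S : sampling R.
Local Notation stepf := (stepf S).
Local Notation av := (av S).
Variables (f : nat -> nat -> R -> R) (k : nat -> nat) (xi Ups : nat -> R -> R).
Variables (lx : nat -> nat) (a : nat -> R).
Hypothesis gf : forall r, (2 <= r)%N -> generic_menshov S r (f r).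
Hypothesis mf : forall r, (2 <= r)%N -> menshov_system r (f r).
Hypothesis gS : forall n i, (1 <= n)%N -> (i < 2 ^ (2 * n))%N -> stepf (k n) (g f k n i).
Hypothesis xiS : forall l, (1 <= l)%N -> stepf (lx l) (xi l).
Hypothesis xiM : forall L l l', (1 <= l)%N -> (1 <= l')%N -> (lx l <= L)%N -> (lx l' <= L)%N ->
  av L (fun x => xi l x * xi l' x) = (l == l')%:R.
Hypothesis Ups_def : forall n j : nat, (1 <= n)%N ->
  (1 <= j <= 2 ^ (2 * n) + 1)%N -> Ups (mu n.-1 + j)%N = upsilon f k xi n j.
Hypothesis small_mean : forall theta : R, 0 < theta -> exists C : R, forall q,
  \sum_(2 <= n < q) rotated a n 1 ^+ 2 <= C + theta ^+ 2 * \sum_(2 <= n < q) block_norm a n ^+ 2.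
Hypothesis infinite_energy : forall C : R, exists q, C <= \sum_(2 <= n < q) block_norm a n ^+ 2.

Local Notation partial := (partial Ups a).
Local Notation bmeasure lam := (bounded_measure S k Ups lx a lam).

(** If the decreasing measures stayed above e, they would form a Cauchy sequence; from some M on
    little is lost, and [energy_bound] then keeps the total energy of the blocks bounded. *)
Lemma small_mean_measure (lam e : R) : 0 <= lam -> 0 < e -> exists q, bmeasure lam q <= e.
Proof.
move=> lam0 e0; apply: contrapT => /forallNP hq.
have {}hq q : e < bmeasure lam q by rewrite ltNge; apply/negP; exact: hq.
have e1 : e < 1 by apply: lt_le_trans (hq 0%N) (bounded_measure_le1 _ _ _ _ _ _ _).
(* With this eps the coefficient of the energy is at least e / 2 - 4 eps = 3e / 8, more than the e /
   4 used below. *)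
pose eps := e / 32; have eps0 : 0 < eps by rewrite divr_gt0.
have cB : cvgn (fun q => bmeasure lam q).
  apply: nonincreasing_is_cvgn.
    by move=> q q' qq; exact: (bounded_measure_mono a gS xiS Ups_def lam qq).
  by exists 0 => _ [q _ <-]; exact: bounded_measure_ge0.
have [M hM] := cvg_oscillation (exprn_gt0 2 eps0) cB.
(* Since [gshift k p] is at least p, the blocks from p on oscillate beyond the level of the event
   fixed at M. *)
pose p := (M + partial_level k lx M + 2)%N.
have p2 : (2 <= p)%N by exact: leq_addl.
have Mp : (M <= p)%N by rewrite /p -addnA leq_addr.
have gp : (partial_level k lx M <= gshift k p)%N.
  have h1 : (partial_level k lx M <= p)%N by rewrite /p; lia.
  have h2 : (p <= p ^ 2)%N by rewrite -{1}[p]expn1 leq_exp2l.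
  by rewrite /gshift; lia.
(* The sum of the alpha_n^2 enters three times, twice from the energy bound and once in the total
   energy B. Three times e / 24 is e / 8, so half of the coefficient e / 4 of B survives. *)
have th0 : 0 < Num.sqrt (e / 24) by rewrite sqrtr_gt0 divr_gt0.
have [C hC] := small_mean th0.
rewrite sqr_sqrtr in hC; last by rewrite divr_ge0 // ltW.
set B := fun q => \sum_(2 <= n < q) block_norm a n ^+ 2 in hC.
pose bound := 8 / e * (8 * lam ^+ 2 + 3 * C) + 2 * B p.
have main q : (p <= q)%N -> B q <= bound.
  move=> pq.
  have osc : bmeasure lam M - bmeasure lam q <= eps ^+ 2.
    have := hM M q (leqnn _) (leq_trans Mp pq); rewrite ltr_norml => /andP[h _]; lra.
  have := energy_bound gf mf gS xiS xiM Ups_def p2 Mp pq gp (ltW eps0) lam0 osc.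
  set D := \sum_(p <= n < q) _; set Al := \sum_(p <= n < q) rotated a n 1 ^+ 2 => hD.
  have BE : B q = B p + (Al + D).
    rewrite /B (@big_cat_nat _ _ _ p) //=; congr (_ + _).
    rewrite /Al /D -big_split /=; apply: eq_big_nat => n hn.
    by rewrite rotated_energy.
  have D0 : 0 <= D by apply: sumr_ge0 => n _; exact: block_energy_ge0.
  have Al0 : 0 <= Al by apply: sumr_ge0 => n _; exact: sqr_ge0.
  have AlC : Al <= C + e / 24 * B q.
    apply: le_trans (hC q); rewrite [leRHS](@big_cat_nat _ _ _ p) //= lerDr.
    by apply: sumr_ge0 => n _; exact: sqr_ge0.
  have h1 : e / 4 * D <= (bmeasure lam M / 2 - 4 * eps) * D.
    by apply: ler_wpM2r => //; have := hq M; rewrite /eps; lra.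
  have h2 : e / 4 * Al <= Al by have : e * Al <= 1 * Al; [exact: ler_wpM2r (ltW e1) | lra].
  have h3 : e / 8 * B q <= 8 * lam ^+ 2 + 3 * C + e / 4 * B p.
    have h5 : e / 4 * B q = e / 4 * B p + e / 4 * Al + e / 4 * D by rewrite BE; ring.
    have h6 : e / 4 * D <= 8 * lam ^+ 2 + 2 * Al by exact: le_trans h1 hD.
    have h7 : e / 24 * B q = (e * B q) / 24 by field.
    have h8 : e / 4 * B q = (e * B q) / 4 by field.
    have h9 : e / 8 * B q = (e * B q) / 8 by field.
    rewrite h7 in AlC; rewrite h8 in h5; rewrite h9; lra.
  have -> : B q = 8 / e * (e / 8 * B q) by field; rewrite gt_eqF.
  have -> : bound = 8 / e * (8 * lam ^+ 2 + 3 * C + e / 4 * B p).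
    by rewrite /bound; field; rewrite gt_eqF.
  by apply: ler_wpM2l h3; rewrite divr_ge0 // ltW.
have [q hqB] := infinite_energy (bound + 1).
have := main (maxn p q) (leq_maxl _ _).
have : B q <= B (maxn p q).
  rewrite /B; have [q2|q2] := leqP 2 q; last first.
    by rewrite big_geq ?sumr_ge0 // 1?ltnW // => n _; exact: sqr_ge0.
  rewrite [leRHS](@big_cat_nat _ _ _ q) ?leq_maxr //= lerDl.
  by apply: sumr_ge0 => n _; exact: sqr_ge0.
by rewrite /B; lra.
Qed.

Lemma cvg_bounded (u : nat -> R) : cvgn u -> exists m : nat, forall n, `|u n| <= m%:R.
Proof.
move=> /(cvg_oscillation ltr01)[P hP].
pose b := \sum_(n < P.+1) `|u n| + 1.
have b0 : 0 <= b by rewrite addr_ge0 // sumr_ge0.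
exists (Num.bound b) => n; apply: ltW; apply: le_lt_trans (archi_boundP b0).
have bn i : (i <= P)%N -> `|u i| <= \sum_(n < P.+1) `|u n|.
  move=> iP; rewrite (bigD1 (Ordinal (iP : (i < P.+1)%N))) //= lerDl sumr_ge0 //.
have [nP|Pn] := leqP n P; first by rewrite /b; have := bn n nP; lra.
have h1 := hP P n (leqnn _) (ltnW Pn); have h2 := bn P (leqnn _).
have := ler_normD (u P) (u n - u P); rewrite addrC subrK /b; lra.
Qed.

(** A convergent series has bounded partial sums, so x lies in one of the sets [A m], each covered
    by events of arbitrarily small measure. *)
Lemma small_mean_negligible :
  (@lebesgue_measure R).-negligible
    ([set x | cvgn (fun N : nat => \sum_(1 <= l < N.+1) a l * Ups l x)] `&` [set x | 0 <= x <= 1]).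
Proof.
pose A m := [set x : R | forall n, `|partial (mu n) x| <= m%:R].
have nA m : (@lebesgue_measure R).-negligible (A m `&` [set x | 0 <= x <= 1]).
  apply: (@negligible_step R S) => e e0.
  have [q hq] := small_mean_measure (ler0n R m) e0.
  exists (partial_level k lx q), (bounded_upto Ups a m%:R q); split=> //.
    exact: (stepf_bounded a gS xiS Ups_def m%:R).
  by move=> x _ Ax n _; exact: Ax.
have nU := @negligible_bigcup _ _ _ (@lebesgue_measure R) _ nA.
apply: negligibleS nU => x [cx /= x01].
have [m hm] := cvg_bounded cx.
by exists m => //; split=> // n; exact: hm.
Qed.

End SmallMeanNull.

(** * The divergence dichotomy *)

Section Dichotomy.
Context {R : realType}.
Variable a : nat -> R.

Lemma sum_half_powers q : \sum_(2 <= n < q) 2 ^- n <= 2 :> R.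
Proof.
have h : \sum_(0 <= n < q) 2 ^- n + 2 * 2 ^- q = 2 :> R.
  elim: q => [|q IH]; first by rewrite big_geq // expr0 invr1 add0r mulr1.
  by rewrite big_nat_recr //= -[RHS]IH exprS invfM; field; rewrite expf_neq0.
have h2 : 0 <= 2 ^- q :> R by rewrite invr_ge0 exprn_ge0.
apply: (@le_trans _ _ (\sum_(0 <= n < q) 2 ^- n)); last by lra.
have [q2|q2] := leqP 2 q.
  rewrite [leRHS](@big_cat_nat _ _ _ 2) //= lerDr.
  by apply: sumr_ge0 => n _; rewrite invr_ge0 exprn_ge0.
rewrite big_geq; last exact: ltnW.
by apply: sumr_ge0 => n _; rewrite invr_ge0 exprn_ge0.
Qed.

Lemma rotated_le n : rotated a n 1 ^+ 2 <= block_norm a n ^+ 2.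
Proof. by rewrite -rotated_energy lerDl block_energy_ge0. Qed.

Lemma block_norm_ge0 n : 0 <= block_norm a n.
Proof. exact: sqrtr_ge0. Qed.

(** For such n a block is bad for one of three reasons: it is zero, its mean is below theta |b_n|,
    or |b_n|^2 < 2^(-2n^2). The last one leaves a summable contribution, majorized by 2^-n. *)
Lemma rotated_bad (theta : R) n : 0 < theta -> (3 <= n)%N -> 96 <= theta * n%:R ->
  ~ good_block a theta n ->
  rotated a n 1 ^+ 2 <= theta ^+ 2 * block_norm a n ^+ 2 + 2 ^- n.
Proof.
move=> t0 n3 t96 bad; have p0 : 0 <= 2 ^- n :> R by rewrite invr_ge0 exprn_ge0.
have tb : 0 <= theta ^+ 2 * block_norm a n ^+ 2 by rewrite mulr_ge0 ?sqr_ge0.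
have [b0|b0] := leP (block_norm a n) 0.
  apply: le_trans (rotated_le n) _.
  have -> : block_norm a n = 0 by apply/eqP; rewrite eq_le b0 block_norm_ge0.
  by rewrite expr0n mulr0 add0r.
have [h|h] := leP (theta * block_norm a n) `|transform (block_size n) (block_coef a n) 1|.
  have hT : 2 ^+ (2 * n ^ 2) * block_norm a n ^+ 2 < 1.
    by rewrite ltNge; apply/negP => hT; apply: bad.
  apply: le_trans (rotated_le n) _; apply: (@le_trans _ _ (2 ^- n)); last by rewrite lerDr.
  have q0 : 0 < 2 ^+ n :> R by rewrite exprn_gt0.
  rewrite -[2 ^- n]mul1r ler_pdivlMr // mulrC; apply: le_trans (ltW hT).
  apply: ler_wpM2r; first exact: sqr_ge0.
  rewrite ler_eXn2l ?(ltr_nat R 1) //.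
  have : (n <= n ^ 2)%N by rewrite -{1}[n]expn1 leq_exp2l // (leq_trans _ n3).
  by move=> ?; lia.
apply: (@le_trans _ _ (theta ^+ 2 * block_norm a n ^+ 2)); last by rewrite lerDl.
rewrite -exprMn -[X in X <= _]real_normK ?num_real //.
by rewrite ler_pXn2r ?nnegrE ?normr_ge0 ?mulr_ge0 ?block_norm_ge0 ?(ltW t0) // ltW.
Qed.

(** Bounded sums force the weights to tend to 0. For a late good block the minimum in its weight is
    then |b_n|^2 itself, so alpha_n^2 <= |b_n|^2 is the weight divided by c and is summable. Late
    bad blocks are handled by [rotated_bad], the early ones by a constant. *)
Lemma small_mean_of_bounded (theta : R) M (C : R) : 0 < theta ->
  (forall q, \sum_(M <= n < M + q) block_weight a theta n <= C) ->
  exists C' : R, forall q, \sum_(2 <= n < q) rotated a n 1 ^+ 2 <=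
    C' + theta ^+ 2 * \sum_(2 <= n < q) block_norm a n ^+ 2.
Proof.
move=> t0 hC; pose w := block_weight a theta.
have w0 n : 0 <= w n by exact: block_weight_ge0.
(* The weight of a good block with |b_n| >= 1; a smaller weight reveals |b_n| < 1. *)
pose c := (theta / 128) ^+ 2 / 4.
have c0 : 0 < c by rewrite divr_gt0 // exprn_gt0 // divr_gt0.
have cu : cvgn (fun q => \sum_(M <= n < M + q) w n).
  apply: nondecreasing_is_cvgn.
    move=> q q' qq /=; rewrite [leRHS](@big_cat_nat _ _ _ (M + q)) ?leq_addr ?leq_add2l //= lerDl.
    by apply: sumr_ge0 => n _; exact: w0.
  by exists C => _ [q _ <-]; exact: hC.
have [P hP] := cvg_oscillation c0 cu.
have wc n : (M + P <= n)%N -> w n < c.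
  move=> hn; have e : n = (M + (n - M))%N by rewrite subnKC // (leq_trans (leq_addr _ _) hn).
  have Pn : (P <= n - M)%N by rewrite leq_subRL // (leq_trans (leq_addr _ _) hn).
  have := hP (n - M)%N (n - M).+1 Pn (leqW Pn).
  rewrite addnS big_nat_recr ?leq_addr //= addrAC subrr add0r -e.
  by apply: le_lt_trans; exact: ler_norm.
pose n2 := (M + P + 3 + Num.bound (96 / theta))%N.
have pointwise n : (2 <= n)%N -> rotated a n 1 ^+ 2 <=
    w n / c + (theta ^+ 2 * block_norm a n ^+ 2 + 2 ^- n) +
    (if (n < n2)%N then rotated a n 1 ^+ 2 else 0).
  move=> _; have tb : 0 <= theta ^+ 2 * block_norm a n ^+ 2 by rewrite mulr_ge0 ?sqr_ge0.
  have p0 : 0 <= 2 ^- n :> R by rewrite invr_ge0 exprn_ge0.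
  have wn : 0 <= w n / c by rewrite divr_ge0 // ltW.
  case: ltnP => [h|h]; first by rewrite lerDr !addr_ge0.
  rewrite addr0; have n3 : (3 <= n)%N by apply: leq_trans h; rewrite /n2; lia.
  have t96 : 96 <= theta * n%:R.
    rewrite -ler_pdivrMl // mulrC; apply: ltW.
    apply: lt_le_trans (archi_boundP _) _; first by rewrite divr_ge0 // ltW.
    by rewrite ler_nat; apply: leq_trans h; exact: leq_addl.
  have [good|bad] := pselect (good_block a theta n); last first.
    by apply: le_trans (rotated_bad t0 n3 t96 bad) _; rewrite lerDr.
  apply: le_trans (rotated_le n) _; apply: (@le_trans _ _ (w n / c)); last first.
    by rewrite lerDl addr_ge0.
  have hw : w n = c * Num.min 1 (block_norm a n ^+ 2).
    by rewrite /w /block_weight asboolT // /c; field.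
  have : w n < c by apply: wc; apply: leq_trans h; rewrite /n2 -!addnA leq_add2l leq_addr.
  rewrite hw -[X in _ < X]mulr1 ltr_pM2l // gt_min ltxx /= => lt.
  by rewrite min_r ?(ltW lt) // mulrC mulKf ?gt_eqF.
exists ((\sum_(0 <= n < M) w n + C) / c + 2 + \sum_(0 <= n < n2) rotated a n 1 ^+ 2) => q.
apply: (@le_trans _ _ (\sum_(2 <= n < q) (w n / c + (theta ^+ 2 * block_norm a n ^+ 2 + 2 ^- n) +
    (if (n < n2)%N then rotated a n 1 ^+ 2 else 0)))).
  by apply: ler_sum_nat => n /andP[h _]; exact: pointwise.
rewrite !big_split /= -mulr_suml -mulr_sumr.
have h1 : \sum_(2 <= n < q) w n / c <= (\sum_(0 <= n < M) w n + C) / c.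
  rewrite -mulr_suml ler_pM2r ?invr_gt0 //.
  apply: (@le_trans _ _ (\sum_(0 <= n < M + q) w n)).
    have [q2|q2] := leqP 2 q; last first.
      by rewrite big_geq ?sumr_ge0 // ltnW.
    rewrite [leRHS](@big_cat_nat _ _ _ 2) //=; last by rewrite (leq_trans q2) ?leq_addl.
    rewrite [X in _ <= _ + X](@big_cat_nat _ _ _ q) ?leq_addl //=.
    by rewrite addrCA lerDl addr_ge0 // sumr_ge0.
  by rewrite (@big_cat_nat _ _ _ M) ?leq_addr //= lerD2l; exact: hC.
have h2 := sum_half_powers q.
have h3 : \sum_(2 <= n < q) (if (n < n2)%N then rotated a n 1 ^+ 2 else 0) <=
    \sum_(0 <= n < n2) rotated a n 1 ^+ 2.
  rewrite -big_mkcond /=.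
  apply: (@le_trans _ _ (\sum_(0 <= n < n2 + q | (n < n2)%N) rotated a n 1 ^+ 2)).
    have [q2|q2] := leqP 2 q; last first.
      by rewrite big_geq; [apply: sumr_ge0 => n _; exact: sqr_ge0 | exact: ltnW].
    rewrite [leRHS](@big_cat_nat _ _ _ 2) //=; last by rewrite (leq_trans q2) ?leq_addl.
    rewrite [X in _ <= _ + X](@big_cat_nat _ _ _ q) ?leq_addl //=.
    by rewrite addrCA lerDl addr_ge0 // sumr_ge0 // => n _; exact: sqr_ge0.
  rewrite (@big_cat_nat _ _ _ n2) ?leq_addr //=.
  rewrite [X in _ + X]big_nat_cond [X in _ + X]big1; last first.
    by move=> n /andP[/andP[h _] h']; move: h'; rewrite ltnNge h.
  rewrite addr0 big_nat_cond [leRHS]big_nat_cond le_eqVlt; apply/orP; left; apply/eqP.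
  by apply: eq_bigl => n; rewrite andbT; case: ltnP => //= _; rewrite !andbF.
by move: h1 h2 h3; rewrite -mulr_suml; lra.
Qed.

(** The blocks exhaust the coefficients, and the first block holds only finite energy. *)
Lemma infinite_energy : ~ in_l2 a ->
  forall C : R, exists q, C <= \sum_(2 <= n < q) block_norm a n ^+ 2.
Proof.
move=> nl2 C; apply: contrapT => /forallNP hq; apply: nl2.
have mu_block q : \sum_(1 <= l < (mu q).+1) a l ^+ 2 = \sum_(1 <= n < q.+1) block_norm a n ^+ 2.
  elim: q => [|q IH]; first by rewrite /mu [in LHS]big_geq // !big_geq.
  rewrite [RHS]big_nat_recr //= -IH -block_norm_sq.
  have e : mu q.+1 = (mu q + block_size q.+1)%N by rewrite /mu big_nat_recr.
  rewrite e (@big_cat_nat _ _ _ (mu q).+1) //= ?ltnS ?leq_addr //; congr (_ + _).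
  rewrite -(add1n (mu q)) big_addn.
  have -> : ((mu q + block_size q.+1).+1 - mu q = (block_size q.+1).+1)%N by lia.
  by apply: eq_big_nat => j _; rewrite /block_coef addnC.
apply: nondecreasing_is_cvgn.
  move=> q q' qq /=; rewrite [leRHS](@big_cat_nat _ _ _ q.+1) //= lerDl.
  by apply: sumr_ge0 => n _; exact: sqr_ge0.
exists (block_norm a 1 ^+ 2 + C) => _ [N _ <-].
apply: (@le_trans _ _ (\sum_(1 <= l < (mu N).+1) a l ^+ 2)).
  rewrite [leRHS](@big_cat_nat _ _ _ N.+1) ?ltnS ?mu_ge //= lerDl.
  by apply: sumr_ge0 => n _; exact: sqr_ge0.
rewrite mu_block; case: N => [|N].
  rewrite big_geq // addr_ge0 ?sqr_ge0 //; have := hq 0%N; rewrite big_geq //.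
  by move=> h; apply: ltW; rewrite ltNge; apply/negP => h'; apply: h.
rewrite big_ltn // lerD2l; apply: ltW; rewrite ltNge; apply/negP => h.
exact: hq h.
Qed.

End Dichotomy.

(** * One exceptional set for the whole construction *)

Section Sampling.
Context {R : realType}.
Variables (f : nat -> nat -> R -> R) (k : nat -> nat) (psi : nat -> R -> R).
Hypothesis f_system : forall r : nat, (2 <= r)%N -> menshov_system r (f r).

Lemma menshov_exceptional r i : (2 <= r)%N -> (i < 2 ^ r)%N ->
  exists2 X : set R, countable X & forall S, X `<=` exceptional S -> generic_shift S r i (f r i).
Proof.
move=> r2 iN; have [_ hf] := f_system r2; have [h1 h2 h3 _] := hf i iN.
have e21 : 2 - 1 = 1 :> R by lra.
have [X3 c3 hX3] := Estep_cells e21 h3.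
exists ([set x | (x \in `[-1, 1]) /\ f r i x != menshov_shift r i x] `|`
  [set x | (x \in `[-2, -1[) /\ f r i x != 0] `|` X3).
  by apply: countableU => //; apply: countableU; apply: finite_set_countable.
move=> S XS; have nX u : generic (exceptional S) u -> ~ (exceptional S) u by exact: generic_notin.
split.
- move=> u gu /andP[u1 u2]; apply/eqP/negPn/negP => ne; apply: (nX u gu); apply: XS.
  by left; left; split=> //; rewrite in_itv /= !ltW.
- move=> u gu /andP[u1 u2]; apply/eqP/negPn/negP => ne; apply: (nX u gu); apply: XS.
  by left; right; split=> //; rewrite in_itv /= u2 ltW.
- move=> u v gu gv /andP[u1 u2] /andP[v1 v2] e.
  have un z : generic (exceptional S) z -> 1 < z -> z < 2 -> unitg S (z - 1).
    move=> gz z1 z2; split; [lra|lra|].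
    by apply: genericD => //; apply: rationalN; exact: (rational_nat 1).
  have uu := un u gu u1 u2; have uv := un v gv v1 v2.
  apply: (hX3 (cell r.+1 (u - 1))).
  + by apply: cell_lt; apply/andP; split; lra.
  + by move=> Xu; apply: (nX u gu); apply: XS; right.
  + by move=> Xv; apply: (nX v gv); apply: XS; right.
  + exact/(cell_eqP _ _ uu).
  + by apply/(cell_eqP _ _ uv).
Qed.

Hypothesis g_Estep : forall n i, (1 <= n)%N -> (i < 2 ^ (2 * n))%N -> Estep 0 1 (k n) (g f k n i).
Hypothesis psi_Estep : forall n nu, (1 <= n)%N -> (m k n.-1 < nu <= m k n)%N ->
  Estep 0 1 (k n + 2) (psi nu).

Lemma exceptional_if (b : bool) (Q : sampling R -> Prop) :
  (b -> exists2 X : set R, countable X & forall S, X `<=` exceptional S -> Q S) ->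
  exists2 X : set R, countable X & forall S, X `<=` exceptional S -> b -> Q S.
Proof.
case: b => [/(_ isT)[X cX h]|_]; last by exists set0; first exact: countable0.
by exists X => // S XS _; exact: h.
Qed.

(** The functions involved are indexed by pairs of natural numbers, so their exceptions together
    with 0 still form a countable set, and a generic offset in (0, 1) exists. *)
Lemma exists_sampling : exists S : sampling R,
  [/\ forall r, (2 <= r)%N -> generic_menshov S r (f r),
      forall n i, (1 <= n)%N -> (i < 2 ^ (2 * n))%N -> stepf S (k n) (g f k n i) &
      forall n nu, (1 <= n)%N -> (m k n.-1 < nu <= m k n)%N -> stepf S (k n + 2) (psi nu)].
Proof.
have : forall u : nat * nat, exists X : set R, countable X /\ forall S, X `<=` exceptional S ->
    [/\ (2 <= u.1)%N && (u.2 < 2 ^ u.1)%N -> generic_shift S u.1 u.2 (f u.1 u.2),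
      (1 <= u.1)%N && (u.2 < 2 ^ (2 * u.1))%N -> stepf S (k u.1) (g f k u.1 u.2) &
      (1 <= u.1)%N && (m k u.1.-1 < u.2 <= m k u.1)%N -> stepf S (k u.1 + 2) (psi u.2)].
  move=> [r i] /=.
  have [|X1 c1 h1] := @exceptional_if ((2 <= r) && (i < 2 ^ r))%N
      (fun S => generic_shift S r i (f r i)).
    by move=> /andP[r2 iN]; exact: menshov_exceptional.
  have [|X2 c2 h2] := @exceptional_if ((1 <= r) && (i < 2 ^ (2 * r)))%N
      (fun S => stepf S (k r) (g f k r i)).
    by move=> /andP[r1 iN]; exact: Estep_stepf (g_Estep r1 iN).
  have [|X3 c3 h3] := @exceptional_if ((1 <= r) && (m k r.-1 < i <= m k r))%N
      (fun S => stepf S (k r + 2) (psi i)).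
    by move=> /andP[r1 iN]; exact: Estep_stepf (psi_Estep r1 iN).
  exists (X1 `|` X2 `|` X3); split; first by apply: countableU => //; exact: countableU.
  move=> S XS; split.
  - by apply: h1 => x Xx; apply: XS; left; left.
  - by apply: h2 => x Xx; apply: XS; left; right.
  - by apply: h3 => x Xx; apply: XS; right.
move=> /choice[X hX].
pose Z : set R := [set 0] `|` \bigcup_u X u.
have cZ : countable Z.
  apply: countableU; first exact: countable1.
  by apply: bigcup_countable => [|u _]; [exact: countableP | case: (hX u)].
have Z0 : Z 0 by left.
have [tau [t0 t1 gt]] := exists_generic cZ.
pose S := Sampling Z0 cZ t0 t1 gt.
have XS u : X u `<=` exceptional S by move=> x Xx; right; exists u.
exists S; split.
- by move=> r r2 i iN; have [_ h] := hX (r, i); have [h1 _ _] := h S (XS _); apply: h1; rewrite r2.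
- by move=> n i n1 iN; have [_ h] := hX (n, i); have [_ h1 _] := h S (XS _); apply: h1; rewrite n1.
- move=> n nu n1 hn; have [_ h] := hX (n, nu); have [_ _ h1] := h S (XS _).
  by apply: h1; rewrite n1.
Qed.

End Sampling.

Theorem theorem12 (R : realType)
    (f : nat -> nat -> R -> R) (k : nat -> nat)
    (psi xi Upsilon : nat -> R -> R)
    (f_system : forall r : nat, (2 <= r)%N -> menshov_system r (f r))
    (k_smallest : forall n : nat, (1 <= n)%N -> is_smallest_level f k n (k n))
    (psi_first : eq_fin `[0, 1] (psi 1%N) (fun=> 1))
    (psi_basis : forall n : nat, (1 <= n)%N ->
       orthonormal_basis 0 1 (psi_space f k n) (m k n.-1) (m k n) psi)
    (xi_def : forall n nu j : nat, (1 <= n)%N ->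
       (m k n.-1 + 1 <= nu <= m k n)%N -> (1 <= j <= p k n)%N ->
       xi (rhonu k n nu + j)%N = phi k psi n nu j)
    (Upsilon_def : forall n j : nat, (1 <= n)%N ->
       (1 <= j <= 2 ^ (2 * n) + 1)%N ->
       Upsilon (mu n.-1 + j)%N = upsilon f k xi n j) :
  divergence_system Upsilon.
Proof.
have gE n i : (1 <= n)%N -> (i < 2 ^ (2 * n))%N -> Estep 0 1 (k n) (g f k n i).
  by move=> n1 iN; have [[_ h] _] := k_smallest n n1; exact: h.
have psiE n nu : (1 <= n)%N -> (m k n.-1 < nu <= m k n)%N -> Estep 0 1 (k n + 2) (psi nu).
  move=> n1 hn; have [_ hV _] := psi_basis n n1; have [ha _ _ _] := hV nu hn.
  by move: ha; rewrite /psi_ambient; case: eqP => [->|] // _ [].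
have [S [gf gS psiS]] := exists_sampling f_system gE psiE.
have [lx [xiS xiM xi_g]] := xi_system gf f_system gS gE psiS psi_basis xi_def.
have ggM L n i n' i' : (1 <= n)%N -> (1 <= n')%N ->
    (i < 2 ^ (2 * n))%N -> (i' < 2 ^ (2 * n'))%N -> (k n <= L)%N -> (k n' <= L)%N ->
    av S L (fun x => g f k n i x * g f k n' i' x) = ((n == n') && (i == i'))%:R.
  move=> n1 n1' iN iN' kL kL'.
  have v : bvalid k (inr (inr (n, i))) by rewrite /= n1.
  have v' : bvalid k (inr (inr (n', i'))) by rewrite /= n1'.
  exact: (base_orthonormal gf f_system gS gE psiS psi_basis v v' kL kL').
have xi0 := @xi_cvg0 R S f k psi xi gf f_system gS gE psiS psi_basis xi_def.
split; first exact: (upsilon_orthonormal gS xiS xiM xi_g ggM Upsilon_def).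
move=> a al2.
suff null : (@lebesgue_measure R).-negligible
    ([set x | cvgn (fun N : nat => \sum_(1 <= l < N.+1) a l * Upsilon l x)] `&`
     [set x | 0 <= x <= 1]).
  apply: negligibleS null => x /= /not_implyP[]; rewrite in_itv /= => x01 /contrapT cx.
  by split.
(* Divergence is asked from every starting block because the null set is a union over the block
   after which no event occurs. The negation bounds the weights from a single M on, for each
   theta. *)
have [[theta [t0 large]]|small] := pselect (exists theta : R, 0 < theta /\
    forall M (C : R), exists q, C <= \sum_(M <= n < M + q) block_weight a theta n).
  exact: (large_mean_negligible gf f_system gS xi0 Upsilon_def t0 large).
apply: (small_mean_negligible gf f_system gS xiS xiM Upsilon_def); last exact: infinite_energy.
move=> theta t0; have : ~ (forall M (C : R), exists q,
    C <= \sum_(M <= n < M + q) block_weight a theta n).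
  by move=> h; apply: small; exists theta.
move=> /existsNP[M /existsNP[C /forallNP hC]].
apply: (@small_mean_of_bounded R a theta M C t0) => q.
by apply: ltW; rewrite ltNge; apply/negP; exact: hC.
Qed.
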